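(* Let $P_0$ be a centered, isotropic probability distribution on $\mathbb R^d$, and let $P$ and $Q$ lie in the corresponding location-scale family: $P=\mathrm{Law}(m_P+\Sigma_P^{1/2}X_0)$ and $Q=\mathrm{Law}(m_Q+\Sigma_Q^{1/2}X_0)$ for $X_0\sim P_0$, with $m_P,m_Q\in\mathbb R^d$ and covariance matrices $\Sigma_P,\Sigma_Q$. Assume that $P_0$ satisfies a Poincaré inequality ($\mathrm{Var}_{P_0}(f)\le C_{\mathtt{PI}}\int\|\nabla f\|^2dP_0$ for every differentiable $f:\mathbb R^d\to\mathbb R$, with $C_{\mathtt{PI}}<\infty$) and has a bounded density along every direction in $\mathbb R^d$. Let $$\phi_0(x)=\tfrac12(x-m_P)^\top\Big(\Sigma_P^{-1/2}(\Sigma_P^{1/2}\Sigma_Q\Sigma_P^{1/2})^{1/2}\Sigma_P^{-1/2}\Big)(x-m_P)+m_Q^\top x$$ be the optimal Brenier potential, so that $\nabla\phi_0$ is the optimal transport map from $P$ to $Q$, and let $$\mathcal F_{\mathrm{quad}}=\{x\mapsto\tfrac12x^\top Bx+\langle b,x\rangle:\ B\in\mathbb R^{d\times d}\ \text{symmetric positive semidefinite},\ b\in\mathbb R^d\}.$$ Then $$\mathbb E\|\nabla\hat\phi_{\mathcal F_{\mathrm{quad}}}-\nabla\phi_0\|^2_{L^2(P)}\lesssim_{\log n}n^{-1}.$$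
   Context: $d\ge2$. $u\lesssim_{\log n}v$ means $u\le Cv$ for a constant $C>0$ independent of $n$, up to polylogarithmic factors in $n$. From i.i.d. samples $X_1,\dots,X_n\sim P$ and independent i.i.d. samples $Y_1,\dots,Y_n\sim Q$ with empirical measures $P_n,Q_n$, $\hat\phi_{\mathcal F}\in\arg\min_{\phi\in\mathcal F}\int\phi\,dP_n+\int\phi^*\,dQ_n$ is a measurable minimizer, where $\phi^*(y)=\sup_x\{\langle x,y\rangle-\phi(x)\}$. Isotropic means identity covariance. ''Bounded density along every direction'' means that for each unit vector $e$ the law of $\langle e,X_0\rangle$, $X_0\sim P_0$, has a bounded density. $\|f\|_{L^2(P)}^2=\int\|f\|^2dP$. The formula for $\phi_0$ presupposes that $\Sigma_P$ is invertible.
   Formalization: The bound on the densities of ⟨e,X_0⟩ is taken uniform over unit vectors e (with direction-dependent bounds the claim fails), and the rate is stated for n ≥ n_0, with n_0 depending on d, P_0, P, Q (for small n minimizers may be missing or non-unique). *)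

(* Defs.v *)
(* MathComp-Analysis; R^d is the space of column vectors 'cV[R]_d. *)
From HB Require Import structures.
From mathcomp Require Import all_boot all_order all_algebra.
From mathcomp Require Import all_classical all_reals all_analysis.

Set Implicit Arguments.
Unset Strict Implicit.
Unset Printing Implicit Defensive.

Import Order.TTheory GRing.Theory Num.Theory.
Import numFieldNormedType.Exports.

Local Open Scope classical_set_scope.
Local Open Scope ring_scope.

(* Borel sigma-algebra of the topology that matrix_topology puts on 'M[R]_(m, n). *)
HB.instance Definition _ (R : realType) (m n : nat) :=
  @isMeasurable.Build (sigma_display (@open 'M[R]_(m, n))) 'M[R]_(m, n)
    <<s (@open 'M[R]_(m, n)) >>
    (@sigma_algebra0 _ setT (@open 'M[R]_(m, n)))
    (@sigma_algebraC _ (@open 'M[R]_(m, n)))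
    (@sigma_algebra_bigcup _ setT (@open 'M[R]_(m, n))).

Section euclidean.
Context {R : realType} {d : nat}.
Implicit Types (u v x y : 'cV[R]_d) (A S B : 'M[R]_d).

Definition dotv u v : R := (u^T *m v) 0 0.

(* The norm `|v| of the library is the sup norm, hence this definition. *)
Definition sqnorm v : R := dotv v v.

Definition psdmx A : Prop :=
  A^T = A /\ forall x, 0 <= dotv x (A *m x).

(* The square root S of A with S psd; it exists and is unique when A is psd,
   and the default value 0 is only used for other A. *)
Definition sqrtmx A : 'M[R]_d :=
  xget 0 [set S : 'M[R]_d | psdmx S /\ S *m S = A].

Definition grad (f : 'cV[R]_d -> R) x : 'cV[R]_d :=
  \col_(i < d) 'D_(delta_mx i 0 : 'cV[R]_d) f x.

Definition conjugate (phi : 'cV[R]_d -> R) y : \bar R :=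
  ereal_sup [set (dotv x y - phi x)%:E | x in [set: 'cV[R]_d]].

Definition F_quad : set ('cV[R]_d -> R) :=
  [set phi | exists (B : 'M[R]_d) (b : 'cV[R]_d), psdmx B /\
    phi = (fun x => 2^-1 * dotv x (B *m x) + dotv b x)].

Definition L2sq (mu : set 'cV[R]_d -> \bar R) (f : 'cV[R]_d -> 'cV[R]_d) :
    \bar R :=
  (\int[mu]_x (sqnorm (f x))%:E)%E.

End euclidean.

Section distributions.
Context {R : realType} {d : nat}.
Implicit Types P : probability 'cV[R]_d R.

Definition centered P : Prop :=
  forall i : 'I_d, ('E_P[fun x : 'cV[R]_d => (x i 0)%R] = 0)%E.

Definition isotropic P : Prop :=
  forall i j : 'I_d,
    covariance P (fun x : 'cV[R]_d => x i 0) (fun x : 'cV[R]_d => x j 0)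
    = ((i == j)%:R : R)%:E.

(* P = Law (m + S^(1/2) X0) for X0 ~ P0. *)
Definition location_scale P (m : 'cV[R]_d) (S : 'M[R]_d) P0 : Prop :=
  forall A : set 'cV[R]_d, measurable A ->
    P A = pushforward P0 (fun x : 'cV[R]_d => m + sqrtmx S *m x) A.

(* Both sides are extended reals: a non-square-integrable f has variance +oo,
   so the inequality then asserts that its Dirichlet energy is infinite. *)
Definition poincare P : Prop :=
  exists CPI : R, forall f : 'cV[R]_d -> R,
    (forall x, differentiable f x) ->
    ('V_P[f] <= CPI%:E * \int[P]_x (sqnorm (grad f x))%:E)%E.

(* The density p depends on the unit direction e, but its bound M does not: a
   pointwise finite bound that is unbounded in e gives no control on the small
   eigenvalues of an empirical covariance. *)
Definition bounded_directional_density P : Prop :=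
  exists M : R, forall e : 'cV[R]_d, sqnorm e = 1 ->
    exists p : R -> R,
      [/\ measurable_fun setT p,
          forall t, 0 <= p t <= M &
          forall A : set R, measurable A ->
            P [set x | A (dotv e x)]
            = (\int[lebesgue_measure]_(t in A) (p t)%:E)%E].

Definition brenier_mx (SP SQ : 'M[R]_d) : 'M[R]_d :=
  invmx (sqrtmx SP) *m sqrtmx (sqrtmx SP *m SQ *m sqrtmx SP)
    *m invmx (sqrtmx SP).

Definition brenier_potential (mP mQ : 'cV[R]_d) (SP SQ : 'M[R]_d)
    (x : 'cV[R]_d) : R :=
  2^-1 * dotv (x - mP) (brenier_mx SP SQ *m (x - mP)) + dotv mQ x.

End distributions.

Section empirical_measure.
Local Open Scope ereal_scope.
Context {dT} {T : measurableType dT} {R : realType} {n : nat}.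
Variable x : 'I_n -> T.

Definition empirical (A : set T) : \bar R :=
  (n%:R^-1)%R%:E * \sum_(i < n) \d_(x i) A.

Let empirical0 : empirical set0 = 0.
Proof.
rewrite /empirical big1 ?mule0// => i _; exact: measure0.
Qed.

Let empirical_ge0 A : 0 <= empirical A.
Proof.
by apply: mule_ge0; [rewrite lee_fin invr_ge0 | apply: sume_ge0].
Qed.

Let empirical_sigma_additive : semi_sigma_additive empirical.
Proof.
pose m (k : nat) : {measure set T -> \bar R} :=
  if insub k is Some i then \d_(x i) else mzero.
have E : empirical = mscale ((n%:R^-1 : R)%:nng)%R (msum m n).
  apply/funext => A; rewrite /empirical /mscale /= /msum; congr (_ * _).
  by apply: eq_bigr => i _; rewrite /m valK.
by rewrite E; exact: measure_semi_sigma_additive.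
Qed.

HB.instance Definition _ := isMeasure.Build _ _ _ empirical
  empirical0 empirical_ge0 empirical_sigma_additive.

End empirical_measure.

Section sampling.
Context {R : realType} {dO dT : measure_display}
  {Omega : measurableType dO} {T : measurableType dT}.
Variable Pr : probability Omega R.

(* Since A i = setT is allowed, the product rule for each finite subfamily is
   included. *)
Definition mutually_independent (I : finType) (Z : I -> {RV Pr >-> T}) : Prop :=
  forall A : I -> set T, (forall i, measurable (A i)) ->
    Pr (\bigcap_i (Z i @^-1` A i)) = (\prod_i Pr (Z i @^-1` A i))%E.

Definition has_law (Z : {RV Pr >-> T}) (P : probability T R) : Prop :=
  forall A, measurable A -> distribution Pr Z A = P A.

(* Both samples are i.i.d., and independent of each other. *)
Definition two_samples (P Q : probability T R) (n : nat)
    (X Y : 'I_n -> {RV Pr >-> T}) : Prop :=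
  [/\ forall i, has_law (X i) P,
      forall i, has_law (Y i) Q &
      mutually_independent (fun k : 'I_n + 'I_n =>
        match k with inl i => X i | inr j => Y j end)].

End sampling.

Section estimation.
Context {R : realType} {d : nat}.

Definition semidual (mu nu : set 'cV[R]_d -> \bar R) (phi : 'cV[R]_d -> R) :
    \bar R :=
  (\int[mu]_x (phi x)%:E + \int[nu]_y conjugate phi y)%E.

Definition is_argmin (F : set ('cV[R]_d -> R)) (J : ('cV[R]_d -> R) -> \bar R)
    (phi : 'cV[R]_d -> R) : Prop :=
  F phi /\ forall psi, F psi -> (J phi <= J psi)%E.

(* phihat is a random element of F that is almost surely an empirical
   minimizer. "Almost surely" matters: for degenerate samples the infimum over
   F_quad need not be attained. *)
Definition empirical_minimizer (F : set ('cV[R]_d -> R)) (dO : measure_display)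
    (Omega : measurableType dO) (Pr : probability Omega R) (n : nat)
    (X Y : 'I_n -> {RV Pr >-> 'cV[R]_d})
    (phihat : Omega -> 'cV[R]_d -> R) : Prop :=
  [/\ forall w, F (phihat w),
      forall x, measurable_fun setT (fun w => phihat w x) &
      {ae Pr, forall w,
        is_argmin F
          (semidual (empirical (fun i => X i w)) (empirical (fun i => Y i w)))
          (phihat w)}].

End estimation.

(* Main.v *)
Require Import Defs.
From HB Require Import structures.
From mathcomp Require Import all_boot all_order all_algebra.
From mathcomp Require Import all_classical all_reals all_analysis.
From mathcomp Require Import measurable_realfun ring lra zify complex spectral.

(** Put z = SP^(-1/2) (x - mP) and u = SP^(1/2) (y - mQ).  In these coordinates
    the first sample has law P0 and the second one is centered with covariance
    A A, where A = (SP^(1/2) SQ SP^(1/2))^(1/2) is the Hessian of the Brenier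
    potential.

    The estimator is nearly explicit.  An empirical minimizer x |-> x.Bx/2 + b.x
    is stationary under translations of b and under rank-one changes of B, and
    this says that its gradient carries the empirical mean and covariance of
    the first sample to those of the second ([optimal_mean], [optimal_cov]).
    In the new coordinates B cov(z) B = cov(u), where cov(z) is close to the
    identity and cov(u) to A A, so that B is an approximate square root of A A.
    Matrix square roots are Lipschitz at A, even for a singular A, as long as B
    vanishes on the kernel of A ([psd_sqrt_error]); this holds because the second
    sample almost surely lies in an affine subspace parallel to the range of
    SQ^(1/2) ([sample_range], [std_range]).  Hence the squared loss is controlled
    by the squared deviations U and V of the first two empirical moments of the
    two samples.  These have expectation O(1/n), because the Poincare inequality
    applied to the squares of the coordinates gives P0 a finite fourth moment
    ([fourth_moment], [fluct_integral]).

    This control fails when cov(z) is nearly singular, and an expectation has to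
    survive that event.  The first sample is split into a group of fixed size,
    which depends only on the dimension, and two halves of the rest.  If the
    deviation of one of the halves is small, cov(z) is bounded below.  With U2
    and U3 the deviations of the two halves, the opposite case costs a factor
    U2 U3, whose expectation is O(1/n^2) by independence, and there the loss is
    bounded by n (1 + V) times an inverse power of the spread of the small group
    ([pathwise_loss]).  That inverse power is integrable: if the small group
    has spread 2^-j in some direction, all its points lie in a slab of that
    width, one of O(8^(j (d+1))) slabs of a net, and by the bounded densities
    each slab contains the whole group with probability O(2^(-j N)), N being the
    size of the group ([bad_event_prob], [degeneracy_integral]).  The samples and the
    three groups are independent, so that the expectation of the product
    factorizes ([majorant_integral]), and n times O(1/n^2) is O(1/n).  The rate
    is thus 1/n without a logarithm. *)

Set Implicit Arguments.
Unset Strict Implicit.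
Unset Printing Implicit Defensive.

Import Order.TTheory GRing.Theory Num.Theory.
Import numFieldNormedType.Exports.

Local Open Scope classical_set_scope.
Local Open Scope ring_scope.

(** * Euclidean and Frobenius norms *)

Section euclid.
Context {R : realType}.

Section dot.
Context {d : nat}.
Implicit Types (u v w : 'cV[R]_d) (A B : 'M[R]_d) (a : R).

Lemma dotvE u v : dotv u v = \sum_i u i 0 * v i 0.
Proof. by rewrite /dotv !mxE; apply: eq_bigr => i _; rewrite mxE. Qed.

Lemma dotvC u v : dotv u v = dotv v u.
Proof. by rewrite !dotvE; apply: eq_bigr => i _; rewrite mulrC. Qed.

Lemma dotvDr u v w : dotv u (v + w) = dotv u v + dotv u w.
Proof. by rewrite /dotv mulmxDr mxE. Qed.

Lemma dotvZr u a v : dotv u (a *: v) = a * dotv u v.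
Proof. by rewrite /dotv -scalemxAr mxE. Qed.

Lemma dotvDl u v w : dotv (u + v) w = dotv u w + dotv v w.
Proof. by rewrite ![dotv _ w]dotvC dotvDr. Qed.

Lemma dotvZl u a v : dotv (a *: u) v = a * dotv u v.
Proof. by rewrite ![dotv _ v]dotvC dotvZr. Qed.

Lemma dotvNr u v : dotv u (- v) = - dotv u v.
Proof. by rewrite -scaleN1r dotvZr mulN1r. Qed.

Lemma dotvNl u v : dotv (- u) v = - dotv u v.
Proof. by rewrite dotvC dotvNr dotvC. Qed.

Lemma dotvBr u v w : dotv u (v - w) = dotv u v - dotv u w.
Proof. by rewrite dotvDr dotvNr. Qed.

Lemma dotvBl u v w : dotv (u - v) w = dotv u w - dotv v w.
Proof. by rewrite dotvDl dotvNl. Qed.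

Lemma dotv0r u : dotv u 0 = 0.
Proof. by rewrite /dotv mulmx0 mxE. Qed.

Lemma dotv0l u : dotv 0 u = 0.
Proof. by rewrite dotvC dotv0r. Qed.

Lemma sqnormE u : sqnorm u = \sum_i u i 0 ^+ 2.
Proof. by rewrite /sqnorm dotvE. Qed.

Lemma sqnorm_ge0 u : 0 <= sqnorm u.
Proof. by rewrite sqnormE sumr_ge0// => i _; exact: sqr_ge0. Qed.

Lemma sqnorm_eq0 u : sqnorm u = 0 -> u = 0.
Proof.
rewrite sqnormE => /eqP; rewrite psumr_eq0 => [|i _]; last exact: sqr_ge0.
move=> /allP u0; apply/colP => i; rewrite mxE.
by apply/eqP; rewrite -sqrf_eq0 (implyP (u0 i (mem_index_enum _))).
Qed.

Lemma sqnormD_le u v : sqnorm (u + v) <= 2 * sqnorm u + 2 * sqnorm v.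
Proof.
rewrite -subr_ge0 [leRHS](_ : _ = sqnorm (u - v)) ?sqnorm_ge0//.
by rewrite /sqnorm !(dotvDl, dotvDr, dotvNl, dotvNr) [dotv v u]dotvC; ring.
Qed.

Lemma sqnormN u : sqnorm (- u) = sqnorm u.
Proof. by rewrite /sqnorm dotvNl dotvNr opprK. Qed.

Lemma sqnormZ a u : sqnorm (a *: u) = a ^+ 2 * sqnorm u.
Proof. by rewrite /sqnorm dotvZl dotvZr mulrA. Qed.

End dot.

Lemma dotv_mull m n (A : 'M[R]_(m, n)) (u : 'cV[R]_m) (v : 'cV[R]_n) :
  dotv u (A *m v) = dotv (A^T *m u) v.
Proof. by rewrite /dotv trmx_mul trmxK mulmxA. Qed.

Lemma dotv_sym n (A : 'M[R]_n) (u v : 'cV[R]_n) : A^T = A ->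
  dotv u (A *m v) = dotv (A *m u) v.
Proof. by move=> At; rewrite dotv_mull At. Qed.

Lemma eq_leR (x y : R) : x = y -> x <= y.
Proof. by move=> ->. Qed.

(** A quadratic function of t that is nowhere negative has a nonpositive
    discriminant; for c = 0 it is affine and then b = 0. *)
Lemma discr_le (a b c : R) : 0 <= c ->
  (forall t, 0 <= a + 2 * t * b + t ^+ 2 * c) -> b ^+ 2 <= a * c.
Proof.
rewrite le_eqVlt => /predU1P[<- h|c0 h].
  rewrite mulr0; have [->|b0] := eqVneq b 0; first by rewrite expr0n.
  have := h (- (a + 1) / (2 * b)).
  have -> : a + 2 * (- (a + 1) / (2 * b)) * b + (- (a + 1) / (2 * b)) ^+ 2 * 0
            = - 1 by field.
  lra.
have := h (- b / c).
have -> : a + 2 * (- b / c) * b + (- b / c) ^+ 2 * c = a - b ^+ 2 / c.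
  by field; rewrite gt_eqF.
by rewrite subr_ge0 ler_pdivrMr.
Qed.

Lemma psd_CS n (A : 'M[R]_n) (u v : 'cV[R]_n) : psdmx A ->
  (dotv u (A *m v)) ^+ 2 <= dotv u (A *m u) * dotv v (A *m v).
Proof.
move=> [At A0]; apply: discr_le => [|t]; first exact: A0.
have := A0 (u + t *: v).
rewrite mulmxDr -scalemxAr !(dotvDl, dotvDr, dotvZl, dotvZr).
rewrite [dotv v (A *m u)]dotv_sym// [dotv (A *m v) u]dotvC.
by move=> h; apply: le_trans h _; apply: eq_leR; ring.
Qed.

Lemma psdmx1 n : psdmx (1%:M : 'M[R]_n).
Proof. by split; rewrite ?trmx1// => x; rewrite mul1mx sqnorm_ge0. Qed.

Lemma dotv_CS n (u v : 'cV[R]_n) : (dotv u v) ^+ 2 <= sqnorm u * sqnorm v.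
Proof. by have := psd_CS u v (psdmx1 n); rewrite !mul1mx. Qed.

Definition frob2 m n (A : 'M[R]_(m, n)) : R := \sum_i \sum_j A i j ^+ 2.

Lemma frob2_ge0 m n (A : 'M[R]_(m, n)) : 0 <= frob2 A.
Proof. by do 2!apply: sumr_ge0 => ? _; exact: sqr_ge0. Qed.

Lemma frob2_col m n (A : 'M[R]_(m, n)) : frob2 A = \sum_k sqnorm (col k A).
Proof.
rewrite /frob2 exchange_big; apply: eq_bigr => i _.
by rewrite sqnormE; apply: eq_bigr => j _; rewrite mxE.
Qed.

Lemma frob2_tr m n (A : 'M[R]_(m, n)) : frob2 A = \tr (A^T *m A).
Proof.
rewrite frob2_col; apply: eq_bigr => i _.
by rewrite sqnormE mxE; apply: eq_bigr => j _; rewrite !mxE expr2.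
Qed.

Lemma frob2Z m n (t : R) (A : 'M[R]_(m, n)) : frob2 (t *: A) = t ^+ 2 * frob2 A.
Proof.
rewrite /frob2 mulr_sumr; apply: eq_bigr => i _; rewrite mulr_sumr.
by apply: eq_bigr => j _; rewrite mxE exprMn.
Qed.

Lemma frob2N m n (A : 'M[R]_(m, n)) : frob2 (- A) = frob2 A.
Proof. by rewrite -scaleN1r frob2Z sqrrN expr1n mul1r. Qed.

Lemma frob2D_le m n (A B : 'M[R]_(m, n)) :
  frob2 (A + B) <= 2 * frob2 A + 2 * frob2 B.
Proof.
rewrite /frob2 !mulr_sumr -big_split/=; apply: ler_sum => i _.
rewrite !mulr_sumr -big_split/=; apply: ler_sum => j _; rewrite mxE.
by have := sqr_ge0 (A i j - B i j); nra.
Qed.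

Lemma trCS m n (A B : 'M[R]_(m, n)) :
  (\tr (A^T *m B)) ^+ 2 <= frob2 A * frob2 B.
Proof.
apply: discr_le => [|t]; first exact: frob2_ge0.
apply: le_trans (frob2_ge0 (A + t *: B)) _; apply: eq_leR.
have trE (X Y : 'M[R]_(m, n)) : \tr (X^T *m Y) = \sum_i \sum_j X i j * Y i j.
  rewrite exchange_big; apply: eq_bigr => j _; rewrite mxE.
  by apply: eq_bigr => i _; rewrite mxE.
rewrite trE /frob2 !mulr_sumr -!big_split/=; apply: eq_bigr => i _.
rewrite !mulr_sumr -!big_split/=; apply: eq_bigr => j _; rewrite !mxE.
by ring.
Qed.

Lemma tr_sqr_le n (A : 'M[R]_n) : (\tr A) ^+ 2 <= n%:R * frob2 A.
Proof.
have := trCS 1%:M A; rewrite trmx1 mul1mx => /le_trans; apply; apply: eq_leR.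
by rewrite [frob2 1%:M]frob2_tr trmx1 mul1mx mxtrace1.
Qed.

Lemma sqnorm_mulmx_le m n (A : 'M[R]_(m, n)) (v : 'cV[R]_n) :
  sqnorm (A *m v) <= frob2 A * sqnorm v.
Proof.
rewrite [sqnorm (_ *m _)]sqnormE /frob2 mulr_suml; apply: ler_sum => i _.
have := dotv_CS (row i A)^T v; rewrite /dotv trmxK -row_mul mxE.
move=> /le_trans; apply; apply: eq_leR; congr (_ * _).
by rewrite sqnormE; apply: eq_bigr => j _; rewrite !mxE.
Qed.

Lemma frob2M_le m n p (A : 'M[R]_(m, n)) (B : 'M[R]_(n, p)) :
  frob2 (A *m B) <= frob2 A * frob2 B.
Proof.
rewrite [frob2 (A *m B)]frob2_col [frob2 B]frob2_col mulr_sumr.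
apply: ler_sum => k _; rewrite [col k (A *m B)]colE -mulmxA -colE.
exact: sqnorm_mulmx_le.
Qed.

End euclid.

(** * Square roots of positive semidefinite matrices *)

Section sqrt.
Context {R : realType}.

(** Makes a function of a matrix with finitely many eigenvalues a polynomial in
    that matrix, so that it stays real and symmetric. *)
Lemma interpolation (F : fieldType) (s : seq F) (y : F -> F) :
  exists q : {poly F}, forall x, x \in s -> q.[x] = y x.
Proof.
elim: s => [|a s [q qy]]; first by exists 0.
have [as_|nas] := boolP (a \in s).
  by exists q => x; rewrite inE => /predU1P[->|]; exact: qy.
pose w := \prod_(b <- s) ('X - b%:P).
have wa : w.[a] != 0 by rewrite -/(root w a) root_prod_XsubC.
exists (q + ((y a - q.[a]) / w.[a])%:P * w) => x.
rewrite inE => /predU1P[->|xs].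
  by rewrite !hornerE/= divfK// addrC subrK.
have /eqP wx : root w x by rewrite root_prod_XsubC.
by rewrite !hornerE/= wx mulr0 addr0 qy.
Qed.

Lemma trmx_horner_mx (F : comNzRingType) n (A : 'M[F]_n.+1) (p : {poly F}) :
  (horner_mx A p)^T = horner_mx A^T p.
Proof.
elim/poly_ind: p => [|p a IH]; first by rewrite !rmorph0 trmx0.
rewrite !rmorphD !rmorphM/= !horner_mx_C !horner_mx_X linearD/= tr_scalar_mx.
rewrite -[X in (X)^T]/(horner_mx A p *m A) trmx_mul IH.
by congr (_ + _); apply: comm_mx_horner.
Qed.

Let toC (x : R) : R[i] := (x%:C)%C.

(** The spectral theorem is applied over the complex numbers; the real or the
    imaginary part of an eigenvector is a nonzero real eigenvector, on which the
    form of A has the sign of the eigenvalue. *)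
Lemma psd_spectral_ge0 n (A : 'M[R]_n.+1) (P : 'M[R[i]]_n.+1) (r : 'rV[R]_n.+1) :
  psdmx A -> P \in unitmx ->
  map_mx toC A = invmx P *m diag_mx (map_mx toC r) *m P ->
  forall j, 0 <= r 0 j.
Proof.
move=> [At A0] Pu AE j.
pose v := col j (invmx P).
have Av : map_mx toC A *m v = toC (r 0 j) *: v.
  rewrite AE /v colE -!mulmxA [P *m _]mulmxA mulmxV// mul1mx.
  rewrite scalemxAr; congr (_ *m _).
  apply/matrixP => a b; rewrite mul_diag_mx !mxE.
  by have [->|] := eqVneq a j; rewrite ?mulr0.
pose a := map_mx (@complex.Re R) v; pose b := map_mx (@complex.Im R) v.
have Re_toC (x : R) (z : R[i]) : complex.Re (toC x * z) = x * complex.Re z.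
  by case: z => p q; rewrite /toC /=; ring.
have Im_toC (x : R) (z : R[i]) : complex.Im (toC x * z) = x * complex.Im z.
  by case: z => p q; rewrite /toC /=; ring.
have Aa : A *m a = r 0 j *: a.
  apply/matrixP => i k; have /matrixP/(_ i k)/(congr1 (@complex.Re R)) := Av.
  rewrite !mxE raddf_sum => E.
  transitivity (complex.Re (toC (r 0 j) * invmx P i j)); last exact: Re_toC.
  by rewrite -E; apply: eq_bigr => l _; rewrite !mxE; exact/esym/Re_toC.
have Ab : A *m b = r 0 j *: b.
  apply/matrixP => i k; have /matrixP/(_ i k)/(congr1 (@complex.Im R)) := Av.
  rewrite !mxE raddf_sum => E.
  transitivity (complex.Im (toC (r 0 j) * invmx P i j)); last exact: Im_toC.
  by rewrite -E; apply: eq_bigr => l _; rewrite !mxE; exact/esym/Im_toC.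
have key (u : 'cV[R]_n.+1) : A *m u = r 0 j *: u -> u != 0 -> 0 <= r 0 j.
  move=> Au u0; have := A0 u; rewrite Au dotvZr pmulr_lge0//.
  rewrite lt_neqAle sqnorm_ge0 andbT eq_sym.
  by apply: contra_neq u0; exact: sqnorm_eq0.
have [a0|/(key _ Aa)//] := eqVneq a 0.
have [b0|/(key _ Ab)//] := eqVneq b 0.
have v0 : v = 0.
  apply/matrixP => i k; rewrite [RHS]mxE.
  have ak : a i k = 0 by rewrite a0 mxE.
  have bk : b i k = 0 by rewrite b0 mxE.
  move: ak bk; rewrite [a i k]mxE [b i k]mxE.
  by case: (v i k) => x y /= -> ->.
have : P *m v = 0 by rewrite v0 mulmx0.
rewrite /v colE mulmxA mulmxV// mul1mx => /matrixP/(_ j 0).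
by rewrite !mxE !eqxx => /eqP; rewrite oner_eq0.
Qed.

(** The square root is the square of q(A), where q is a real polynomial that
    interpolates the fourth root on the spectrum. *)
Lemma psd_sqrt_exists n (A : 'M[R]_n) : psdmx A ->
  exists S, psdmx S /\ S *m S = A.
Proof.
case: n A => [|n] A Apsd.
  by exists A; split => //; rewrite [LHS]flatmx0 [RHS]flatmx0.
have [At A0] := Apsd.
pose Ac := map_mx toC A.
have Aherm : Ac \is hermsymmx.
  apply: realsym_hermsym.
    apply/is_hermitianmxP; rewrite scale1r map_mx_id//.
    by apply/matrixP => i j; rewrite !mxE -{1}At mxE.
  by apply/mxOverP => i j; rewrite mxE complex_real.
have /orthomx_spectralP AE := hermitian_normalmx Aherm.
have spr := hermitian_spectral_diag_real Aherm.
set P := spectralmx Ac in AE; have Pu : P \in unitmx := spectral_unit _.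
pose r := map_mx (@complex.Re R) (spectral_diag Ac).
have rE : spectral_diag Ac = map_mx toC r.
  apply/matrixP => i j; rewrite !mxE.
  have /mxOverP/(_ i j) := spr.
  by case/complex_realP => x ->.
rewrite rE in AE; clearbody r.
have r0 := psd_spectral_ge0 Apsd Pu AE.
have [q qE] := interpolation [seq r 0 j | j <- enum 'I_n.+1]
  (fun x => Num.sqrt (Num.sqrt x)).
have q4 j : (q ^+ 4).[r 0 j] = r 0 j.
  rewrite horner_exp qE; last by apply/mapP; exists j; rewrite ?mem_enum.
  by rewrite (exprM _ 2 2) sqr_sqrtr ?sqrtr_ge0// sqr_sqrtr.
have A4 : horner_mx A (q ^+ 4) = A.
  apply: (@map_mx_inj _ _ (real_complex R : {rmorphism R -> R[i]})).
  pose f : {rmorphism R -> R[i]} := real_complex R.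
  apply: etrans (map_horner_mx f A (q ^+ 4)) _.
  change (horner_mx Ac (map_poly f (q ^+ 4)) = Ac).
  rewrite {1}AE.
  rewrite (horner_mx_uconjC _ _ Pu).
  rewrite horner_mx_diag.
  rewrite [RHS]AE.
  have -> // : map_mx (horner (map_poly f (q ^+ 4))) (map_mx toC r) = map_mx toC r.
  apply/matrixP => i j; rewrite !mxE (ord1 i).
  exact: etrans (horner_map f (q ^+ 4) (r 0 j)) (congr1 f (q4 j)).
(* T^2 is the square root; as the square of a symmetric matrix it is psd *)
pose T := horner_mx A q.
have Tt : T^T = T by rewrite trmx_horner_mx At.
exists (T *m T); split; last first.
  rewrite -[RHS]A4 rmorphXn /= -/T (exprM T 2 2) !expr2.
  by rewrite mulmxE.
split; first by rewrite trmx_mul Tt.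
by move=> x; rewrite -mulmxA dotv_sym// sqnorm_ge0.
Qed.

Lemma sqrtmxP n (A : 'M[R]_n) : psdmx A ->
  psdmx (sqrtmx A) /\ sqrtmx A *m sqrtmx A = A.
Proof.
move=> /psd_sqrt_exists[S hS]; rewrite /sqrtmx.
by case: xgetP => [T _ //|/(_ S)].
Qed.

End sqrt.

(** * Stability of the matrix square root *)

Section linalg.
Context {R : realType}.

Lemma mx_eq_dotv m n (A B : 'M[R]_(m, n)) :
  (forall u v, dotv u (A *m v) = dotv u (B *m v)) -> A = B.
Proof.
move=> h; apply/matrixP => i j.
have := h (delta_mx i 0) (delta_mx j 0).
have E (C : 'M[R]_(m, n)) :
    dotv (delta_mx i 0) (C *m delta_mx j 0 : 'cV[R]_m) = C i j.
  rewrite dotvE (bigD1 i)//= big1 => [|k ki].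
    by rewrite -colE !mxE !eqxx mul1r addr0.
  by rewrite mxE (negPf ki) mul0r.
by rewrite !E.
Qed.

Lemma sym_eq_dotv n (A B : 'M[R]_n) : A^T = A -> B^T = B ->
  (forall u, dotv u (A *m u) = dotv u (B *m u)) -> A = B.
Proof.
move=> At Bt h; apply: mx_eq_dotv => u v.
have := h (u + v); rewrite !mulmxDr !(dotvDl, dotvDr) !h.
rewrite [dotv v (A *m u)]dotv_sym// [dotv (A *m v) u]dotvC.
rewrite [dotv v (B *m u)]dotv_sym// [dotv (B *m v) u]dotvC.
by lra.
Qed.

(** Cauchy-Schwarz with an additive bound in place of the product, which spares
    a square root of [frob2 A]. *)
Lemma psd_form_le n (A : 'M[R]_n) (v : 'cV[R]_n) :
  2 * dotv v (A *m v) <= (1 + frob2 A) * sqnorm v.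
Proof.
have h1 := sqnorm_ge0 (v - A *m v).
have h2 := sqnorm_mulmx_le A v.
move: h1 h2; rewrite /sqnorm !(dotvDl, dotvDr, dotvNl, dotvNr).
by rewrite [dotv (A *m v) v]dotvC; lra.
Qed.

(** On its range a psd matrix is bounded below: there the Cauchy-Schwarz
    inequality of the form A can be inverted with any generalized inverse. *)
Lemma psd_coercive n (A : 'M[R]_n) : psdmx A ->
  exists2 c : R, 0 < c & forall y : 'cV[R]_n,
    c * sqnorm (A *m y) <= dotv (A *m y) (A *m (A *m y)).
Proof.
move=> Apsd.
have [G AGA] : exists G, A *m G *m A = A by exists (pinvmx A); apply: mulmxKpV.
pose K := (1 + frob2 A) * frob2 G + 1.
have K0 : 0 < K.
  by rewrite ltr_wpDl// mulr_ge0 ?addr_ge0 ?frob2_ge0.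
exists K^-1; first by rewrite invr_gt0.
move=> y; set x := A *m y.
have xE : x = A *m (G *m x) by rewrite /x !mulmxA AGA.
have := psd_CS x (G *m x) Apsd; rewrite -xE -/(sqnorm x) => h.
have h1 := psd_form_le A (G *m x); rewrite -xE in h1.
have h2 : (1 + frob2 A) * sqnorm (G *m x) <= (1 + frob2 A) * (frob2 G * sqnorm x).
  by rewrite ler_wpM2l ?sqnorm_mulmx_le// addr_ge0 ?frob2_ge0.
have xAx : 0 <= dotv x (A *m x) by case: Apsd => _; exact.
rewrite mulrC ler_pdivrMr//.
have [x0|x0] := eqVneq (sqnorm x) 0; first by rewrite x0 mulr_ge0// ltW.
have x0' : 0 < sqnorm x by rewrite lt_neqAle eq_sym x0 sqnorm_ge0.
rewrite -(ler_pM2r x0') -expr2 (le_trans h)// -mulrA ler_wpM2l//.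
have q0 : 0 <= dotv (G *m x) x by rewrite {2}xE; case: Apsd => _; exact.
by rewrite /K; lra.
Qed.

Lemma frob2_row_form m n (D : 'M[R]_(m, n)) (A : 'M[R]_n) :
  \tr (D *m A *m D^T) = \sum_i dotv (row i D)^T (A *m (row i D)^T).
Proof.
apply: eq_bigr => i _.
rewrite /dotv trmxK mulmxA -row_mul tr_row colE mulmxA -row_mul -colE !mxE.
by apply: eq_bigr => j _; rewrite !mxE.
Qed.

Lemma frob2_row m n (D : 'M[R]_(m, n)) :
  frob2 D = \sum_i sqnorm (row i D)^T.
Proof.
by apply: eq_bigr => i _; rewrite sqnormE; apply: eq_bigr => j _; rewrite !mxE.
Qed.

Lemma tr_psd_ge0 m n (D : 'M[R]_(m, n)) (A : 'M[R]_n) : psdmx A ->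
  0 <= \tr (D *m A *m D^T).
Proof. by case=> _ A0; rewrite frob2_row_form sumr_ge0. Qed.

Lemma psd_coercive_mx n (A : 'M[R]_n) : psdmx A ->
  exists2 c : R, 0 < c & forall E : 'M[R]_n,
    c * frob2 (E *m A) <= \tr (E *m A *m A *m (E *m A)^T).
Proof.
move=> Apsd; have [c c0 h] := psd_coercive Apsd; exists c => // E.
rewrite frob2_row frob2_row_form mulr_sumr; apply: ler_sum => i _.
by rewrite row_mul trmx_mul (proj1 Apsd).
Qed.

(** The error of a matrix square root: D = B - A satisfies
    B B - A A = D B + A D, and pairing with D leaves the nonnegative
    term tr (D B D) next to the coercive term tr (D A D). *)
Lemma psd_sqrt_error n (A B E X : 'M[R]_n) (c : R) :
  psdmx A -> psdmx B -> B = E *m A -> 0 <= c ->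
  (forall E : 'M[R]_n,
    c * frob2 (E *m A) <= \tr (E *m A *m A *m (E *m A)^T)) ->
  B *m B - A *m A = X ->
  c ^+ 2 * frob2 (B - A) <= frob2 X.
Proof.
move=> Apsd Bpsd BE c0 hc XE; set D := B - A.
have Dt : D^T = D by rewrite linearB/= (proj1 Apsd) (proj1 Bpsd).
have DE : D = (E - 1%:M) *m A by rewrite mulmxBl mul1mx -BE.
have h1 : c * frob2 D <= \tr (D *m A *m D).
  by rewrite -{3}Dt {2 3}DE {1}DE hc.
have h2 : \tr (D^T *m X) = \tr (D *m A *m D) + \tr (D *m B *m D).
  have -> : X = D *m B + A *m D.
    by rewrite -XE /D mulmxBl mulmxBr addrA subrK.
  by rewrite Dt mulmxDr mxtraceD (mxtrace_mulC D (D *m B)) addrC mulmxA.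
have h3 : 0 <= \tr (D *m B *m D) by rewrite -{2}Dt tr_psd_ge0.
have h4 : (\tr (D^T *m X)) ^+ 2 <= frob2 D * frob2 X := trCS D X.
have D0 := frob2_ge0 D; have X0 := frob2_ge0 X.
have h5 : (c * frob2 D) ^+ 2 <= frob2 D * frob2 X.
  rewrite (le_trans _ h4)// ler_sqr ?nnegrE ?h2; last 2 first.
  - by rewrite mulr_ge0.
  - by rewrite addr_ge0// (le_trans _ h1)// mulr_ge0.
  lra.
have [->|D1] := eqVneq (frob2 D) 0; first by rewrite mulr0.
have D0' : 0 < frob2 D by rewrite lt_neqAle eq_sym D1.
rewrite -(ler_pM2l D0') (le_trans _ h5)//; apply: eq_leR; ring.
Qed.

End linalg.

(** * Moments of a finite sample *)

Section empirical_moments.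
Context {R : realType} {I : finType}.
Implicit Types (H : {set I}) (f g : I -> R).

Definition avg H f : R := #|H|%:R^-1 * \sum_(i in H) f i.

Lemma avgD H f g : avg H (fun i => f i + g i) = avg H f + avg H g.
Proof. by rewrite /avg big_split mulrDr. Qed.

Lemma avgZ H (c : R) f : avg H (fun i => c * f i) = c * avg H f.
Proof. by rewrite /avg -mulr_sumr mulrCA. Qed.

Lemma avg_sum H (K : finType) (F : K -> I -> R) :
  avg H (fun i => \sum_k F k i) = \sum_k avg H (F k).
Proof. by rewrite /avg exchange_big/= mulr_sumr. Qed.

Lemma eq_avg H f g : f =1 g -> avg H f = avg H g.
Proof. by move=> fg; congr (_ * _); apply: eq_bigr => i _; exact: fg. Qed.

Lemma avg_ge0 H f : (forall i, i \in H -> 0 <= f i) -> 0 <= avg H f.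
Proof. by move=> f0; rewrite mulr_ge0 ?invr_ge0// sumr_ge0. Qed.

Lemma ler_avg H f g : (forall i, i \in H -> f i <= g i) -> avg H f <= avg H g.
Proof. by move=> fg; rewrite ler_wpM2l ?invr_ge0// ler_sum. Qed.

Lemma avg_cst H (c : R) : (0 < #|H|)%N -> avg H (fun=> c) = c.
Proof.
move=> H0; rewrite /avg sumr_const -[c *+ _]mulr_natl mulrA mulVf ?mul1r//.
by rewrite pnatr_eq0 -lt0n.
Qed.

Lemma card_avg H f : (0 < #|H|)%N -> #|H|%:R * avg H f = \sum_(i in H) f i.
Proof. by move=> H0; rewrite mulrA divff ?mul1r// pnatr_eq0 -lt0n. Qed.

Context {d : nat}.
Implicit Types (u z : I -> 'cV[R]_d) (v w : 'cV[R]_d).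

Definition mean H u : 'cV[R]_d := \col_k avg H (fun i => u i k 0).
Definition mom2 H u : 'M[R]_d :=
  \matrix_(k, l) avg H (fun i => u i k 0 * u i l 0).
Definition cov H u : 'M[R]_d := mom2 H u - mean H u *m (mean H u)^T.

(** One quantity for both moments: it vanishes exactly when the empirical mean
    is 0 and the empirical second moment is T, and it is of order 1/n in
    expectation. *)
Definition fluct H (T : 'M[R]_d) u : R :=
  frob2 (mom2 H u - T) + sqnorm (mean H u).

Lemma dotv_mean H u w : dotv w (mean H u) = avg H (fun i => dotv w (u i)).
Proof.
rewrite dotvE; under [RHS]eq_avg do rewrite dotvE.
by rewrite avg_sum; apply: eq_bigr => k _; rewrite mxE avgZ.
Qed.

Lemma dotv_mom2 H u w v :
  dotv w (mom2 H u *m v) = avg H (fun i => dotv w (u i) * dotv v (u i)).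
Proof.
rewrite dotvE; under [RHS]eq_avg do rewrite dotvE mulr_suml.
rewrite avg_sum; apply: eq_bigr => k _.
rewrite mxE mulr_sumr; under [RHS]eq_avg do rewrite dotvE mulr_sumr.
rewrite avg_sum; apply: eq_bigr => l _; rewrite mxE.
by rewrite [avg _ _ * _]mulrC mulrA -avgZ; apply: eq_avg => i; ring.
Qed.

Lemma mom2T H u : (mom2 H u)^T = mom2 H u.
Proof. by apply/matrixP => k l; rewrite !mxE; apply: eq_avg => i; rewrite mulrC. Qed.

Lemma covT H u : (cov H u)^T = cov H u.
Proof. by rewrite linearB/= mom2T trmx_mul trmxK. Qed.

Lemma dotv_outer w v m : dotv w (m *m m^T *m v) = dotv w m * dotv v m.
Proof.
rewrite -mulmxA dotvE (dotvE w) mulr_suml; apply: eq_bigr => k _.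
rewrite mxE big_ord1 -mulrA; congr (_ * (_ * _)).
by rewrite -[_ 0 0]/(dotv m v) dotvC.
Qed.

Lemma dotv_cov H u w : dotv w (cov H u *m w) =
  avg H (fun i => dotv w (u i) ^+ 2) - dotv w (mean H u) ^+ 2.
Proof. by rewrite mulmxBl dotvBr dotv_outer dotv_mom2. Qed.

Lemma avg_sq_dist H u w (c : R) : (0 < #|H|)%N ->
  avg H (fun i => (dotv w (u i) - c) ^+ 2) =
  dotv w (cov H u *m w) + (dotv w (mean H u) - c) ^+ 2.
Proof.
move=> H0; rewrite dotv_cov.
have -> : avg H (fun i => (dotv w (u i) - c) ^+ 2) =
    avg H (fun i => dotv w (u i) ^+ 2 + (- 2 * c) * dotv w (u i) + c ^+ 2).
  by apply: eq_avg => i; ring.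
by rewrite !avgD avgZ avg_cst// -dotv_mean; ring.
Qed.

Lemma cov_form H u w : (0 < #|H|)%N -> dotv w (cov H u *m w) =
  avg H (fun i => dotv w (u i - mean H u) ^+ 2).
Proof.
move=> H0; under eq_avg do rewrite dotvBr.
by rewrite avg_sq_dist// subrr expr0n addr0.
Qed.

Lemma mean_affine H u (K : 'M[R]_d) k : (0 < #|H|)%N ->
  mean H (fun i => K *m u i + k) = K *m mean H u + k.
Proof.
move=> H0; apply/colP => a.
have E w : dotv w (mean H (fun i => K *m u i + k)) = dotv w (K *m mean H u + k).
  rewrite dotv_mean; under eq_avg do rewrite dotvDr dotv_mull.
  by rewrite avgD avg_cst// -dotv_mean -dotv_mull dotvDr.
have := E (delta_mx a 0); rewrite !dotvE.
have F v : \sum_i (delta_mx a 0 : 'cV[R]_d) i 0 * v i 0 = v a 0.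
  rewrite (bigD1 a)//= big1 ?addr0 ?mxE ?eqxx ?mul1r// => b ba.
  by rewrite mxE (negPf ba) mul0r.
by rewrite !F.
Qed.

Lemma cov_affine H u (K : 'M[R]_d) k : (0 < #|H|)%N ->
  cov H (fun i => K *m u i + k) = K *m cov H u *m K^T.
Proof.
move=> H0; apply: sym_eq_dotv; first exact: covT.
  by rewrite !trmx_mul trmxK covT mulmxA.
move=> w; rewrite cov_form// mean_affine//.
rewrite -!mulmxA dotv_mull cov_form//; apply: eq_avg => i.
by rewrite -dotv_mull mulmxBr; congr (dotv w _ ^+ 2); rewrite opprD addrACA subrr addr0.
Qed.

Lemma tr_outer v : \tr (v *m v^T) = sqnorm v.
Proof.
by rewrite mxtrace_mulC /mxtrace big_ord1.
Qed.

Lemma tr_cov_ge0 H u : (0 < #|H|)%N -> 0 <= \tr (cov H u).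
Proof.
move=> H0; have : psdmx (cov H u).
  split=> [|w]; first exact: covT.
  by rewrite cov_form// avg_ge0// => i _; exact: sqr_ge0.
by move=> /(tr_psd_ge0 1%:M); rewrite trmx1 mul1mx mulmx1.
Qed.

Lemma frob2_outer v : frob2 (v *m v^T) = sqnorm v ^+ 2.
Proof.
rewrite /frob2 sqnormE expr2 mulr_suml; apply: eq_bigr => i _.
rewrite mulr_sumr; apply: eq_bigr => j _.
by rewrite mxE big_ord1 mxE exprMn.
Qed.

Lemma tr_covE H u : \tr (cov H u) = \tr (mom2 H u) - sqnorm (mean H u).
Proof. by rewrite linearB/= tr_outer. Qed.

Section fluct.
Variables (H : {set I}) (T : 'M[R]_d) (u : I -> 'cV[R]_d).
Hypotheses (H0 : (0 < #|H|)%N) (T0 : 0 <= \tr T).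

Lemma fluct_ge0 : 0 <= fluct H T u.
Proof. by rewrite addr_ge0 ?frob2_ge0 ?sqnorm_ge0. Qed.

Let trdev : (\tr (mom2 H u) - \tr T) ^+ 2 <= d%:R * fluct H T u.
Proof.
rewrite -linearB/= (le_trans (tr_sqr_le _))// ler_wpM2l//.
by rewrite lerDl sqnorm_ge0.
Qed.

(** The square of the mean is of fourth order in the data, but it is at most
    the second moment, so that it costs no fourth moment of the average. *)
Lemma sqnorm_mean_sq :
  sqnorm (mean H u) ^+ 2 <= (2 * \tr T + d%:R) * fluct H T u.
Proof.
have := tr_cov_ge0 u H0; rewrite tr_covE subr_ge0 => h.
have m0 := sqnorm_ge0 (mean H u).
have h1 := trdev.
have h2 : sqnorm (mean H u) <= fluct H T u by rewrite lerDr frob2_ge0.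
have h3 : 2 * \tr T * sqnorm (mean H u) <= 2 * \tr T * fluct H T u.
  by rewrite ler_wpM2l// mulr_ge0.
have h4 : sqnorm (mean H u) ^+ 2 <= sqnorm (mean H u) * \tr (mom2 H u).
  by rewrite expr2 ler_wpM2l.
move: h h1 h2 h3 h4; set a := sqnorm _; set t := \tr (mom2 H u); set x := \tr T.
move=> h h1 h2 h3 h4.
have := sqr_ge0 (a - (t - x)).
by nra.
Qed.

Lemma tr_cov_sq : (\tr (cov H u)) ^+ 2 <= (2 * (\tr T) ^+ 2 + 2 * d%:R) * (1 + fluct H T u).
Proof.
have h0 := tr_cov_ge0 u H0; have h1 := trdev.
have h2 : \tr (cov H u) <= \tr (mom2 H u).
  by rewrite tr_covE gerBl sqnorm_ge0.
have V0 := fluct_ge0.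
have h3 : (\tr (cov H u)) ^+ 2 <= (\tr (mom2 H u)) ^+ 2.
  by rewrite ler_sqr ?nnegrE// (le_trans h0).
have d0 : 0 <= d%:R :> R by [].
have h4 : 0 <= (\tr T) ^+ 2 * fluct H T u by rewrite mulr_ge0 ?sqr_ge0.
have := sqr_ge0 (\tr (mom2 H u) - 2 * \tr T).
by nra.
Qed.

Lemma frob2_cov_dev :
  frob2 (cov H u - T) <= (2 + 4 * \tr T + 2 * d%:R) * fluct H T u.
Proof.
have -> : cov H u - T = (mom2 H u - T) - mean H u *m (mean H u)^T.
  by rewrite /cov addrAC.
apply: le_trans (frob2D_le _ _) _; rewrite frob2N frob2_outer.
have := sqnorm_mean_sq.
have : frob2 (mom2 H u - T) <= fluct H T u by rewrite lerDl sqnorm_ge0.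
by nra.
Qed.

End fluct.

(** The second moment is within 1/4 of the identity in Frobenius norm and the
    mean has norm at most 1/4, which leaves at least 1 - 1/4 - 1/16 of the
    squared norm of v. *)
Lemma fluct_small_form H z v (c : R) : (0 < #|H|)%N ->
  fluct H 1%:M z <= 16^-1 ->
  2^-1 * sqnorm v <= avg H (fun i => (dotv v (z i) - c) ^+ 2).
Proof.
move=> H0 Usmall; rewrite avg_sq_dist// dotv_cov.
have -> : avg H (fun i => dotv v (z i) ^+ 2) =
    sqnorm v + dotv v ((mom2 H z - 1%:M) *m v).
  by rewrite mulmxBl dotvBr mul1mx addrC subrK dotv_mom2.
have U1 : frob2 (mom2 H z - 1%:M) <= 16^-1.
  by apply: le_trans Usmall; rewrite lerDl sqnorm_ge0.
have U2 : sqnorm (mean H z) <= 16^-1.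
  by apply: le_trans Usmall; rewrite lerDr frob2_ge0.
have v0 := sqnorm_ge0 v.
have h1 : (dotv v (mean H z)) ^+ 2 <= sqnorm v * 16^-1.
  by apply: le_trans (dotv_CS _ _) _; rewrite ler_wpM2l.
set X := mom2 H z - 1%:M in U1 *.
have h2 : (dotv v (X *m v)) ^+ 2 <= (sqnorm v * 4^-1) ^+ 2.
  apply: le_trans (dotv_CS _ _) _.
  apply: le_trans (_ : _ <= sqnorm v * (frob2 X * sqnorm v)) _.
    by rewrite ler_wpM2l// sqnorm_mulmx_le.
  by have : 0 <= sqnorm v ^+ 2 := sqr_ge0 _; nra.
have h3 : - (sqnorm v * 4^-1) <= dotv v (X *m v).
  have : `|dotv v (X *m v)| <= `|sqnorm v * 4^-1| by rewrite -ler_sqr ?nnegrE// !real_normK ?num_real.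
  by rewrite (ger0_norm (_ : 0 <= sqnorm v * 4^-1)) ?mulr_ge0// ler_norml => /andP[].
have := sqr_ge0 (dotv v (mean H z) - c).
by lra.
Qed.

End empirical_moments.

(** * Error of an approximate square root of the covariance *)

Section pathwise.
Context {R : realType} {d : nat}.

(** Applied to the rows of B, this turns a lower bound on cov(z) into an upper
    bound on B. *)
Lemma lower_form_frob2 (B M : 'M[R]_d) (lam : R) : B^T = B ->
  (forall v : 'cV[R]_d, lam * sqnorm v <= dotv v (M *m v)) ->
  lam * frob2 B <= \tr (B *m M *m B).
Proof.
move=> Bt h; rewrite -{3}Bt frob2_row_form frob2_row mulr_sumr.
by apply: ler_sum => i _; exact: h.
Qed.

(** The factor l bounds the inverse of the smallest eigenvalue of cov(z), and the
    trace of B cov(z) B = cov(u) bounds frob2 B by l times the trace of cov(u).  The first bound comes from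
    B B - A A = (cov(u) - A A) - B (cov(z) - 1) B
    and is small, but quadratic in l.  The second one does not compare B with A
    at all; it is not small, but only linear in l, and serves when l is large. *)
Lemma brenier_bounds (A : 'M[R]_d) : psdmx A -> exists2 C : R, 0 < C &
  forall (I J : finType) (z : I -> 'cV[R]_d) (u : J -> 'cV[R]_d)
    (E B : 'M[R]_d) (l : R),
  (0 < #|I|)%N -> (0 < #|J|)%N ->
  psdmx B -> B = E *m A -> B *m cov [set: _]%SET z *m B = cov [set: _]%SET u ->
  1 <= l -> (forall v, sqnorm v <= l * dotv v (cov [set: _]%SET z *m v)) ->
  let U := fluct [set: _]%SET 1%:M z in let V := fluct [set: _]%SET (A *m A) u in
  let loss := frob2 (B - A) + frob2 B * sqnorm (mean [set: _]%SET z)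
              + sqnorm (mean [set: _]%SET u) in
  loss <= C * (V + (1 + V) * (l ^+ 2 * U)) /\
  loss <= C * ((1 + V) * (l * (1 + sqnorm (mean [set: _]%SET z)))).
Proof.
move=> Apsd; have [c c0 hc] := psd_coercive_mx Apsd.
have T0 : 0 <= \tr (A *m A).
  by rewrite -{2}(proj1 Apsd) -[A in A *m _]mulmx1 tr_psd_ge0//; exact: psdmx1.
pose D : R := d%:R; have D0 : 0 <= D by [].
pose K1 := 2 * (\tr (A *m A)) ^+ 2 + 2 * D.
pose K2 := 2 + 4 * \tr (A *m A) + 2 * D.
pose K3 := 2 + 4 * D + 2 * D.
have K10 : 0 <= K1 by rewrite addr_ge0 ?mulr_ge0 ?sqr_ge0.
have K20 : 0 <= K2 by rewrite /K2; lra.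
have K30 : 0 <= K3 by rewrite /K3; lra.
pose C1 := c ^- 2 * (2 * K2 + 2 * K1 * K3) + 1 + K1.
pose C2 := 2 * (1 + K1) + 2 * frob2 A + 1 + K1 + 1.
have ci : 0 < c ^- 2 by rewrite invr_gt0 exprn_gt0.
have A0 := frob2_ge0 A.
have C10 : 0 <= C1.
  have KK : 0 <= 2 * K2 + 2 * K1 * K3 by rewrite addr_ge0 ?mulr_ge0.
  by have := mulr_ge0 (ltW ci) KK; rewrite /C1; lra.
have C20 : 0 <= C2 by rewrite /C2; lra.
exists (C1 + C2 + 1); first by rewrite ltr_wpDl// addr_ge0.
move=> I J z u E B l I0 J0 Bpsd BE eqB l1 hl U V loss.
have I0' : (0 < #|[set: I]%SET|)%N by rewrite cardsT.
have J0' : (0 < #|[set: J]%SET|)%N by rewrite cardsT.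
have U0 : 0 <= U by exact: fluct_ge0.
have V0 : 0 <= V by exact: fluct_ge0.
have l0 : 0 < l := lt_le_trans ltr01 l1.
set mz := sqnorm (mean [set: _]%SET z) in loss *.
set mu := sqnorm (mean [set: _]%SET u) in loss *.
have mz0 : 0 <= mz := sqnorm_ge0 _.
have mzU : mz <= U by rewrite lerDr frob2_ge0.
have muV : mu <= V by rewrite lerDr frob2_ge0.
set f := frob2 B in loss *; have f0 : 0 <= f := frob2_ge0 _.
pose t := \tr (cov [set: _]%SET u).
have t0 : 0 <= t := tr_cov_ge0 u J0'.
have tK : t ^+ 2 <= K1 * (1 + V) by exact: tr_cov_sq.
have ft : f <= l * t.
  have := @lower_form_frob2 B (cov [set: _]%SET z) l^-1 (proj1 Bpsd).
  rewrite eqB -/t -/f => h.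
  rewrite -ler_pdivrMl// h// => v.
  by rewrite ler_pdivrMl// hl.
have t1 : t <= (1 + K1) * (1 + V).
  have := sqr_ge0 (t - 1); have : 0 <= K1 * V by rewrite mulr_ge0.
  by nra.
have err : frob2 (B - A) <= c ^- 2 * (2 * K2 * V + 2 * (f ^+ 2 * (K3 * U))).
  rewrite mulrC ler_pdivlMr ?exprn_gt0// mulrC.
  pose X := (cov [set: _]%SET u - A *m A) - B *m (cov [set: _]%SET z - 1%:M) *m B.
  apply: le_trans (psd_sqrt_error (X := X) Apsd Bpsd BE (ltW c0) hc _) _.
    by rewrite /X mulmxBr mulmxBl mulmx1 eqB opprB [RHS]addrC addrA subrK.
  apply: le_trans (frob2D_le _ _) _; rewrite frob2N; apply: lerD.
    by rewrite -mulrA ler_wpM2l//; exact: frob2_cov_dev.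
  rewrite ler_wpM2l//; apply: le_trans (frob2M_le _ _) _.
  have h : frob2 (B *m (cov [set: _]%SET z - 1%:M)) <= f * (K3 * U).
    apply: le_trans (frob2M_le _ _) _; rewrite ler_wpM2l//.
    have := @frob2_cov_dev _ I d [set: _]%SET 1%:M z I0'.
    by rewrite mxtrace1; exact.
  apply: le_trans (ler_wpM2r f0 h) _.
  by apply: eq_leR; rewrite /f; ring.
have f2 : f ^+ 2 <= l ^+ 2 * (K1 * (1 + V)).
  apply: le_trans (_ : _ <= (l * t) ^+ 2) _.
    by rewrite ler_sqr ?nnegrE// mulr_ge0// ltW.
  by rewrite exprMn ler_wpM2l// sqr_ge0.
have f1 : f <= (1 + K1) * ((1 + V) * l).
  by apply: le_trans ft _; rewrite mulrA mulrC ler_wpM2r// ltW.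
have W0 : 0 <= (1 + V) * (l ^+ 2 * U).
  by apply: mulr_ge0; [lra | rewrite mulr_ge0 ?sqr_ge0].
have Z0 : 0 <= (1 + V) * (l * (1 + mz)).
  by apply: mulr_ge0; [lra | apply: mulr_ge0; lra].
split.
  apply: (@le_trans _ _ (C1 * (V + (1 + V) * (l ^+ 2 * U)))); last first.
    by apply: ler_wpM2r; [exact: addr_ge0 | lra].
  have e1 : frob2 (B - A) <=
      c ^- 2 * (2 * K2 + 2 * K1 * K3) * (V + (1 + V) * (l ^+ 2 * U)).
    apply: le_trans err _; rewrite -[leRHS]mulrA.
    apply: ler_wpM2l; first exact: ltW.
    have h1 : f ^+ 2 * (K3 * U) <= l ^+ 2 * (K1 * (1 + V)) * (K3 * U).
      by rewrite ler_wpM2r// mulr_ge0.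
    have h2 : 0 <= K2 * ((1 + V) * (l ^+ 2 * U)) by rewrite mulr_ge0.
    have h3 : 0 <= K1 * K3 * V by rewrite !mulr_ge0.
    by lra.
  have e2 : f * mz <= (1 + K1) * ((1 + V) * (l ^+ 2 * U)).
    apply: le_trans (ler_pM f0 mz0 f1 mzU) _.
    rewrite -!mulrA; apply: ler_wpM2l; first lra.
    apply: ler_wpM2l; first lra.
    apply: ler_wpM2l; first exact: ltW.
    by rewrite ler_peMl.
  have h4 : 0 <= K1 * V by rewrite mulr_ge0.
  by rewrite /loss /C1; lra.
apply: (@le_trans _ _ (C2 * ((1 + V) * (l * (1 + mz))))); last first.
  by apply: ler_wpM2r => //; lra.
have Vl : (1 + V) * l <= (1 + V) * (l * (1 + mz)).
  by apply: ler_wpM2l; [lra | rewrite ler_peMr ?(ltW l0)// lerDl].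
have Vlm : (1 + V) * l * mz <= (1 + V) * (l * (1 + mz)).
  rewrite [leRHS]mulrA; apply: ler_wpM2l; last lra.
  by apply: mulr_ge0; lra.
have V1 : 1 + V <= (1 + V) * l by rewrite ler_peMr//; lra.
have e1 : frob2 (B - A) <= 2 * f + 2 * frob2 A.
  by apply: le_trans (frob2D_le _ _) _; rewrite frob2N.
have e2 : f * mz <= (1 + K1) * ((1 + V) * l * mz).
  by rewrite [leRHS]mulrA ler_wpM2r.
have e3 : f <= (1 + K1) * ((1 + V) * (l * (1 + mz))).
  by apply: le_trans f1 _; apply: ler_wpM2l; lra.
have e4 : (1 + K1) * ((1 + V) * l * mz) <= (1 + K1) * ((1 + V) * (l * (1 + mz))).
  by apply: ler_wpM2l; lra.
have e5 : frob2 A <= frob2 A * ((1 + V) * (l * (1 + mz))).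
  by rewrite ler_peMr// (le_trans _ Vl)// (le_trans _ V1)// lerDl.
have e6 : mu <= (1 + V) * (l * (1 + mz)) by lra.
by rewrite /loss /C2; lra.
Qed.

End pathwise.

(** * Groups within a sample *)

Section groups.
Context {R : realType} {d : nat}.

Lemma card_avg_le (I : finType) (H : {set I}) (f : I -> R) :
  (0 < #|H|)%N -> (forall i, 0 <= f i) ->
  #|H|%:R * avg H f <= #|I|%:R * avg [set: _]%SET f.
Proof.
move=> H0 f0; have I0 : (0 < #|[set: I]%SET|)%N.
  by apply: leq_trans H0 _; rewrite subset_leq_card.
rewrite card_avg// -cardsT card_avg// [leRHS](bigID (fun i => i \in H))/=.
rewrite -[X in X <= _]addr0 lerD ?sumr_ge0//.
by apply: eq_leR; apply: eq_bigl => i; rewrite inE.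
Qed.

(** The variance of the whole sample along v dominates the part of it that comes
    from one group, whatever the centering. *)
Lemma group_form_le (I : finType) (H : {set I}) (z : I -> 'cV[R]_d) v (q : R) :
  (0 < #|H|)%N ->
  (forall c, q <= avg H (fun i => (dotv v (z i) - c) ^+ 2)) ->
  #|H|%:R * q <= #|I|%:R * dotv v (cov [set: _]%SET z *m v).
Proof.
move=> H0 hq; have I0 : (0 < #|[set: I]%SET|)%N.
  by apply: leq_trans H0 _; rewrite subset_leq_card.
rewrite cov_form//; under eq_avg do rewrite dotvBr.
pose c := dotv v (mean [set: I]%SET z).
apply: (le_trans (ler_wpM2l (ler0n _ _) (hq c))).
by apply: card_avg_le => // i; exact: sqr_ge0.
Qed.

Lemma mean_split_le (I : finType) (H1 H2 H3 : {set I}) (z : I -> 'cV[R]_d) :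
  (H1 :|: H2 :|: H3)%SET = [set: _]%SET -> [disjoint H1 & H2]%B -> [disjoint (H1 :|: H2)%SET & H3]%B ->
  (0 < #|H1|)%N -> (0 < #|H2|)%N -> (0 < #|H3|)%N ->
  sqnorm (mean [set: _]%SET z) <=
  3 * (sqnorm (mean H1 z) + sqnorm (mean H2 z) + sqnorm (mean H3 z)).
Proof.
move=> HU D12 D123 n1 n2 n3.
have I0 : (0 < #|I|)%N.
  by apply: leq_trans n1 _; rewrite -cardsT subset_leq_card.
have Ir : 0 < #|I|%:R :> R by rewrite ltr0n.
pose w (H : {set I}) : R := #|H|%:R / #|I|%:R.
have w0 H : 0 <= w H by rewrite divr_ge0.
have w1 H : w H <= 1 by rewrite ler_pdivrMr// mul1r ler_nat max_card.
have mE : mean [set: _]%SET z =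
    w H1 *: mean H1 z + w H2 *: mean H2 z + w H3 *: mean H3 z.
  apply/colP => k; rewrite !mxE /w.
  rewrite ![_ / _ * _]mulrAC ![#|_|%:R * _]card_avg//.
  rewrite -!mulrDl /avg cardsT mulrC; congr (_ / _).
  transitivity (\sum_(i in [predU [predU H1 & H2] & H3]) z i k 0).
    by apply: eq_bigl => i; rewrite -HU !inE.
  rewrite bigU/= ?bigU//= -?addrA//.
  by apply: etrans D123; apply: eq_disjoint => i; rewrite !inE.
rewrite mE.
have e H : sqnorm (w H *: mean H z) <= sqnorm (mean H z).
  rewrite sqnormZ ler_piMl ?sqnorm_ge0//.
  by rewrite expr_le1.
have := e H1; have := e H2; have := e H3.
set a := _ *: mean H1 z; set b := _ *: mean H2 z; set c := _ *: mean H3 z.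
have := sqnorm_ge0 (a - b); have := sqnorm_ge0 (a - c).
have := sqnorm_ge0 (b - c).
rewrite /sqnorm !(dotvDl, dotvDr, dotvNl, dotvNr) [dotv b a]dotvC.
rewrite [dotv c a]dotvC [dotv c b]dotvC.
by lra.
Qed.

End groups.

(** * Borel measurability on spaces of matrices *)

Section measurable_cV.
Context {R : realType}.

Lemma open_measurable_mx m n (A : set 'M[R]_(m, n)) : open A -> measurable A.
Proof. by move=> oA; exact: sub_sigma_algebra. Qed.

Lemma continuous_measurable_mx m n (f : 'M[R]_(m, n) -> R) :
  continuous f -> measurable_fun setT f.
Proof.
move=> /continuousP cf; apply: (measurability _ (RGenOpens.measurableE R)).
move=> _ [_ [a [b ->] <-]]; rewrite setTI; apply: open_measurable_mx.
exact/cf/interval_open.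
Qed.

Lemma measurable_coord m n i j :
  measurable_fun setT (fun x : 'M[R]_(m, n) => x i j).
Proof. by apply: continuous_measurable_mx; exact: coord_continuous. Qed.

Lemma continuous_mxP (T : topologicalType) m n (f : T -> 'M[R]_(m, n)) :
  (forall i j, continuous (fun x => f x i j)) -> continuous f.
Proof.
move=> cf x A [P nP sPA].
suff : \forall y \near x, forall i j, P i j (f y i j).
  by apply: filterS => y Py; exact: sPA.
apply: filter_forall => i; apply: filter_forall => j.
exact: cf (nP i j).
Qed.

Lemma continuous_sumR (T : topologicalType) (I : finType) (F : I -> T -> R) :
  (forall i, continuous (F i)) -> continuous (fun x => \sum_i F i x).
Proof.
move=> cF; elim: (index_enum I) => [|i s IH] x.
  by under eq_fun do rewrite big_nil; exact: cst_continuous.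
under eq_fun do rewrite big_cons.
by apply: cvgD; [exact: cF | exact: IH].
Qed.

Lemma continuous_affine m n (k : 'cV[R]_m) (K : 'M[R]_(m, n)) :
  continuous (fun x : 'cV[R]_n => k + K *m x).
Proof.
apply: continuous_mxP => i j.
have -> : (fun x : 'cV[R]_n => (k + K *m x) i j) =
    (fun x => k i j + \sum_l K i l * x l j).
  by apply/funext => x; rewrite !mxE.
move=> x; apply: (@continuousD _ _ _ (fun=> k i j)); first exact: cst_continuous.
apply: (@continuous_sumR _ _ (fun l (x : 'cV[R]_n) => K i l * x l j)) => l y.
apply: (@continuousM _ _ (fun=> K i l) (fun x : 'cV[R]_n => x l j) y).
  exact: cst_continuous.
exact: coord_continuous.
Qed.

Lemma continuous_measurable_mx2 m n p q (f : 'M[R]_(m, n) -> 'M[R]_(p, q)) :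
  continuous f -> measurable_fun setT f.
Proof.
move=> /continuousP cf; apply: (@measurability _ _ _ _ _ _ (@open 'M[R]_(p, q))) => //.
move=> _ [A oA <-]; rewrite setTI; apply: open_measurable_mx; exact: cf.
Qed.

Lemma measurable_affine m n (k : 'cV[R]_m) (K : 'M[R]_(m, n)) :
  measurable_fun setT (fun x : 'cV[R]_n => k + K *m x).
Proof. by apply: continuous_measurable_mx2; exact: continuous_affine. Qed.

Lemma measurable_dotv n (v : 'cV[R]_n) : measurable_fun setT (dotv v).
Proof.
rewrite (_ : dotv v = fun x => \sum_i v i 0 * x i 0); last first.
  by apply/funext => x; rewrite dotvE.
apply: measurable_sum => i; apply: measurable_funM => //.
exact: measurable_coord.
Qed.

Lemma measurable_sqnorm n : measurable_fun setT (@sqnorm R n).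
Proof.
rewrite (_ : @sqnorm R n = fun x => \sum_i x i 0 ^+ 2); last first.
  by apply/funext => x; rewrite sqnormE.
apply: measurable_sum => i; apply: measurable_funX; exact: measurable_coord.
Qed.

End measurable_cV.

(** * Empirical integrals and conjugates of quadratic functions *)

Section empirical_integral.
Context {dT} {T : measurableType dT} {R : realType} {n : nat}.
Variable x : 'I_n -> T.
Local Open Scope ereal_scope.

Lemma ge0_integral_empirical (f : T -> \bar R) :
  measurable_fun setT f -> (forall t, 0 <= f t) ->
  \int[empirical x]_t f t = (n%:R^-1)%:E * \sum_(i < n) f (x i).
Proof.
move=> mf f0.
pose m (k : nat) : {measure set T -> \bar R} :=
  if insub k is Some i then \d_(x i) else mzero.
transitivity (\int[mscale ((n%:R^-1 : R)%:nng)%R (msum m n)]_t f t).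
  apply: eq_measure_integral => A mA _.
  rewrite /empirical /mscale /= /msum; congr (_ * _).
  by apply: eq_bigr => i _; rewrite /m valK.
rewrite ge0_integral_mscale// ge0_integral_measure_sum//; congr (_ * _).
apply: eq_bigr => i _; rewrite /m valK integral_dirac//.
by rewrite diracT mul1e.
Qed.

Lemma integral_empirical (f : T -> R) : measurable_fun setT f ->
  \int[empirical x]_t (f t)%:E = (avg [set: _]%SET (fun i => f (x i)))%:E.
Proof.
move=> mf; have mf' : measurable_fun setT (EFin \o f) by exact/measurable_EFinP.
rewrite integralE !ge0_integral_empirical//; last 2 first.
- exact: measurable_funeneg.
- exact: measurable_funepos.
have -> : \sum_(i < n) (EFin \o f)^\+ (x i) = (\sum_(i < n) Num.max (f (x i)) 0)%:E.
  by rewrite -sumEFin; apply: eq_bigr => i _; rewrite funeposE/= -EFin_max.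
have -> : \sum_(i < n) (EFin \o f)^\- (x i) = (\sum_(i < n) Num.max (- f (x i)) 0)%:E.
  by rewrite -sumEFin; apply: eq_bigr => i _; rewrite funenegE/= -EFin_max.
rewrite -!EFinM -EFinB -mulrBr -sumrB /avg cardsT card_ord; congr (_ * _)%:E.
rewrite [RHS](eq_bigl xpredT)//; last by move=> i; rewrite inE.
apply: eq_bigr => i _; rewrite /Num.max.
by case: ifPn; case: ifPn; lra.
Qed.

End empirical_integral.

Lemma col_mulmx (F : pzSemiRingType) m n p (A : 'M[F]_(m, n)) (B : 'M[F]_(n, p)) j :
  col j (A *m B) = A *m col j B.
Proof. by rewrite !colE mulmxA. Qed.

Section conjugate.
Context {R : realType} {d : nat}.
Implicit Types (B : 'M[R]_d) (b x y z w : 'cV[R]_d).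

Definition quad B b x : R := 2^-1 * dotv x (B *m x) + dotv b x.

(** The conjugate is a supremum of continuous functions, hence lower
    semicontinuous. *)
Lemma measurable_conjugate (phi : 'cV[R]_d -> R) :
  measurable_fun setT (conjugate phi).
Proof.
apply: (measurability _ (ErealGenOInfty.measurableE R)).
move=> /= _ [_ [a ->]] <-; rewrite setTI; apply: open_measurable_mx.
rewrite preimage_itvoy.
have -> : [set y | (a%:E < conjugate phi y)%E] =
    \bigcup_(x in [set: 'cV[R]_d]) (dotv x @^-1` `](a + phi x), +oo[).
  apply/seteqP; split => [y /=|y [x _]/=].
    move=> /ereal_sup_gt[_ [x _ <-]]; rewrite lte_fin => h.
    by exists x => //=; rewrite in_itv/= andbT -ltrBrDr.
  rewrite in_itv/= andbT -ltrBrDr -lte_fin => h.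
  by apply: lt_le_trans h _; apply: ereal_sup_ubound; exists x.
apply: bigcup_open => x _.
have /continuousP : continuous (dotv x).
  have -> : dotv x = fun y => \sum_i x i 0 * y i 0.
    by apply/funext => y; rewrite dotvE.
  apply: (@continuous_sumR _ _ _ (fun i (y : 'cV[R]_d) => x i 0 * y i 0)) => i y.
  apply: (@continuousM _ _ (fun=> x i 0) (fun y : 'cV[R]_d => y i 0) y).
    exact: cst_continuous.
  exact: coord_continuous.
by apply; exact: interval_open.
Qed.

Lemma conjugate_quad_ge0 B b y : (0 <= conjugate (quad B b) y)%E.
Proof.
apply: ereal_sup_ubound; exists 0 => //.
by rewrite /quad mulmx0 !dotv0r dotv0l mulr0 addr0 subr0.
Qed.

(** The conjugate is attained where the gradient B z + b hits y. *)
Lemma conjugate_quadE B b z : psdmx B ->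
  conjugate (quad B b) (b + B *m z) = (2^-1 * dotv z (B *m z))%:E.
Proof.
move=> [Bt B0]; apply/eqP; rewrite eq_le; apply/andP; split.
  apply: ge_ereal_sup => _ [x _ <-]; rewrite lee_fin /quad.
  have := B0 (x - z); rewrite mulmxBr !(dotvBr, dotvBl, dotvDr).
  rewrite [dotv z (B *m x)]dotv_sym// [dotv (B *m z) x]dotvC [dotv b x]dotvC.
  by lra.
apply: ereal_sup_ubound; exists z => //; congr EFin.
by rewrite /quad dotvDr [dotv b z]dotvC; lra.
Qed.

(** If y - b has a component along the kernel of B, the supremum defining the
    conjugate is unbounded along that component. *)
Lemma conjugate_quad_lty B b y : psdmx B ->
  (conjugate (quad B b) y < +oo)%E -> exists z, y = b + B *m z.
Proof.
move=> [Bt B0] fin.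
have ker w : B *m w = 0 -> dotv w (y - b) = 0.
  move=> Bw; apply/eqP/negPn/negP => w0.
  have [r hr] : exists r, conjugate (quad B b) y = r%:E.
    exists (fine (conjugate (quad B b) y)); rewrite fineK//.
    by rewrite ge0_fin_numE// conjugate_quad_ge0.
  pose t := (r + 1) / dotv w (y - b).
  have : ((dotv (t *: w) y - quad B b (t *: w))%:E <= r%:E)%E.
    by rewrite -hr; apply: ereal_sup_ubound; exists (t *: w).
  rewrite lee_fin /quad -scalemxAr Bw scaler0 dotv0r mulr0 add0r.
  rewrite [dotv b _]dotvC -dotvBr dotvZl /t divfK//.
  by lra.
have : ((y - b)^T <= B)%MS.
  rewrite submxE; apply/eqP/matrixP => i j; rewrite [RHS]mxE (ord1 i).
  have := ker (col j (cokermx B)).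
  rewrite -col_mulmx mulmx_coker col0 => /(_ erefl).
  by rewrite dotvC /dotv -col_mulmx mxE.
move=> /submxP[D hD]; exists D^T.
by rewrite -[B]Bt -trmx_mul -hD trmxK addrC subrK.
Qed.

End conjugate.

(** * Stationarity of the empirical minimizer *)

Section stationarity.
Context {R : realType} {d n : nat}.
Variables (X Y : 'I_n -> 'cV[R]_d).
Implicit Types (B : 'M[R]_d) (b : 'cV[R]_d) (z : 'I_n -> 'cV[R]_d).
Local Notation avgT := (avg [set: 'I_n]%SET).

Lemma measurable_quad B b : measurable_fun setT (quad B b).
Proof.
have -> : quad B b = (fun x => 2^-1 * (\sum_i x i 0 * dotv (row i B)^T x) + dotv b x).
  apply/funext => x; rewrite /quad dotvE; congr (_ * _ + _).
  apply: eq_bigr => i _; congr (_ * _).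
  by rewrite /dotv trmxK -row_mul [RHS]mxE.
apply: measurable_funD; last exact: measurable_dotv.
apply: measurable_funM => //; apply: measurable_sum => i.
apply: measurable_funM; [exact: measurable_coord | exact: measurable_dotv].
Qed.

Definition quad_obj B b z : R :=
  avgT (fun i => quad B b (X i)) + avgT (fun j => 2^-1 * dotv (z j) (B *m z j)).

Lemma semidual_quadE B b z : psdmx B -> (forall j, Y j = b + B *m z j) ->
  semidual (empirical X) (empirical Y) (quad B b) = (quad_obj B b z)%:E.
Proof.
move=> Bpsd Yz; rewrite /semidual integral_empirical; last exact: measurable_quad.
rewrite ge0_integral_empirical; last 2 first.
- exact: measurable_conjugate.
- exact: conjugate_quad_ge0.
rewrite /quad_obj EFinD /avg; congr (_ + _)%E.
under eq_bigr do rewrite Yz conjugate_quadE//.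
rewrite sumEFin -EFinM cardsT card_ord; congr (_ * _)%:E.
by apply: eq_bigl => i; rewrite inE.
Qed.

(** The matrix 1 gives a finite objective, so the minimum is finite and every
    point of the second sample has a preimage under the gradient.  This turns the
    minimization into one of [quad_obj] over triples (B, b, z) with prescribed
    b + B z, free of conjugates. *)
Lemma argmin_quad phi : (0 < n)%N ->
  is_argmin F_quad (semidual (empirical X) (empirical Y)) phi ->
  exists B b z, [/\ psdmx B, phi = quad B b, (forall j, Y j = b + B *m z j) &
    forall B' b' z', psdmx B' -> (forall j, Y j = b' + B' *m z' j) ->
    quad_obj B b z <= quad_obj B' b' z'].
Proof.
move=> n0 [[B [b [Bpsd phiE]]] opt].
have {}phiE : phi = quad B b by [].
have fin : (semidual (empirical X) (empirical Y) phi < +oo)%E.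
  have := opt (quad 1%:M 0).
  rewrite (@semidual_quadE _ _ Y); last 2 first.
  - exact: psdmx1.
  - by move=> j; rewrite add0r mul1mx.
  move=> h; apply: le_lt_trans (h _) (ltry _).
  by exists 1%:M, 0; split => //; exact: psdmx1.
have finY j : (conjugate phi (Y j) < +oo)%E.
  rewrite ltey; apply/negP => /eqP cj; move: fin; rewrite ltey => /negP; apply.
  rewrite /semidual {1}phiE integral_empirical; last exact: measurable_quad.
  rewrite ge0_integral_empirical; last 2 first.
  - exact: measurable_conjugate.
  - by rewrite phiE; exact: conjugate_quad_ge0.
  rewrite (bigD1 j)//= cj addye; last first.
    rewrite gt_eqF// (lt_le_trans (ltNye 0%R))// sume_ge0// => i _.
    by rewrite phiE conjugate_quad_ge0.
  by rewrite gt0_muley// lte_fin invr_gt0 ltr0n.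
have /choice[z zE] : forall j, exists y : 'cV[R]_d, Y j = b + B *m y.
  by move=> j; apply: (@conjugate_quad_lty _ _ B) => //; rewrite -phiE.
exists B, b, z; split => // B' b' z' B'psd Yz'.
have := opt (quad B' b'); rewrite phiE (semidual_quadE Bpsd zE).
rewrite (semidual_quadE B'psd Yz') lee_fin; apply.
by exists B', b'.
Qed.

(** A stationarity condition that needs no derivative: the first-order term of a
    quadratic polynomial with a minimum at 0 vanishes. *)
Lemma linear_term_eq0 (a c : R) : 0 <= c ->
  (forall t : R, 0 <= t * a + t ^+ 2 * c) -> a = 0.
Proof.
move=> c0 h; have := @discr_le R 0 (a / 2) c c0.
rewrite mul0r => /(_ _)/wrap[t|]; first by have := h t; lra.
move=> a2; have : (a / 2) ^+ 2 == 0 by rewrite eq_le a2 sqr_ge0.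
by rewrite sqrf_eq0 mulf_eq0 => /orP[/eqP//|]; rewrite invr_eq0 pnatr_eq0.
Qed.

Lemma mx_eq_dotv1 m (x y : 'cV[R]_m) : (forall h, dotv h x = dotv h y) -> x = y.
Proof.
move=> h; apply/eqP; rewrite -subr_eq0; apply/eqP/sqnorm_eq0.
by rewrite /sqnorm dotvBr h subrr.
Qed.

(** The first-order term of the expression in s is s (a - e), which takes both
    signs near 0 unless a = e. *)
Lemma rank_one_term_eq (a e beta : R) : 0 <= a -> 0 <= beta ->
  (forall s : R, `|s| * beta < 1 -> 0 <= s * a - s / (1 + s * beta) * e) -> a = e.
Proof.
move=> a0 b0 h; apply/eqP; rewrite -subr_eq0; apply/negP => /negP x0.
set x := a - e in x0.
pose D := 2 * (a * beta + `|x| * beta + 1).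
have xb : 0 <= `|x| * beta by rewrite mulr_ge0.
have ab : 0 <= a * beta by rewrite mulr_ge0.
have D0 : 0 < D by rewrite /D; lra.
pose s := - x / D.
have sb : `|s| * beta = `|x| * beta / D.
  by rewrite /s normrM normrN normfV (gtr0_norm D0) mulrAC.
have sb1 : `|s| * beta < 1.
  by rewrite sb ltr_pdivrMr// mul1r /D; lra.
have s1 : 0 < 1 + s * beta.
  have : `|s * beta| < 1 by rewrite normrM (ger0_norm b0).
  by rewrite ltr_norml => /andP[]; lra.
have := h s sb1.
have -> : s * a - s / (1 + s * beta) * e = s * (x + s * (a * beta)) / (1 + s * beta).
  by rewrite /x; field; rewrite gt_eqF.
rewrite pmulr_lge0 ?invr_gt0// => hh.
have e1 : s * (x + s * (a * beta)) = x ^+ 2 / D * (a * beta / D - 1).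
  by rewrite /s; field; rewrite gt_eqF.
move: hh; rewrite e1 pmulr_rge0; last first.
  by rewrite divr_gt0// exprn_even_gt0.
by rewrite subr_ge0 ler_pdivlMr// mul1r /D; lra.
Qed.

Section optimal.
Variables (B : 'M[R]_d) (b : 'cV[R]_d) (z : 'I_n -> 'cV[R]_d).
Hypotheses (n0 : (0 < n)%N) (Bpsd : psdmx B).
Hypothesis Yz : forall j, Y j = b + B *m z j.
Hypothesis opt : forall B' b' z', psdmx B' ->
  (forall j, Y j = b' + B' *m z' j) -> quad_obj B b z <= quad_obj B' b' z'.

Let cardT : (0 < #|[set: 'I_n]%SET|)%N.
Proof. by rewrite cardsT card_ord. Qed.

Local Notation m := (mean [set: 'I_n]%SET X).

(** Moving b by t B h and the preimages z by - t h keeps the points b + B z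
    fixed, so that the first-order term of the objective in t vanishes. *)
Lemma optimal_mean : b + B *m m = mean [set: 'I_n]%SET Y.
Proof.
have key h : dotv (B *m h) m = dotv (B *m h) (mean [set: 'I_n]%SET z).
  apply/eqP; rewrite -subr_eq0; apply/eqP.
  apply: (@linear_term_eq0 _ (2^-1 * dotv h (B *m h))).
    by rewrite mulr_ge0//; case: Bpsd => _; exact.
  move=> t.
  have := @opt B (b + t *: (B *m h)) (fun j => z j - t *: h) Bpsd.
  rewrite -subr_ge0 => /(_ _)/wrap[j|].
    by rewrite Yz mulmxBr -scalemxAr addrACA subrr addr0.
  move=> /le_trans; apply; apply: eq_leR; rewrite /quad_obj.
  have -> : avgT (fun i => quad B (b + t *: (B *m h)) (X i)) =
      avgT (fun i => quad B b (X i)) + t * dotv (B *m h) m.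
    rewrite dotv_mean -avgZ -avgD; apply: eq_avg => i.
    by rewrite /quad dotvDl dotvZl addrA.
  have -> : avgT (fun j => 2^-1 * dotv (z j - t *: h) (B *m (z j - t *: h))) =
      avgT (fun j => 2^-1 * dotv (z j) (B *m z j))
      + (- t) * dotv (B *m h) (mean [set: 'I_n]%SET z)
      + t ^+ 2 * (2^-1 * dotv h (B *m h)).
    rewrite dotv_mean -avgZ -avgD -[in RHS](avg_cst (t ^+ 2 * _) cardT) -avgD.
    apply: eq_avg => j; rewrite mulmxBr -scalemxAr !(dotvBl, dotvBr, dotvZl, dotvZr).
    rewrite [dotv (z j) (B *m h)]dotvC [dotv h (B *m z j)]dotv_sym ?(proj1 Bpsd)//.
    by field.
  by ring.
have Bm : B *m m = B *m mean [set: 'I_n]%SET z.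
  apply: mx_eq_dotv1 => h.
  by rewrite !dotv_sym ?(proj1 Bpsd)// key.
rewrite Bm addrC -mean_affine//; congr (mean _ _); apply/funext => j.
by rewrite Yz addrC.
Qed.

(** The competitor is B + s v v^T with v = B u, translated so as to keep the
    means matched.  To first order in s the objective changes by s/2 times the
    difference of the empirical variances of v.X and of u.Y, which must
    therefore agree.  The preimages of the Y j under the perturbed matrix are
    explicit by the Sherman-Morrison formula; perturbing along B u rather than
    along an arbitrary vector is what keeps them in the range. *)
Lemma optimal_cov : B *m cov [set: 'I_n]%SET X *m B = cov [set: 'I_n]%SET Y.
Proof.
have [Bt B0] := Bpsd.
apply: sym_eq_dotv => [||u]; [|exact: covT|].
  by rewrite !trmx_mul covT Bt mulmxA.
rewrite -!mulmxA dotv_sym// !cov_form//.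
set a := LHS; set e := RHS; pose v := B *m u; pose beta := dotv u v.
have beta0 : 0 <= beta by exact: B0.
apply: (@rank_one_term_eq _ _ beta) => // [|s sb].
  by apply: avg_ge0 => i _; exact: sqr_ge0.
have s1 : 0 < 1 + s * beta.
  have : `|s * beta| < 1 by rewrite normrM (ger0_norm beta0).
  by rewrite ltr_norml => /andP[]; lra.
pose Bs := B + s *: (v *m v^T).
have Bsv x : Bs *m x = B *m x + (s * dotv v x) *: v.
  rewrite /Bs mulmxDl -scalemxAl -mulmxA; congr (_ + _).
  rewrite [v^T *m x]mx11_scalar -/(dotv v x) mul_mx_scalar scalerA.
  by [].
have Bspsd : psdmx Bs.
  split; first by rewrite /Bs linearD/= linearZ/= trmx_mul trmxK Bt.
  move=> x; rewrite Bsv dotvDr dotvZr [dotv x v]dotvC -mulrA -expr2.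
  have := psd_CS u x Bpsd; rewrite dotv_sym// -/v -/beta => CS.
  have := B0 x; set q := dotv x (B *m x) in CS * => q0.
  have : `|s| * dotv v x ^+ 2 <= 1 * q.
    apply: le_trans (_ : `|s| * (beta * q) <= _); first by rewrite ler_wpM2l.
    by rewrite mulrA ler_wpM2r// ltW.
  have : - `|s| * dotv v x ^+ 2 <= s * dotv v x ^+ 2.
    by rewrite ler_wpM2r ?sqr_ge0// lerNl -normrN ler_norm.
  by lra.
pose mY := mean [set: 'I_n]%SET Y.
pose al j := dotv u (Y j - mY).
(* the Sherman-Morrison coefficient for the inverse of B + s v v^T *)
pose k := s / (1 + s * beta).
pose z' j := z j - (k * al j) *: u.
have BzE j : B *m (z j - m) = Y j - mY.
  by rewrite mulmxBr /mY -optimal_mean Yz opprD addrACA subrr add0r.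
have alE j : al j = dotv v (z j - m) by rewrite /al -BzE dotv_sym.
have Bsz j : Bs *m (z' j - m) = B *m (z j - m).
  rewrite (_ : z' j - m = (z j - m) - (k * al j) *: u); last by rewrite /z' addrAC.
  rewrite Bsv mulmxBr -scalemxAr -/v dotvBr dotvZr -alE [dotv v u]dotvC -/beta.
  rewrite -addrA -scaleNr -scalerDl.
  have -> : - (k * al j) + s * (al j - k * al j * beta) = 0.
    by rewrite /k; field; rewrite gt_eqF.
  by rewrite scale0r addr0.
have := @opt Bs (mY - Bs *m m) z' Bspsd.
move=> /(_ _)/wrap[j|].
  by rewrite -addrA -mulmxN -mulmxDr [- m + _]addrC Bsz BzE addrC subrK.
have bE : b = mY - B *m m by rewrite /mY -optimal_mean addrK.
have quadE C x : C^T = C -> quad C (mY - C *m m) x =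
    2^-1 * dotv (x - m) (C *m (x - m)) + dotv mY x - 2^-1 * dotv m (C *m m).
  move=> Ct; rewrite /quad mulmxBr !(dotvBl, dotvBr).
  rewrite [dotv m (C *m x)]dotv_sym// [dotv x (C *m m)]dotvC.
  by field.
have formE C x : C^T = C -> 2^-1 * dotv x (C *m x) =
    2^-1 * dotv (x - m) (C *m (x - m)) + dotv m (C *m (x - m))
    + 2^-1 * dotv m (C *m m).
  move=> Ct; rewrite mulmxBr !(dotvBl, dotvBr).
  rewrite [dotv m (C *m x)]dotv_sym// [dotv x (C *m m)]dotvC.
  by field.
move=> h0; rewrite -/k.
have e1 : avgT (fun i => quad Bs (mY - Bs *m m) (X i)) =
    avgT (fun i => quad B b (X i)) + 2^-1 * s * a
    - 2^-1 * s * dotv v m ^+ 2.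
  rewrite /a -avgZ -(avg_cst (- (2^-1 * s * _)) cardT) -!avgD.
  apply: eq_avg => i; rewrite quadE ?(proj1 Bspsd)// bE quadE//.
  move: (X i - m) => y.
  rewrite !Bsv !(dotvDr, dotvZr) [dotv m v]dotvC [dotv y v]dotvC -/v.
  by field.
have e2 : avgT (fun j => 2^-1 * dotv (z' j) (Bs *m z' j)) =
    avgT (fun j => 2^-1 * dotv (z j) (B *m z j)) + (- (2^-1 * k)) * e
    + 2^-1 * s * dotv v m ^+ 2.
  rewrite /e -avgZ -(avg_cst (2^-1 * s * _) cardT) -!avgD.
  apply: eq_avg => i; rewrite formE ?(proj1 Bspsd)// [in RHS]formE//.
  rewrite Bsz Bsv (dotvDr m (B *m m)) dotvZr [dotv m v]dotvC.
  rewrite (_ : z' i - m = (z i - m) - (k * al i) *: u); last by rewrite /z' addrAC.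
  have -> : dotv u (Y i - mean [set: 'I_n]%SET Y) = al i by [].
  have alE' : dotv u (B *m (z i - m)) = al i by rewrite BzE.
  rewrite (dotvBl (z i - m)) dotvZl alE'.
  by field.
by move: h0; rewrite /quad_obj e1 e2; lra.
Qed.

End optimal.

End stationarity.

(** * Gradients of quadratic functions *)

Section gradients.
Context {R : realType} {d : nat}.

(** An exact second-order expansion replaces the differential calculus of
    bilinear maps. *)
Lemma derive_second_order (f : 'cV[R]_d -> R) (x v : 'cV[R]_d) (a q : R) :
  (forall h : R, f (h *: v + x) = f x + h * a + h ^+ 2 * q) -> 'D_v f x = a.
Proof.
move=> fE; apply/cvg_lim => //.
have -> : a = a + 0 * q by rewrite mul0r addr0.
apply: (@cvg_trans _ ((fun h : R => a + h * q) @ 0^')).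
  apply: near_eq_cvg; near=> h; rewrite /= fE.
  have h0 : h != 0 by near: h; exact: nbhs_dnbhs_neq.
  by rewrite /GRing.scale/=; field.
apply: cvg_within_filter.
apply: (@continuousD _ _ _ (fun=> a) (fun h : R => h * q) 0); first exact: cst_continuous.
exact: mulrr_continuous.
Unshelve. all: by end_near. Qed.

Lemma dotv_delta (u : 'cV[R]_d) i : dotv u (delta_mx i 0) = u i 0.
Proof.
rewrite dotvE (bigD1 i)//= big1 ?addr0 ?mxE ?eqxx ?mulr1// => j ji.
by rewrite mxE (negPf ji) mulr0.
Qed.

Lemma grad_quadratic (B : 'M[R]_d) (c b x : 'cV[R]_d) : B^T = B ->
  grad (fun x => 2^-1 * dotv (x - c) (B *m (x - c)) + dotv b x) x
  = B *m (x - c) + b.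
Proof.
move=> Bt; apply/colP => i; rewrite mxE -[RHS]dotv_delta.
set v := delta_mx i 0.
apply: (@derive_second_order _ _ _ _ (2^-1 * dotv v (B *m v))) => h.
rewrite (_ : h *: v + x - c = h *: v + (x - c)); last by rewrite addrA.
move: (x - c) => y.
rewrite mulmxDr -scalemxAr !(dotvDl, dotvDr, dotvZl, dotvZr).
rewrite [dotv y (B *m v)]dotv_sym// [dotv v (B *m y)]dotvC.
by field.
Qed.

Lemma grad_coord_sqr (i : 'I_d) (x : 'cV[R]_d) :
  sqnorm (grad (fun x : 'cV[R]_d => x i 0 ^+ 2) x) = 4 * x i 0 ^+ 2.
Proof.
have -> : grad (fun x : 'cV[R]_d => x i 0 ^+ 2) x = (2 * x i 0) *: delta_mx i 0.
  apply/colP => k; rewrite mxE.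
  apply: (@derive_second_order _ _ _ _ ((delta_mx k 0 : 'cV[R]_d) i 0 ^+ 2)) => h.
  rewrite !mxE [i == k]eq_sym.
  by ring.
by rewrite sqnormZ /sqnorm dotv_delta mxE !eqxx mulr1 exprMn -natrX.
Qed.

Lemma differentiable_coord_sqr (i : 'I_d) (x : 'cV[R]_d) :
  differentiable (fun x : 'cV[R]_d => x i 0 ^+ 2) x.
Proof.
have h := differentiable_coord x i 0.
have := differentiableX 1 h; rewrite exprfctE; exact.
Qed.

End gradients.

(** * Integrals of products of independent functions *)

Section independence.
Context {R : realType} {dO : measure_display} {Omega : measurableType dO}.
Variable Pr : probability Omega R.
Local Open Scope ereal_scope.

Definition indep2 d1 d2 (T1 : measurableType d1) (T2 : measurableType d2)
    (f : Omega -> T1) (g : Omega -> T2) : Prop :=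
  forall A B, measurable A -> measurable B ->
    Pr (f @^-1` A `&` g @^-1` B) = Pr (f @^-1` A) * Pr (g @^-1` B).

Lemma indep2_comp d1 d2 d3 d4 (T1 : measurableType d1) (T2 : measurableType d2)
    (T3 : measurableType d3) (T4 : measurableType d4)
    (f : Omega -> T1) (g : Omega -> T2) (u : T1 -> T3) (v : T2 -> T4) :
  measurable_fun setT u -> measurable_fun setT v ->
  indep2 f g -> indep2 (u \o f) (v \o g).
Proof.
move=> mu mv fg A B mA mB; apply: (fg (u @^-1` A) (v @^-1` B)).
  by rewrite -[X in measurable X]setTI; exact: mu.
by rewrite -[X in measurable X]setTI; exact: mv.
Qed.

(** Independence identifies the joint law with the product law, so that the
    product rule for integrals is the Tonelli theorem. *)
Lemma ge0_indep2_integral (f g : Omega -> \bar R) :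
  measurable_fun setT f -> measurable_fun setT g ->
  (forall w, 0 <= f w) -> (forall w, 0 <= g w) -> indep2 f g ->
  \int[Pr]_w (f w * g w) = \int[Pr]_w f w * \int[Pr]_w g w.
Proof.
move=> mf mg f0 g0 fg.
pose F : {RV Pr >-> \bar R} := mfun_Sub (mem_set mf).
pose G : {RV Pr >-> \bar R} := mfun_Sub (mem_set mg).
have mfg : measurable_fun setT (fun w => (f w, g w)).
  exact: measurable_fun_pair.
pose FG : {RV Pr >-> (\bar R * \bar R)%type} := mfun_Sub (mem_set mfg).
pose h (z : \bar R * \bar R) : \bar R := `|z.1| * `|z.2|.
have mh : measurable_fun setT h.
  apply: emeasurable_funM; apply: measurableT_comp => //.
have h0 z : 0 <= h z by rewrite mule_ge0.
transitivity (\int[distribution Pr FG]_z h z).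
  rewrite ge0_integral_distribution//; apply: eq_integral => w _ /=.
  by rewrite /h /= !gee0_abs.
transitivity (\int[(distribution Pr F \x distribution Pr G)]_z h z).
  apply: eq_measure_integral => A mA _; apply/esym.
  apply: product_measure_unique => // B C mB mC.
rewrite fubini_tonelli1// /fubini_F /=.
have intG : \int[distribution Pr G]_y `|y| = \int[Pr]_w g w.
  rewrite ge0_integral_distribution//; apply: eq_integral => w _ /=.
  by rewrite gee0_abs.
transitivity (\int[distribution Pr F]_x (`|x| * \int[Pr]_w g w)).
  by apply: eq_integral => x _; rewrite /h/= ge0_integralZl// intG.
rewrite ge0_integralZr//; last by apply: integral_ge0.
rewrite ge0_integral_distribution//; congr (_ * _).
by apply: eq_integral => w _ /=; rewrite gee0_abs.
Qed.

(** The case of integrable factors, one of them centered, which makes the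
    cross terms in the variance of a sum vanish. *)
Lemma indep2_integral0 (f g : Omega -> R) :
  Pr.-integrable setT (EFin \o f) -> Pr.-integrable setT (EFin \o g) ->
  indep2 f g -> \int[Pr]_w (g w)%:E = 0 ->
  \int[Pr]_w (f w * g w)%:E = 0.
Proof.
move=> intf intg fg Eg0.
have mf : measurable_fun setT f by exact/measurable_EFinP/(measurable_int Pr).
have mg : measurable_fun setT g by exact/measurable_EFinP/(measurable_int Pr).
(* reduces to four products of nonnegative factors *)
pose pos (x : R) : R := Num.max x 0%R; pose neg (x : R) : R := Num.max (- x)%R 0%R.
have mpos : measurable_fun setT pos by exact: measurable_maxr.
have mneg : measurable_fun setT neg.
  by apply: measurable_maxr => //; exact: oppr_measurable.
have pos0 x : (0 <= pos x)%R by rewrite le_max lexx orbT.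
have neg0 x : (0 <= neg x)%R by rewrite le_max lexx orbT.
have posneg x : (x = pos x - neg x)%R.
  rewrite /pos /neg; case: (leP x 0%R) => x0; case: (leP (- x)%R 0%R) => x1; lra.
have pos_le x : (pos x <= `|x|)%R.
  by rewrite /pos ge_max normr_ge0 ler_norm.
have neg_le x : (neg x <= `|x|)%R.
  by rewrite /neg ge_max normr_ge0 -normrN ler_norm.
have key (k : R -> R) (h : Omega -> R) : measurable_fun setT k ->
    measurable_fun setT h -> Pr.-integrable setT (EFin \o h) ->
    (forall x, 0 <= k x)%R -> (forall x, k x <= `|x|)%R ->
    Pr.-integrable setT (EFin \o (k \o h)).
  move=> mk mh ih k0 kle; apply: le_integrable ih => //.
    by apply/measurable_EFinP; exact: measurableT_comp.
  by move=> w _ /=; rewrite !lee_fin ger0_norm// kle.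
have prod (k1 k2 : R -> R) : measurable_fun setT k1 -> measurable_fun setT k2 ->
    (forall x, 0 <= k1 x)%R -> (forall x, 0 <= k2 x)%R ->
    \int[Pr]_w (k1 (f w) * k2 (g w))%:E =
    \int[Pr]_w (k1 (f w))%:E * \int[Pr]_w (k2 (g w))%:E.
  move=> m1 m2 k10 k20; under eq_integral do rewrite EFinM.
  apply: ge0_indep2_integral.
  - by apply/measurable_EFinP; exact: measurableT_comp.
  - by apply/measurable_EFinP; exact: measurableT_comp.
  - by move=> w; rewrite lee_fin.
  - by move=> w; rewrite lee_fin.
  - by apply: (@indep2_comp _ _ _ _ _ _ _ _ f g (EFin \o k1) (EFin \o k2)) => //; exact/measurable_EFinP.
have fin (k : R -> R) (h : Omega -> R) : Pr.-integrable setT (EFin \o (k \o h)) ->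
    (\int[Pr]_w (k (h w))%:E) \is a fin_num.
  by move=> ih; exact: (integrable_fin_num _ ih).
have ifp := key pos f mpos mf intf pos0 pos_le.
have ifn := key neg f mneg mf intf neg0 neg_le.
have igp := key pos g mpos mg intg pos0 pos_le.
have ign := key neg g mneg mg intg neg0 neg_le.
have Eg : \int[Pr]_w (pos (g w))%:E = \int[Pr]_w (neg (g w))%:E.
  have : \int[Pr]_w ((pos (g w))%:E - (neg (g w))%:E) = 0.
    by rewrite -Eg0; apply: eq_integral => w _; rewrite -EFinB -posneg.
  rewrite integralB//= => h.
  move: h; rewrite -(fineK (fin _ _ igp)) -(fineK (fin _ _ ign)) -EFinB.
  by move=> [] /subr0_eq ->.
have iprod (k1 k2 : R -> R) : measurable_fun setT k1 -> measurable_fun setT k2 ->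
    (forall x, 0 <= k1 x)%R -> (forall x, 0 <= k2 x)%R ->
    Pr.-integrable setT (EFin \o (k1 \o f)) -> Pr.-integrable setT (EFin \o (k2 \o g)) ->
    Pr.-integrable setT (fun w => (k1 (f w) * k2 (g w))%:E).
  move=> m1 m2 k10 k20 i1 i2; apply/integrableP; split.
    by apply/measurable_EFinP; apply: measurable_funM; exact: measurableT_comp.
  under eq_integral => w _ do rewrite /= ger0_norm ?mulr_ge0//.
  rewrite prod//.
  by rewrite ltey_eq fin_numM ?fin.
have -> : \int[Pr]_w (f w * g w)%:E = \int[Pr]_w (
    ((pos (f w) * pos (g w))%:E - (pos (f w) * neg (g w))%:E)
    - ((neg (f w) * pos (g w))%:E - (neg (f w) * neg (g w))%:E)).
  apply: eq_integral => w _; rewrite -!EFinB; congr EFin.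
  by rewrite {1}(posneg (f w)) {1}(posneg (g w)); ring.
have ipp := iprod _ _ mpos mpos pos0 pos0 ifp igp.
have ipn := iprod _ _ mpos mneg pos0 neg0 ifp ign.
have inp := iprod _ _ mneg mpos neg0 pos0 ifn igp.
have inn := iprod _ _ mneg mneg neg0 neg0 ifn ign.
rewrite integralB//; [|exact: integrableB ipp ipn|exact: integrableB inp inn].
rewrite integralB// integralB//.
rewrite !prod// Eg !subee ?sube0//.
- by rewrite fin_numM ?fin.
- by rewrite fin_numM ?fin.
Qed.

End independence.

(** * Functions of disjoint groups of a sample *)

Section groups.
Context {R : realType} {dO dT : measure_display}
  {Omega : measurableType dO} {T : measurableType dT}.
Variable Pr : probability Omega R.
Context {I : finType}.
Variable Z : I -> {RV Pr >-> T}.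

(** The pi-system of product events on the coordinates in J, which generates
    the sigma-algebra of the group J. *)
Definition cylinder (J : {set I}) : set (set Omega) :=
  [set E | exists A : I -> set T, [/\ forall i, measurable (A i),
    forall i, i \notin J -> A i = setT & E = \bigcap_i (Z i @^-1` A i)]].

Definition group_measurable d (T' : measurableType d) (J : {set I})
    (f : Omega -> T') : Prop :=
  @measurable_fun _ _ (g_sigma_algebraType (cylinder J)) T' setT f.

Lemma measurable_preimage_RV i (A : set T) : measurable A ->
  measurable (Z i @^-1` A).
Proof. by move=> mA; rewrite -[X in measurable X]setTI; exact: measurable_funP. Qed.

Lemma cylinder_measurable J : cylinder J `<=` measurable.
Proof.
move=> _ [A [mA _ ->]]; apply: fin_bigcap_measurable => // i _.
exact: measurable_preimage_RV.
Qed.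

Lemma cylinder_setI J : setI_closed (cylinder J).
Proof.
move=> _ _ [A [mA AT ->]] [B [mB BT ->]].
exists (fun i => A i `&` B i); split.
- by move=> i; exact: measurableI.
- by move=> i iJ; rewrite AT// BT// setTI.
- by rewrite -bigcapI; apply: eq_bigcapr => i _; rewrite preimage_setI.
Qed.

Lemma cylinder_setT J : cylinder J setT.
Proof.
exists (fun=> setT); split => //; apply/esym/seteqP; split => // w _ i _ //.
Qed.

Lemma group_measurable_fun d (T' : measurableType d) J (f : Omega -> T') :
  group_measurable J f -> measurable_fun setT f.
Proof.
move=> mf _ A mA; have := mf measurableT A mA.
rewrite !setTI; apply: smallest_sub; last exact: cylinder_measurable.
exact: sigma_algebra_measurable.
Qed.

Lemma group_measurable_RV (J : {set I}) i : i \in J -> group_measurable J (Z i).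
Proof.
move=> iJ _ A mA; rewrite setTI; apply: sub_sigma_algebra.
exists (fun k => if k == i then A else setT); split.
- by move=> k; case: ifP.
- by move=> k kJ; case: eqP => // ki; rewrite ki iJ in kJ.
- apply/seteqP; split => w.
    by move=> Aw k _ /=; case: eqP => // ->.
  by move=> /(_ i Logic.I) /=; rewrite eqxx.
Qed.

Lemma group_measurable_comp d d' (T1 : measurableType d) (T2 : measurableType d')
    (J : {set I}) (f : Omega -> T1) (u : T1 -> T2) :
  measurable_fun setT u -> group_measurable J f -> group_measurable J (u \o f).
Proof. by move=> mu mf; exact: measurableT_comp mu mf. Qed.

Hypothesis ind : mutually_independent Z.
Local Open Scope ereal_scope.

Lemma cylinder_indep (J K : {set I}) E F : [disjoint J & K]%B -> cylinder J E -> cylinder K F ->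
  Pr (E `&` F) = Pr E * Pr F.
Proof.
move=> dJK [A [mA AT ->]] [B [mB BT ->]].
rewrite -bigcapI.
under eq_bigcapr do rewrite -preimage_setI.
rewrite !ind//; last by move=> i; exact: measurableI.
rewrite -big_split/=; apply: eq_bigr => i _.
have [iJ|iJ] := boolP (i \in J).
  have iK : i \notin K by rewrite (disjointFr dJK).
  by rewrite (BT _ iK) setIT preimage_setT probability_setT mule1.
by rewrite (AT _ iJ) setTI preimage_setT probability_setT mul1e.
Qed.

(** For fixed F, both sides are finite measures in E, and two finite measures
    that agree on a pi-system agree on the sigma-algebra that it generates. *)
Lemma sigma_indep (G : set (set Omega)) F : G `<=` measurable ->
  setI_closed G -> G setT -> measurable F ->
  (forall E, G E -> Pr (E `&` F) = Pr E * Pr F) ->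
  forall E, <<s G >> E -> Pr (E `&` F) = Pr E * Pr F.
Proof.
move=> Gm GI GT mF h E sE.
have F0 : (0 <= fine (Pr F))%R by exact: fine_ge0.
have Ffin : Pr F \is a fin_num by exact: fin_num_measure.
have sc A : mscale (NngNum F0) Pr A = Pr A * Pr F.
  by rewrite muleC -{2}(fineK Ffin).
rewrite -sc.
rewrite -[LHS]/(mrestr Pr mF E).
apply: (@g_sigma_algebra_measure_unique _ _ _ G Gm (fun=> setT)) => //.
- by rewrite bigcup_const.
- by move=> A GA; apply: etrans (h _ GA) _; exact/esym/sc.
- move=> _; apply: (@le_lt_trans _ _ (Pr F)); last by rewrite ltey_eq Ffin.
  by apply: le_measure; rewrite ?inE//; exact: measurableI.
Qed.

Lemma group_indep d1 d2 (T1 : measurableType d1) (T2 : measurableType d2)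
    (J K : {set I}) (f : Omega -> T1) (g : Omega -> T2) : [disjoint J & K]%B ->
  group_measurable J f -> group_measurable K g -> indep2 Pr f g.
Proof.
move=> dJK mf mg A B mA mB.
have sA : <<s cylinder J >> (f @^-1` A).
  by have := mf measurableT A mA; rewrite setTI.
have sB : <<s cylinder K >> (g @^-1` B).
  by have := mg measurableT B mB; rewrite setTI.
have mB' : measurable (g @^-1` B).
  by rewrite -[X in measurable X]setTI; apply: (group_measurable_fun mg).
apply: (sigma_indep (@cylinder_measurable J)) sA => //.
- exact: cylinder_setI.
- exact: cylinder_setT.
move=> E cE; rewrite setIC muleC.
apply: (sigma_indep (@cylinder_measurable K)) sB => //.
- exact: cylinder_setI.
- exact: cylinder_setT.
- exact: cylinder_measurable cE.
move=> F cF; rewrite setIC muleC; exact: cylinder_indep cE cF.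
Qed.

Lemma group_integralM (J K : {set I}) (f g : Omega -> \bar R) : [disjoint J & K]%B ->
  group_measurable J f -> group_measurable K g ->
  (forall w, 0 <= f w) -> (forall w, 0 <= g w) ->
  \int[Pr]_w (f w * g w) = \int[Pr]_w f w * \int[Pr]_w g w.
Proof.
move=> dJK mf mg f0 g0; apply: ge0_indep2_integral => //.
- exact: group_measurable_fun mf.
- exact: group_measurable_fun mg.
- exact: group_indep mf mg.
Qed.

Lemma group_measurableS d (T' : measurableType d) (J K : {set I}) (f : Omega -> T') :
  J \subset K -> group_measurable J f -> group_measurable K f.
Proof.
move=> JK mf _ A mA; have := mf measurableT A mA; rewrite !setTI.
apply: sub_sigma_algebra2 => E [C [mC CT ->]]; exists C; split => // i iK.
by apply: CT; apply: contra iK; exact: (fintype.subsetP JK).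
Qed.

End groups.

(** * Variance of an empirical average *)

Section averages.
Context {R : realType} {dO dT : measure_display}
  {Omega : measurableType dO} {T : measurableType dT}.
Variables (Pr : probability Omega R) (P : probability T R).
Context {I : finType}.
Variable Z : I -> {RV Pr >-> T}.
Hypothesis ind : mutually_independent Z.
Local Open Scope ereal_scope.

Lemma ge0_integral_law (V : {RV Pr >-> T}) (f : T -> \bar R) : has_law V P ->
  measurable_fun setT f -> (forall t, 0 <= f t) ->
  \int[Pr]_w f (V w) = \int[P]_t f t.
Proof.
move=> lawV mf f0; rewrite -[LHS]/(\int[Pr]_w (f \o V) w).
rewrite -ge0_integral_distribution//.
by apply: eq_measure_integral => A mA _; exact: lawV.
Qed.

Lemma integral_law (V : {RV Pr >-> T}) (f : T -> \bar R) : has_law V P ->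
  measurable_fun setT f -> \int[Pr]_w f (V w) = \int[P]_t f t.
Proof.
move=> lawV mf; rewrite integralE [RHS]integralE; congr (_ - _).
  rewrite -(ge0_integral_law lawV)//; last exact: measurable_funepos.
  by apply: eq_integral => w _; rewrite !funeposE.
rewrite -(ge0_integral_law lawV)//; last exact: measurable_funeneg.
by apply: eq_integral => w _; rewrite !funenegE.
Qed.

Lemma integrable_of_sq d (S : measurableType d) (mu : probability S R) (f : S -> R) :
  measurable_fun setT f -> mu.-integrable setT (fun s => (f s ^+ 2)%:E) ->
  mu.-integrable setT (EFin \o f).
Proof.
move=> mf if2; apply: (@le_integrable _ _ _ mu _ measurableT _ (fun s => (1 + f s ^+ 2)%:E)).
- exact/measurable_EFinP.
- move=> s _ /=; rewrite lee_fin [leRHS]ger0_norm ?addr_ge0 ?sqr_ge0//.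
  have := sqr_ge0 (`|f s| - 1)%R; have := sqr_ge0 (f s).
  by rewrite sqrrB mulr1 expr1n real_normK ?num_real//; lra.
- under eq_fun do rewrite EFinD.
  apply: integrableD => //.
  exact: finite_measure_integrable_cst.
Qed.

Lemma integrable_mul d (S : measurableType d) (mu : probability S R) (f g : S -> R) :
  measurable_fun setT f -> measurable_fun setT g ->
  mu.-integrable setT (fun s => (f s ^+ 2)%:E) ->
  mu.-integrable setT (fun s => (g s ^+ 2)%:E) ->
  mu.-integrable setT (fun s => (f s * g s)%:E).
Proof.
move=> mf mg if2 ig2.
apply: (@le_integrable _ _ _ mu _ measurableT _ (fun s => (f s ^+ 2 + g s ^+ 2)%:E)).
- by apply/measurable_EFinP; exact: measurable_funM.
- move=> s _ /=; rewrite lee_fin [leRHS]ger0_norm ?addr_ge0 ?sqr_ge0//.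
  rewrite ler_norml; have := sqr_ge0 (f s - g s); have := sqr_ge0 (f s + g s).
  have := sqr_ge0 (f s); have := sqr_ge0 (g s).
  by move=> h1 h2 h3 h4; apply/andP; split; nra.
- under eq_fun do rewrite EFinD.
  exact: integrableD.
Qed.

Variables (zeta : T -> R) (C : R).
Hypothesis law : forall i, has_law (Z i) P.
Hypothesis mz : measurable_fun setT zeta.
Hypothesis zsq : \int[P]_t (zeta t ^+ 2)%:E <= C%:E.
Hypothesis zmean : \int[P]_t (zeta t)%:E = 0.

Let g i w := zeta (Z i w).
Let S (s : seq I) w : R := (\sum_(i <- s) g i w)%R.

Let gm (J : {set I}) i : i \in J -> group_measurable Z J (g i).
Proof.
by move=> iJ; apply: (group_measurable_comp mz); exact: group_measurable_RV.
Qed.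

Let Sm (s : seq I) : group_measurable Z [set i in s]%SET (S s).
Proof.
have -> : S s = (fun w => \sum_(i <- s) (if i \in s then g i else cst 0%R) w)%R.
  by apply/funext => w; apply: eq_big_seq => i ->.
apply: measurable_sum => i; case: ifPn => // is_.
by apply: gm; rewrite inE.
Qed.

Let mg i : measurable_fun setT (g i).
Proof. exact: group_measurable_fun (gm (finset.set11 i)). Qed.

Let mS s : measurable_fun setT (S s).
Proof. exact: group_measurable_fun (@Sm s). Qed.

Let g2 i : \int[Pr]_w (g i w ^+ 2)%:E <= C%:E.
Proof.
rewrite (ge0_integral_law (law i) (f := fun t => (zeta t ^+ 2)%:E))//.
  by apply/measurable_EFinP; exact: measurable_funX.
by move=> t; rewrite lee_fin sqr_ge0.
Qed.

Let ig2 i : Pr.-integrable setT (fun w => (g i w ^+ 2)%:E).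
Proof.
apply/integrableP; split; first by apply/measurable_EFinP; exact: measurable_funX.
under eq_integral => w _ do rewrite gee0_abs ?lee_fin ?sqr_ge0//.
exact: le_lt_trans (g2 i) (ltry _).
Qed.

Let g0 i : \int[Pr]_w (g i w)%:E = 0.
Proof.
by rewrite (integral_law (law i) (f := fun t => (zeta t)%:E))//; exact/measurable_EFinP.
Qed.

(** Adding one variable at a time: the cross term with the previous ones
    vanishes by independence. *)
Lemma sum_sq_le (s : seq I) : uniq s ->
  Pr.-integrable setT (fun w => (S s w ^+ 2)%:E) /\
  \int[Pr]_w (S s w ^+ 2)%:E <= ((size s)%:R * C)%:E.
Proof.
elim: s => [_|i s IH /= /andP[is_ us]].
  have -> : (fun w => (S [::] w ^+ 2)%:E) = cst 0.
    by apply/funext => w; rewrite /S big_nil expr0n.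
  by rewrite integral0 mul0r; split => //; exact: integrable0.
have [iS2 bS] := IH us.
have igS : Pr.-integrable setT (fun w => (S s w * g i w)%:E).
  exact: integrable_mul.
have gS0 : \int[Pr]_w (S s w * g i w)%:E = 0.
  apply: indep2_integral0 => //; try exact: integrable_of_sq.
  apply: (group_indep ind _ (@Sm s) (gm (finset.set11 i))).
  by rewrite disjoint_sym disjoints1 inE.
have SE w : (S (i :: s) w ^+ 2)%:E =
    (g i w ^+ 2)%:E + (S s w ^+ 2)%:E + 2%:E * (S s w * g i w)%:E.
  by rewrite -EFinM -!EFinD /S big_cons; congr EFin; ring.
have iZ : Pr.-integrable setT (fun w => 2%:E * (S s w * g i w)%:E) by exact: integrableZl.
have iD := integrableD measurableT (ig2 i) iS2.
split.
  by under eq_fun do rewrite SE; exact: integrableD.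
under eq_integral do rewrite SE.
rewrite integralD// integralD// integralZl// gS0 mule0 adde0.
rewrite -natr1 mulrDl mul1r addrC EFinD.
exact: leeD.
Qed.

Lemma avg_sq_le (H : {set I}) : (0 < #|H|)%N ->
  \int[Pr]_w (avg H (fun i => zeta (Z i w)) ^+ 2)%:E <= (C / #|H|%:R)%:E.
Proof.
move=> H0; have [iS bS] := sum_sq_le (enum_uniq H).
have Hr : (0 < #|H|%:R :> R)%R by rewrite ltr0n.
have -> : \int[Pr]_w (avg H (fun i => zeta (Z i w)) ^+ 2)%:E =
    \int[Pr]_w ((#|H|%:R^-1 ^+ 2)%:E * (S (enum H) w ^+ 2)%:E).
  apply: eq_integral => w _; rewrite -EFinM /avg exprMn /S.
  by rewrite big_enum.
rewrite integralZl// (le_trans (lee_wpmul2l _ bS))//.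
rewrite -EFinM lee_fin -cardE; apply: eq_leR.
by field; rewrite gt_eqF.
Qed.

End averages.

(** * A finite net of slabs *)

Section grid.
Context {R : realType} {d : nat}.
Implicit Types (v x : 'cV[R]_d).

Definition grid_dir (m : nat) (g : {ffun 'I_d -> 'I_(2 * m).+1}) : 'cV[R]_d :=
  \col_k ((g k)%:R / m%:R - 1).

Definition grid_off (t : R) (q : nat) (h : 'I_(2 * q).+1) : R := t * (h%:R - q%:R).

Lemma dotv_sup_le (v x : 'cV[R]_d) (a b : R) :
  (forall k, `|v k 0| <= a) -> (forall k, `|x k 0| <= b) ->
  `|dotv v x| <= d%:R * (a * b).
Proof.
move=> va xb; rewrite dotvE (le_trans (ler_norm_sum _ _ _))//.
apply: le_trans (_ : _ <= \sum_(i < d) a * b) _.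
  by apply: ler_sum => k _; rewrite normrM ler_pM.
by rewrite sumr_const card_ord mulr_natl.
Qed.

(** Rounding down to the multiples of 1/m keeps the values 1 and -1, so that the
    rounded direction still has sup norm 1 and the density bound applies to it. *)
Lemma grid_dirP (m : nat) (v : 'cV[R]_d) : (0 < m)%N ->
  (forall k, `|v k 0| <= 1) ->
  exists g : {ffun 'I_d -> 'I_(2 * m).+1},
    (forall k, `|(grid_dir g - v) k 0| <= m%:R^-1) /\
    (forall k, `|v k 0| = 1 -> `|grid_dir g k 0| = 1).
Proof.
move=> m0 v1; have m0r : 0 < m%:R :> R by rewrite ltr0n.
pose y k := m%:R * (v k 0 + 1).
have vk k : - 1 <= v k 0 <= 1 by have := v1 k; rewrite ler_norml.
have y0 k : 0 <= y k.
  by rewrite mulr_ge0// -lerBlDr sub0r; have /andP[] := vk k.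
have ym k : y k <= (2 * m)%:R.
  rewrite natrM [leRHS]mulrC /y ler_wpM2l//.
  by have /andP[_] := vk k; lra.
have ty k : (Num.truncn (y k) < (2 * m).+1)%N.
  rewrite ltnS -(ler_nat R) (le_trans _ (ym k))//.
  by have /andP[] := truncn_itv (y0 k).
exists [ffun k => Ordinal (ty k)]; split => k.
  rewrite !mxE ffunE/=; have /andP[] := truncn_itv (y0 k).
  set r := (Num.truncn _)%:R; rewrite -natr1 -/r => h1 h2.
  have -> : r / m%:R - 1 - v k 0 = (r - y k) / m%:R.
    by rewrite /y; field; rewrite gt_eqF.
  rewrite normrM normfV (gtr0_norm m0r) ler_piMl ?invr_ge0//.
  by rewrite ler_norml; apply/andP; split; lra.
move=> vk1; rewrite mxE ffunE/=.
have [vE|vE] : v k 0 = 1 \/ v k 0 = - 1.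
  by move/eqP: vk1; rewrite eqr_norml ler01 andbT => /orP[/eqP|/eqP]; [left|right].
  rewrite /y vE; have -> : m%:R * (1 + 1) = (2 * m)%:R :> R by rewrite natrM; ring.
  rewrite natrK natrM mulfK ?gt_eqF//.
  by rewrite (_ : 2 - 1 = 1 :> R) ?normr1//; ring.
by rewrite /y vE addNr mulr0 truncn0 mul0r sub0r normrN normr1.
Qed.

Lemma grid_offP (q : nat) (t c : R) : 0 < t -> `|c| <= t * q%:R ->
  exists h : 'I_(2 * q).+1, `|grid_off t h - c| <= t.
Proof.
move=> t0; rewrite ler_norml => /andP[c1 c2].
pose y := c / t + q%:R.
have y0 : 0 <= y.
  by rewrite /y -lerBlDr sub0r ler_pdivlMr// mulNr mulrC.
have ym : y <= (2 * q)%:R.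
  rewrite /y natrM -lerBrDr [leRHS](_ : _ = q%:R); last by ring.
  by rewrite ler_pdivrMr// mulrC.
have ty : (Num.truncn y < (2 * q).+1)%N.
  by rewrite ltnS -(ler_nat R) (le_trans _ ym)//; have /andP[] := truncn_itv y0.
exists (Ordinal ty); rewrite /grid_off/=.
have /andP[] := truncn_itv y0; set r := (Num.truncn _)%:R; rewrite -natr1 -/r => h1 h2.
have -> : t * (r - q%:R) - c = t * (r - y).
  by rewrite /y; field; rewrite gt_eqF.
rewrite normrM (gtr0_norm t0) ler_piMr ?(ltW t0)//.
by rewrite ler_norml; apply/andP; split; lra.
Qed.

(** Rounding v to the grid moves each inner product by at most t, because the
    points are bounded by r, and rounding c costs another t.  The bound on the
    points is also what confines c to a finite range. *)
Lemma grid_slab (I : finType) (H : {set I}) (z : I -> 'cV[R]_d) v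
    (m : nat) (r t c : R) (k0 : 'I_d) :
  (0 < m)%N -> (0 < #|H|)%N -> 0 < t -> d%:R * r <= t * m%:R ->
  (forall i k, i \in H -> `|z i k 0| <= r) ->
  (forall k, `|v k 0| <= 1) -> `|v k0 0| = 1 ->
  (forall i, i \in H -> `|dotv v (z i) - c| <= t) ->
  exists (g : {ffun 'I_d -> 'I_(2 * m).+1}) (h : 'I_(2 * m.+1).+1),
    (exists k, `|grid_dir g k 0| = 1) /\
    (forall i, i \in H -> `|dotv (grid_dir g) (z i) - grid_off t h| <= 3 * t).
Proof.
move=> m0 H0 t0 drm zr v1 vk0 slab.
have m0r : 0 < m%:R :> R by rewrite ltr0n.
have [i0 i0H] := card_gt0P H0.
have c_le : `|c| <= t * m.+1%:R.
  have h1 := slab i0 i0H.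
  have h2 := dotv_sup_le v1 (fun k => zr i0 k i0H).
  rewrite mul1r in h2.
  have := ler_normB (dotv v (z i0)) (dotv v (z i0) - c).
  rewrite opprB addrC subrK -natr1; lra.
have [g [g1 g2]] := grid_dirP m0 v1.
have [h hc] := grid_offP t0 c_le.
exists g, h; split; first by exists k0; exact: g2.
move=> i iH.
have h1 := dotv_sup_le g1 (fun k => zr i k iH).
have h2 : `|dotv (grid_dir g - v) (z i)| <= t.
  apply: le_trans h1 _; rewrite mulrCA mulrC ler_pdivrMr//.
have -> : dotv (grid_dir g) (z i) - grid_off t h =
   dotv (grid_dir g - v) (z i) + (dotv v (z i) - c) - (grid_off t h - c).
  by rewrite dotvBl; ring.
have := slab i iH.
have := ler_normB (dotv (grid_dir g - v) (z i) + (dotv v (z i) - c)) (grid_off t h - c).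
have := ler_normD (dotv (grid_dir g - v) (z i)) (dotv v (z i) - c).
by lra.
Qed.

Lemma sup_coord v : v != 0 -> exists k0, v k0 0 != 0 /\ forall k, `|v k 0| <= `|v k0 0|.
Proof.
move=> v0; have [k vk] : exists k, v k 0 != 0.
  apply/existsP; apply: contra_neqT v0; rewrite negb_exists => /forallP h.
  by apply/colP => k; rewrite mxE; apply/eqP; have := h k; rewrite negbK.
case: (@arg_maxP _ R _ k xpredT (fun k => `|v k 0|) isT) => k0 _ hk0.
exists k0; split => [|j]; last exact: hk0.
by rewrite -normr_gt0 (lt_le_trans _ (hk0 k isT))// normr_gt0.
Qed.

Lemma sqnorm_sup_le v (a : R) : (forall k, `|v k 0| <= a) -> sqnorm v <= d%:R * a ^+ 2.
Proof.
move=> va; rewrite /sqnorm expr2.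
by have := dotv_sup_le va va; apply: le_trans; exact: ler_norm.
Qed.

(** Once v is scaled to sup norm 1, some point of the group is farther than t
    from the hyperplane, and the square of this one deviation bounds the sum. *)
Lemma no_slab_form (I : finType) (H : {set I}) (z : I -> 'cV[R]_d) (t : R) :
  0 < t -> (0 < #|H|)%N ->
  (forall v c k0, (forall k, `|v k 0| <= 1) -> `|v k0 0| = 1 ->
     exists2 i, i \in H & t < `|dotv v (z i) - c|) ->
  forall v c, t ^+ 2 * sqnorm v <=
    d%:R * (#|H|%:R * avg H (fun i => (dotv v (z i) - c) ^+ 2)).
Proof.
move=> t0 H0 spread v c; rewrite card_avg//.
have [->|v0] := eqVneq v 0.
  by rewrite /sqnorm dotv0r mulr0 mulr_ge0// sumr_ge0// => i _; exact: sqr_ge0.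
have [k0 [vk0 vmax]] := sup_coord v0.
set a := v k0 0 in vk0 vmax; pose w := a^-1 *: v.
have a0 : 0 < `|a| by rewrite normr_gt0.
have w1 k : `|w k 0| <= 1.
  by rewrite mxE normrM normfV mulrC ler_pdivrMr// mul1r.
have wk0 : `|w k0 0| = 1 by rewrite mxE mulVf// normr1.
have [i iH ti] := spread w (a^-1 * c) k0 w1 wk0.
apply: le_trans (_ : t ^+ 2 * (d%:R * `|a| ^+ 2) <= _).
  by rewrite ler_wpM2l ?sqr_ge0//; exact: sqnorm_sup_le.
rewrite mulrCA ler_wpM2l// (bigD1 i)//=.
apply: ler_wpDr; first by apply: sumr_ge0 => j _; exact: sqr_ge0.
have h : t * `|a| <= `|dotv v (z i) - c|.
  move: ti; rewrite /w dotvZl -mulrBr normrM normfV mulrC => ti.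
  by rewrite -ler_pdivlMr// ltW.
rewrite -exprMn; apply: le_trans (_ : `|dotv v (z i) - c| ^+ 2 <= _).
  by rewrite ler_sqr ?nnegrE// mulr_ge0// ltW.
by rewrite real_normK ?num_real.
Qed.

End grid.

(** * Moments of an isotropic law with a Poincare inequality *)

Lemma ereal_eq_le {R : realType} (x y : \bar R) : x = y -> (x <= y)%E.
Proof. by move=> ->. Qed.

Lemma integral_prob_cst {R : realType} d (T : measurableType d)
    (mu : probability T R) (c : R) : (\int[mu]_x c%:E = c%:E)%E.
Proof. by rewrite integral_cst// [X in (_ * X)%E]probability_setT mule1. Qed.

Section centered_L2.
Context {R : realType} {dT : measure_display} {T : measurableType dT}.
Variable P : probability T R.
Local Open Scope ereal_scope.

Definition centered_L2 (f : T -> R) : Prop :=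
  [/\ measurable_fun setT f, P.-integrable setT (fun t => (f t ^+ 2)%:E) &
      \int[P]_t (f t)%:E = 0].

Lemma centered_L2Z (c : R) f : centered_L2 f -> centered_L2 (fun t => c * f t)%R.
Proof.
move=> [mf if2 f0]; split.
- exact: measurable_funM.
- under eq_fun do rewrite exprMn EFinM.
  exact: integrableZl.
- under eq_integral do rewrite EFinM.
  by rewrite integralZl ?f0 ?mule0//; exact: integrable_of_sq.
Qed.

Lemma centered_L2D f g : centered_L2 f -> centered_L2 g ->
  centered_L2 (fun t => f t + g t)%R.
Proof.
move=> [mf if2 f0] [mg ig2 g0]; split.
- exact: measurable_funD.
- apply: (@le_integrable _ _ _ P _ measurableT _ (fun t => (2 * f t ^+ 2 + 2 * g t ^+ 2)%:E)).
  + by apply/measurable_EFinP; apply: measurable_funX; exact: measurable_funD.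
  + move=> t _ /=; rewrite lee_fin !ger0_norm ?sqr_ge0//; last first.
      by rewrite addr_ge0// mulr_ge0// sqr_ge0.
    by have := sqr_ge0 (f t - g t); lra.
  + under eq_fun do rewrite EFinD !EFinM.
    by apply: integrableD => //; exact: integrableZl.
- under eq_integral do rewrite EFinD.
  rewrite integralD//; try exact: integrable_of_sq.
  by rewrite f0 g0 adde0.
Qed.

Lemma centered_L2_0 : centered_L2 (fun=> 0%R).
Proof.
split => //; last by rewrite integral0.
by under eq_fun do rewrite expr0n; exact: integrable0.
Qed.

Lemma centered_L2_sum (I : finType) (f : I -> T -> R) :
  (forall i, centered_L2 (f i)) -> centered_L2 (fun t => \sum_i f i t)%R.
Proof.
move=> h; elim: (index_enum I) => [|i s IH].
  by under eq_fun do rewrite big_nil; exact: centered_L2_0.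
by under eq_fun do rewrite big_cons; exact: centered_L2D.
Qed.

Lemma centered_L2_sq_le f : centered_L2 f -> exists2 C : R, (0 <= C)%R &
  \int[P]_t (f t ^+ 2)%:E <= C%:E.
Proof.
move=> [mf if2 _]; exists (fine (\int[P]_t (f t ^+ 2)%:E)).
  by apply: fine_ge0; apply: integral_ge0 => t _; rewrite lee_fin sqr_ge0.
by rewrite fineK//; exact: (integrable_fin_num _ if2).
Qed.

End centered_L2.

Section isotropic_moments.
Context {R : realType} {d : nat}.
Variable P : probability 'cV[R]_d R.
Hypotheses (Pc : centered P) (Pi : isotropic P) (Pp : poincare P).
Local Open Scope ereal_scope.

Lemma mean_coord k : \int[P]_x (x k 0)%:E = 0.
Proof. by have := Pc k; rewrite unlock. Qed.

Lemma cov_coord k l : \int[P]_x (x k 0 * x l 0)%:E = ((k == l)%:R)%:E.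
Proof.
have := Pi k l; rewrite unlock !Pc /= => <-.
rewrite unlock; apply: eq_integral => x _.
congr EFin; rewrite /GRing.mul /= /cst /=.
by rewrite !subr0.
Qed.

Lemma integrable_coord_sq k : P.-integrable setT (fun x => (x k 0 ^+ 2)%:E).
Proof.
apply/integrableP; split.
  by apply/measurable_EFinP; apply: measurable_funX; exact: measurable_coord.
under eq_integral => x _ do rewrite gee0_abs ?lee_fin ?sqr_ge0// expr2.
by rewrite cov_coord ltry.
Qed.

(** The Poincare inequality for the square of a coordinate bounds its variance
    by the second moment. *)
Lemma fourth_moment : exists2 C : R, (0 <= C)%R &
  forall k, \int[P]_x (x k 0 ^+ 4)%:E <= C%:E.
Proof.
have [CP hP] := Pp; exists (8 * `|CP| + 2)%R; first by rewrite addr_ge0// mulr_ge0.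
move=> k; have m1 : measurable_fun setT (fun x : 'cV[R]_d => x k 0%R) := @measurable_coord R d 1 k 0%R.
have := hP (fun x => x k 0 ^+ 2)%R (differentiable_coord_sqr k).
have -> : \int[P]_x (sqnorm (grad (fun x : 'cV[R]_d => x k 0 ^+ 2)%R x))%:E = 4%:E.
  under eq_integral do rewrite grad_coord_sqr EFinM expr2.
  rewrite integralZl//=; last first.
    by under eq_fun do rewrite -expr2; exact: integrable_coord_sq.
  by rewrite cov_coord eqxx mule1.
rewrite /variance unlock.
have -> : 'E_P[(fun x : 'cV[R]_d => x k 0 ^+ 2)%R] = 1.
  by rewrite unlock; under eq_integral do rewrite expr2; rewrite cov_coord eqxx.
rewrite unlock /= => h.
have mv : measurable_fun setT (fun x : 'cV[R]_d => (x k 0 ^+ 2 - 1) ^+ 2)%R.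
  apply: measurable_funX; apply: measurable_funB => //; exact: measurable_funX.
have {}h : \int[P]_x ((x k 0 ^+ 2 - 1) ^+ 2)%:E <= (4 * `|CP|)%:E.
  apply: le_trans (_ : _ <= CP%:E * 4%:E) _; last first.
    by rewrite -EFinM lee_fin mulrC ler_wpM2l// ler_norm.
  apply: le_trans h; apply: ereal_eq_le.
  by apply: eq_integral => x _; rewrite expr2.
apply: le_trans (_ : _ <= \int[P]_x (2%:E * ((x k 0 ^+ 2 - 1) ^+ 2)%:E + 2%:E)) _.
  apply: ge0_le_integral => //.
  - by move=> x _; rewrite lee_fin exprn_even_ge0.
  - by apply/measurable_EFinP; exact: measurable_funX.
  - apply: emeasurable_funD => //; apply: emeasurable_funM => //; exact/measurable_EFinP.
  - move=> x _; rewrite -EFinM -EFinD lee_fin.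
    by have := sqr_ge0 (x k 0 ^+ 2 - 2)%R; rewrite (exprM _ 2 2); lra.
have m2 : measurable_fun setT (fun x : 'cV[R]_d => ((x k 0 ^+ 2 - 1) ^+ 2)%:E).
  exact/measurable_EFinP.
have n2 (x : 'cV[R]_d) : setT x -> 0 <= ((x k 0 ^+ 2 - 1) ^+ 2)%:E.
  by rewrite lee_fin sqr_ge0.
have m3 : measurable_fun setT (fun x : 'cV[R]_d => 2%:E * ((x k 0 ^+ 2 - 1) ^+ 2)%:E).
  exact: emeasurable_funM.
have n3 (x : 'cV[R]_d) : setT x -> 0 <= 2%:E * ((x k 0 ^+ 2 - 1) ^+ 2)%:E.
  by move=> _; rewrite mule_ge0// n2.
rewrite ge0_integralD// ge0_integralZl//.
rewrite (integral_prob_cst P 2) [leRHS]EFinD; apply: leeD => //.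
apply: le_trans (lee_wpmul2l _ h) _ => //.
by rewrite -EFinM lee_fin; apply: eq_leR; ring.
Qed.

Lemma centered_L2_coord k : centered_L2 P (fun x => x k 0%R).
Proof.
split; [exact: measurable_coord|exact: integrable_coord_sq|exact: mean_coord].
Qed.

(** A product of two coordinates is square integrable by the bound on the fourth
    moments. *)
Lemma centered_L2_coord2 k l :
  centered_L2 P (fun x => x k 0 * x l 0 - (k == l)%:R)%R.
Proof.
have mc i : measurable_fun setT (fun x : 'cV[R]_d => x i 0%R) := @measurable_coord R d 1 i 0%R.
have [C C0 hC] := fourth_moment.
have i4 i : P.-integrable setT (fun x => (x i 0 ^+ 4)%:E).
  apply/integrableP; split; first by apply/measurable_EFinP; exact: measurable_funX.
  under eq_integral => x _ do rewrite gee0_abs ?lee_fin ?exprn_even_ge0//.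
  exact: le_lt_trans (hC i) (ltry _).
have ikl : P.-integrable setT (fun x => (x k 0 * x l 0)%:E).
  by apply: integrable_mul => //; exact: integrable_coord_sq.
have mkl : measurable_fun setT (fun x : 'cV[R]_d => x k 0 * x l 0 - (k == l)%:R)%R.
  by apply: measurable_funB => //; exact: measurable_funM.
split => //.
- apply: (@le_integrable _ _ _ P _ measurableT _ (fun x => (x k 0 ^+ 4 + x l 0 ^+ 4 + 2)%:E)).
  + by apply/measurable_EFinP; exact: measurable_funX.
  + move=> x _ /=; rewrite lee_fin ger0_norm ?sqr_ge0// ger0_norm; last first.
      by rewrite !addr_ge0// exprn_even_ge0.
    have h1 := sqr_ge0 (x k 0 ^+ 2 - x l 0 ^+ 2)%R.
    have h2 := sqr_ge0 (x k 0 * x l 0 + (k == l)%:R)%R.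
    rewrite !(exprM _ 2 2).
    have h3 : ((k == l)%:R ^+ 2 <= 1 :> R)%R by case: (k == l); rewrite ?expr1n ?expr0n.
    have -> : ((x k 0 * x l 0 - (k == l)%:R) ^+ 2 = 2 * (x k 0 ^+ 2 * x l 0 ^+ 2)
      + 2 * (k == l)%:R ^+ 2 - (x k 0 * x l 0 + (k == l)%:R) ^+ 2)%R by ring.
    by move: h1; rewrite sqrrB; lra.
  + under eq_fun do rewrite !EFinD.
    apply: integrableD => //; last exact: finite_measure_integrable_cst.
    exact: integrableD.
- under eq_integral do rewrite EFinB.
  rewrite integralB//; last exact: finite_measure_integrable_cst.
  by rewrite cov_coord (integral_prob_cst P) subee.
Qed.

End isotropic_moments.

(** * Probability that a group is nearly degenerate *)

Section slab.
Context {R : realType} {d : nat}.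
Variable P : probability 'cV[R]_d R.
Hypotheses (Pden : bounded_directional_density P).

(** A vector with a coordinate of modulus 1 has Euclidean norm at least 1, so that
    scaling it to a unit vector only shrinks the slab. *)
Lemma slab_prob : exists2 M : R, 0 <= M & forall (v : 'cV[R]_d) (c s : R),
  (exists k, `|v k 0| = 1) -> 0 <= s ->
  (P [set x | (`|dotv v x - c| <= s)%R] <= (2 * M * s)%:E)%E.
Proof.
have [M hM] := Pden; exists `|M| => // v c s [k vk] s0.
have v1 : 1 <= sqnorm v.
  rewrite sqnormE (bigD1 k)//= -[v k 0 ^+ 2]real_normK ?num_real// vk expr1n.
  by rewrite lerDl sumr_ge0// => i _; exact: sqr_ge0.
pose r := Num.sqrt (sqnorm v).
have r1 : 1 <= r by rewrite -(sqrtr1 R) ler_wsqrtr.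
have r0 : 0 < r := lt_le_trans ltr01 r1.
have e1 : sqnorm (r^-1 *: v) = 1.
  by rewrite sqnormZ -[X in _ * X](sqr_sqrtr (sqnorm_ge0 v)) -/r -exprMn mulVf ?gt_eqF// expr1n.
have [p [mp pM pE]] := hM _ e1.
pose A : set R := `[(c - s) / r, (c + s) / r]%classic.
have -> : [set x | `|dotv v x - c| <= s] = [set x | A (dotv (r^-1 *: v) x)].
  apply/seteqP; split => x /=; rewrite /A /= in_itv /= dotvZl [r^-1 * _]mulrC ler_norml.
    by move=> /andP[h1 h2]; rewrite !ler_pM2r ?invr_gt0//; apply/andP; split; lra.
  by rewrite !ler_pM2r ?invr_gt0// => /andP[h1 h2]; apply/andP; split; lra.
have mA : measurable A by exact: measurable_itv.
rewrite pE//.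
apply: le_trans (_ : _ <= \int[lebesgue_measure]_(t in A) (`|M|)%:E)%E _.
  apply: ge0_le_integral => //.
  - by move=> t _; rewrite lee_fin; have /andP[] := pM t.
  - by apply/measurable_EFinP; exact: measurable_funTS.
  - move=> t _; rewrite lee_fin; have /andP[_ h] := pM t.
    by apply: le_trans h _; exact: ler_norm.
have -> : (\int[lebesgue_measure]_(t in A) (`|M|)%:E = (`|M|)%:E * lebesgue_measure A)%E.
  by rewrite integral_cst.
rewrite /A lebesgue_measure_itv/= lte_fin.
case: ifPn => _; last by rewrite mule0 lee_fin !mulr_ge0.
rewrite -EFinD -EFinM lee_fin [leRHS](_ : _ = `|M| * (2 * s)); last by ring.
rewrite ler_wpM2l// -mulrBl ler_pdivrMr//.
rewrite (_ : c + s - (c - s) = 2 * s * 1); last by ring.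
by rewrite ler_wpM2l// mulr_ge0.
Qed.

End slab.

Section finite_unions.
Context {R : realType} {d : measure_display} {T : measurableType d}.
Variable mu : {measure set T -> \bar R}.
Local Open Scope ereal_scope.

Lemma measurable_exists (I : finType) (A : I -> set T) :
  (forall i, measurable (A i)) -> measurable [set w | exists i, A i w].
Proof.
move=> mA; have -> : [set w | exists i, A i w] = \bigcup_(i in [set: I]) A i.
  apply/seteqP; split => w; first by move=> [i Ai]; exists i.
  by move=> [i _ Ai]; exists i.
by apply: fin_bigcup_measurable => // i _; exact: mA.
Qed.

Lemma measure_exists_le (I : finType) (A : I -> set T) (b : I -> R) :
  (forall i, measurable (A i)) -> (forall i, mu (A i) <= (b i)%:E) ->
  mu [set w | exists i, A i w] <= (\sum_i b i)%:E.
Proof.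
move=> mA Ab.
have h (s : seq I) : measurable [set w | exists2 i, i \in s & A i w] /\
    mu [set w | exists2 i, i \in s & A i w] <= (\sum_(i <- s) b i)%:E.
  elim: s => [|i s [ms IH]].
    rewrite (_ : [set w | _] = set0) ?measure0 ?big_nil//.
    by apply/seteqP; split => w // [].
  have -> : [set w | exists2 j, j \in i :: s & A j w] =
      A i `|` [set w | exists2 j, j \in s & A j w].
    apply/seteqP; split => w.
      move=> [j]; rewrite inE => /predU1P[->|js] Aj; first by left.
      by right; exists j.
    move=> [Ai|[j js Aj]]; first by exists i; rewrite ?mem_head.
    by exists j; rewrite // inE js orbT.
  split; first exact: measurableU.
  apply: le_trans (measureU2 _ _ _) _ => //.
  by rewrite big_cons EFinD (leeD (Ab i) IH).
have [_] := h (index_enum I).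
rewrite (_ : [set w | exists2 i, i \in index_enum I & A i w] =
  [set w | exists i, A i w])//.
apply/seteqP; split => w; first by move=> [i _ Ai]; exists i.
by move=> [i Ai]; exists i => //; rewrite mem_index_enum.
Qed.

End finite_unions.

Section bad_event.
Context {R : realType} {d : nat} {dO : measure_display}
  {Omega : measurableType dO}.
Variables (Pr : probability Omega R) (P : probability 'cV[R]_d R).
Context {I : finType}.
Variable Z : I -> {RV Pr >-> 'cV[R]_d}.
Hypothesis ind : mutually_independent Z.
Variable H : {set I}.
Hypothesis law : forall i, i \in H -> has_law (Z i) P.

Definition tail_event (r : R) : set Omega :=
  [set w | exists p : I * 'I_d, (if p.1 \in H
     then Z p.1 @^-1` [set x | r < `|x p.2 0|] else set0) w].

Definition slab_event (m : nat) (t : R) : set Omega :=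
  [set w | exists gh : {ffun 'I_d -> 'I_(2 * m).+1} * 'I_(2 * m.+1).+1,
    ([exists k, `|grid_dir gh.1 k 0| == 1 :> R] /\
     forall i, (if i \in H then Z i @^-1` [set x |
       `|dotv (grid_dir gh.1) x - grid_off t gh.2| <= 3 * t] else setT) w)].

(** Outside of it the points of the group are bounded by r, and no direction of
    the net, hence no direction at all, confines them to a slab of width of order
    t. *)
Definition bad_event m r t := tail_event r `|` slab_event m t.

Let mtail (r : R) k : measurable [set x : 'cV[R]_d | r < `|x k 0|].
Proof.
rewrite (_ : [set x | _] = (fun x : 'cV[R]_d => `|x k 0|) @^-1` `]r, +oo[); last first.
  by apply/seteqP; split => x /=; rewrite in_itv/= andbT.
rewrite -[X in measurable X]setTI.
apply: (measurableT_comp (@normr_measurable R setT) (@measurable_coord R d 1 k 0)) => //.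
Qed.

Let mslab (v : 'cV[R]_d) (c s : R) : measurable [set x : 'cV[R]_d | `|dotv v x - c| <= s].
Proof.
rewrite (_ : [set x | _] = (fun x : 'cV[R]_d => `|dotv v x - c|) @^-1` `]-oo, s]); last first.
  by apply/seteqP; split => x /=; rewrite in_itv/=.
rewrite -[X in measurable X]setTI.
have h : measurable_fun setT (fun x : 'cV[R]_d => dotv v x - c).
  by apply: measurable_funB => //; exact: measurable_dotv.
exact: (measurableT_comp (@normr_measurable R setT) h).
Qed.

Lemma bad_event_group m r t : <<s cylinder Z H >> (bad_event m r t).
Proof.
pose GT := g_sigma_algebraType (cylinder Z H).
suff : @measurable _ GT (tail_event r) /\ @measurable _ GT (slab_event m t).
  by move=> [h1 h2]; exact: (@measurableU _ GT).
split.
  apply: (@measurable_exists _ GT) => -[i k] /=.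
  case: ifPn => iH.
  2: exact: (@sigma_algebra0 _ setT (cylinder Z H)).
  by have := group_measurable_RV (Z := Z) iH measurableT (mtail r k); rewrite setTI.
apply: (@measurable_exists _ GT) => -[g h] /=.
have [e|e] := boolP [exists k, `|grid_dir g k 0| == 1 :> R]; last first.
  rewrite [X in measurable X](_ : _ = set0).
    exact: (@sigma_algebra0 _ setT (cylinder Z H)).
  apply/seteqP; split => w; last by [].
  by move=> [].
apply: sub_sigma_algebra.
exists (fun i => if i \in H then
  [set x | `|dotv (grid_dir g) x - grid_off t h| <= 3 * t] else setT); split.
- by move=> i; case: ifP => _; [exact: mslab | exact: measurableT].
- by move=> i /negPf ->.
- apply/seteqP; split => w.
    by move=> [_ hw] i _; have := hw i; case: ifP.
  by move=> hw; split => // i; have := hw i Logic.I; case: ifP.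
Qed.

Lemma bad_event_measurable m r t : measurable (bad_event m r t).
Proof.
apply: smallest_sub (bad_event_group m r t); last exact: cylinder_measurable.
exact: sigma_algebra_measurable.
Qed.

Lemma not_bad_event (m : nat) (r t : R) w : (0 < m)%N -> (0 < #|H|)%N -> 0 < t ->
  d%:R * r <= t * m%:R -> ~ bad_event m r t w ->
  (forall i k, i \in H -> `|Z i w k 0| <= r) /\
  (forall v c, t ^+ 2 * sqnorm v <=
    d%:R * (#|H|%:R * avg H (fun i => (dotv v (Z i w) - c) ^+ 2))).
Proof.
move=> m0 H0 t0 drm /not_orP[ntail nslab].
have zr i k : i \in H -> `|Z i w k 0| <= r.
  move=> iH; rewrite leNgt; apply/negP => h; apply: ntail.
  by exists (i, k); rewrite /= iH.
split => //; apply: no_slab_form => // v c k0 v1 vk0.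
apply: contrapT => h; apply: nslab.
have [|g [h' [[k gk] hg]]] := grid_slab m0 H0 t0 drm zr v1 vk0 (c := c).
  by move=> i iH; rewrite leNgt; apply/negP => ti; apply: h; exists i.
exists (g, h'); split; first by apply/existsP; exists k; exact/eqP.
by move=> i /=; case: ifPn => // iH /=; exact: hg.
Qed.

Variables (M K4 : R).
Hypotheses (M0 : 0 <= M) (K40 : 0 <= K4).
Hypothesis slabP : forall (v : 'cV[R]_d) (c s : R),
  (exists k, `|v k 0| = 1) -> 0 <= s ->
  (P [set x | (`|dotv v x - c| <= s)%R] <= (2 * M * s)%:E)%E.
Hypothesis mom4 : forall k, (\int[P]_x (x k 0 ^+ 4)%:E <= K4%:E)%E.

Lemma tail_prob (r : R) k : 0 < r -> (P [set x | (r < `|x k 0|)%R] <= (K4 / r ^+ 4)%:E)%E.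
Proof.
move=> r0.
have mc : measurable_fun setT (fun x : 'cV[R]_d => (x k 0 ^+ 4)%:E).
  by apply/measurable_EFinP; apply: measurable_funX; exact: measurable_coord.
have h : ((r ^+ 4)%:E * P [set x | (r < `|x k 0|)%R] <= K4%:E)%E.
  apply: le_trans (mom4 k).
  rewrite -integral_cst; last exact: mtail.
  apply: (@le_trans _ _ (\int[P]_(x in [set x | (r < `|x k 0|)%R]) (x k 0 ^+ 4)%:E)%E).
    apply: ge0_le_integral => //.
    - exact: mtail.
    - by move=> x _ /=; rewrite lee_fin exprn_ge0// ltW.
    - exact: measurable_funTS.
    - move=> x /= hx; rewrite lee_fin -[leRHS]ger0_norm ?exprn_even_ge0// normrX.
      by rewrite lerXn2r ?nnegrE// ltW.
  apply: ge0_subset_integral => //; first exact: mtail.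
  by move=> x _ /=; rewrite lee_fin exprn_even_ge0.
have r4 : 0 < r ^+ 4 by rewrite exprn_gt0.
by rewrite EFinM lee_pdivlMr// muleC.
Qed.

(** Independence turns the bound for one point into a power whose exponent is the
    size of the group. *)
Lemma indep_slab_prob (A : set 'cV[R]_d) (b : R) : measurable A ->
  (P A <= b%:E)%E ->
  (Pr (\bigcap_i (Z i @^-1` (if i \in H then A else setT))) <= (b ^+ #|H|)%:E)%E.
Proof.
move=> mA Ab; rewrite ind; last by move=> i; case: ifP.
have fE i : Pr (Z i @^-1` (if i \in H then A else setT)) =
    (fine (Pr (Z i @^-1` (if i \in H then A else setT))))%:E.
  by rewrite fineK// fin_num_measure//; apply: measurable_preimage_RV; case: ifP.
under eq_bigr do rewrite fE.
rewrite prodEFin lee_fin.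
apply: le_trans (_ : _ <= \prod_i (if i \in H then b else 1)) _; last first.
  by rewrite -big_mkcond/= prodr_const.
apply: ler_prod => i _; apply/andP; split; first by apply: fine_ge0; exact: measure_ge0.
rewrite -lee_fin -fE; case: ifP => iH; last by rewrite preimage_setT; exact: probability_le1.
by rewrite -[leLHS]/(distribution Pr (Z i) A) law.
Qed.

Lemma bad_event_prob (m : nat) (r t : R) : 0 < r -> 0 <= t ->
  (Pr (bad_event m r t) <=
   (#|H|%:R * d%:R * (K4 / r ^+ 4)
    + ((2 * m).+1 ^ d * (2 * m.+1).+1)%:R * (2 * M * (3 * t)) ^+ #|H|)%:E)%E.
Proof.
move=> r0 t0; set q := K4 / r ^+ 4; set b := (2 * M * (3 * t)) ^+ #|H|.
have q0 : 0 <= q by rewrite divr_ge0// exprn_ge0// ltW.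
have mt (p : I * 'I_d) : measurable (if p.1 \in H
     then Z p.1 @^-1` [set x | r < `|x p.2 0|] else set0).
  by case: ifP => pH; [apply: measurable_preimage_RV; exact: mtail | exact: measurable0].
have b0 : 0 <= b by rewrite exprn_ge0// !mulr_ge0.
pose F (gh : {ffun 'I_d -> 'I_(2 * m).+1} * 'I_(2 * m.+1).+1) : set Omega :=
  [set w | ([exists k, `|grid_dir gh.1 k 0| == 1 :> R] /\
     forall i, (if i \in H then Z i @^-1` [set x |
       `|dotv (grid_dir gh.1) x - grid_off t gh.2| <= 3 * t] else setT) w)].
have FE gh : [exists k, `|grid_dir gh.1 k 0| == 1 :> R] -> F gh =
    \bigcap_i (Z i @^-1` (if i \in H then [set x |
       `|dotv (grid_dir gh.1) x - grid_off t gh.2| <= 3 * t] else setT)).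
  move=> e; apply/seteqP; split => w.
    by move=> [_ hw] i _; have := hw i; case: ifP.
  by move=> hw; split => // i; have := hw i Logic.I; case: ifP.
have F0 gh : [exists k, `|grid_dir gh.1 k 0| == 1 :> R] = false -> F gh = set0.
  by move=> e; rewrite /F e; apply/seteqP; split => w // [].
have mF gh : measurable (F gh).
  case e : [exists k, `|grid_dir gh.1 k 0| == 1 :> R]; last by rewrite (F0 _ e).
  rewrite (FE _ e); apply: fin_bigcap_measurable => // i _.
  by apply: measurable_preimage_RV; case: ifP => _ //; exact: mslab.
apply: le_trans (measureU2 _ _ _) _.
- exact: measurable_exists.
- exact: (measurable_exists mF).
rewrite EFinD; apply: leeD.
  apply: le_trans (measure_exists_le (b := fun p => if p.1 \in H then q else 0) mt _) _.
    move=> [i k]/=; case: ifPn => iH; last by rewrite measure0.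
    by rewrite -[leLHS]/(distribution Pr (Z i) _) law//; [exact: tail_prob | exact: mtail].
  rewrite lee_fin; apply: eq_leR.
  rewrite -(pair_bigA _ (fun i (k : 'I_d) => if i \in H then q else 0))/=.
  under eq_bigr do rewrite sumr_const card_ord.
  rewrite (eq_bigr (fun i => if i \in H then q *+ d else 0)); last first.
    by move=> i _; case: ifP => // _; rewrite mul0rn.
  by rewrite -big_mkcond/= sumr_const -mulrnA -[q *+ _]mulr_natl natrM [_%:R * _%:R]mulrC.
apply: le_trans (measure_exists_le (b := fun=> b) mF _) _.
  move=> gh; case e : [exists k, `|grid_dir gh.1 k 0| == 1 :> R]; last first.
    by rewrite (F0 _ e) measure0 lee_fin.
  rewrite (FE _ e); apply: indep_slab_prob; first exact: mslab.
  apply: slabP; last by rewrite mulr_ge0.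
  by have /existsP[k /eqP gk] := e; exists k.
by rewrite lee_fin sumr_const card_prod card_ffun !card_ord mulr_natl.
Qed.

End bad_event.

(** * Summing over the scales of degeneracy *)

Section degeneracy.
Context {R : realType} {d : nat} {dO : measure_display}
  {Omega : measurableType dO}.
Variables (Pr : probability Omega R) (P : probability 'cV[R]_d R).
Context {I : finType}.
Variable Z : I -> {RV Pr >-> 'cV[R]_d}.
Hypothesis ind : mutually_independent Z.
Variable H : {set I}.
Hypothesis law : forall i, i \in H -> has_law (Z i) P.
Hypothesis d0 : (0 < d)%N.
Hypothesis cardH : #|H| = (3 * d.+1 + 8)%N.

(** Radius 4^j and width 2^-j, with a net fine enough for both. *)
Definition bad_scale j : set Omega :=
  bad_event Z H (d * 8 ^ j) (4 ^+ j) (2 ^- j : R).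

(** The weight 64^j pays for the loss at scale j, which is 4^j from the inverse
    of the smallest eigenvalue times 16^j from the squared mean. *)
Definition degeneracy (w : Omega) : \bar R :=
  (\sum_(0 <= j <oo) ((64 ^+ j)%:E * (\1_(bad_scale j) w)%:E))%E.

Let degeneracy_term_ge0 w j : (0 <= (64 ^+ j)%:E * (\1_(bad_scale j) w)%:E :> \bar R)%E.
Proof. by rewrite mule_ge0// lee_fin ?exprn_ge0. Qed.

Lemma degeneracy_ge0 w : (0 <= degeneracy w)%E.
Proof. exact: nneseries_ge0. Qed.

Lemma degeneracy_group_measurable : group_measurable Z H degeneracy.
Proof.
apply: (@ge0_emeasurable_sum _ (g_sigma_algebraType (cylinder Z H))) => [j w _ _|j _].
  exact: degeneracy_term_ge0.
apply: emeasurable_funM => //; apply/measurable_EFinP.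
by apply: measurable_indic; exact: bad_event_group.
Qed.

Let H0 : (0 < #|H|)%N. Proof. by rewrite cardH addn_gt0 orbT. Qed.

Lemma not_bad_scale j w : ~ bad_scale j w ->
  (forall i k, i \in H -> `|Z i w k 0| <= 4 ^+ j) /\
  (forall v c, sqnorm v <= 4 ^+ j *
    (d%:R * (#|H|%:R * avg H (fun i => (dotv v (Z i w) - c) ^+ 2)))).
Proof.
move=> nb; have t0 : 0 < 2 ^- j :> R by rewrite invr_gt0 exprn_gt0.
have [||zr h] := not_bad_event _ H0 t0 _ nb.
- by rewrite muln_gt0 d0 expn_gt0.
- rewrite natrM natrX mulrCA ler_wpM2l//.
  by rewrite (_ : 8 = 2 * 4) ?exprMn ?mulKf ?lexx ?expf_neq0//; ring.
split => // v c; rewrite -ler_pdivrMl ?exprn_gt0//.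
apply: le_trans (h v c); rewrite ler_wpM2r ?sqnorm_ge0//.
rewrite exprVn -exprM mulnC exprM (_ : 2 ^+ 2 = 4 :> R)//.
by rewrite -natrX.
Qed.

(** Let j0 be the first scale at which the group is not degenerate.  If j0 > 0,
    the scale before it contributes 64^(j0 - 1) to the sum; if there is no such
    scale, the sum is infinite. *)
Lemma degeneracy_bound w (L c : R) : 0 < c ->
  (forall j, ~ bad_scale j w -> L <= c * 64 ^+ j) ->
  (L%:E <= (64 * c)%:E * (1 + degeneracy w))%E.
Proof.
move=> c0 h.
have psi_term j : bad_scale j w -> ((64 ^+ j)%:E <= degeneracy w)%E.
  move=> bj; apply: le_trans (nneseries_lim_ge j.+1 (fun n _ _ => degeneracy_term_ge0 w n)).
  rewrite big_nat_recr//= [X in (_ <= _ + X)%E](_ : _ = (64 ^+ j)%:E).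
    by rewrite leeDr// sume_ge0.
  by rewrite indicE mem_set// mule1.
have [[j nj]|all_bad] := pselect (exists j, ~ bad_scale j w); last first.
  have -> : degeneracy w = +oo%E.
    apply: eq_infty => A.
    have [n An] : exists n : nat, A <= 64 ^+ n.
      exists (Num.truncn A).+1; apply: le_trans (ltW (truncnS_gt A)) _.
      by rewrite -natrX ler_nat ltnW// ltn_expl.
    apply: le_trans (psi_term n _); first by rewrite lee_fin.
    by apply: contrapT => nb; apply: all_bad; exists n.
  by rewrite addey// gt0_muley ?leey// lte_fin mulr_gt0.
have [j0 nj0 jmin] : exists2 j0, ~ bad_scale j0 w & forall j, (j < j0)%N -> bad_scale j w.
  have ex : exists j, `[< ~ bad_scale j w >] by exists j; exact/asboolP.
  exists (ex_minn ex); case: ex_minnP => m /asboolP // nm hm k km.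
  by apply: contrapT => /asboolP /hm; rewrite leqNgt km.
apply: (@le_trans _ _ (c * 64 ^+ j0)%:E); first by rewrite lee_fin h.
have -> : ((64 * c)%:E * (1 + degeneracy w) = c%:E * (64%:E * (1 + degeneracy w)))%E.
  by rewrite [(64 * c)%R]mulrC EFinM muleA.
rewrite EFinM lee_pmul2l ?lte_fin//.
case: j0 nj0 jmin => [|j0] nj0 jmin.
  rewrite expr0; apply: (@le_trans _ _ (1 + degeneracy w)%E); first by rewrite leeDl// degeneracy_ge0.
  by rewrite lee_pemull ?lee_fin ?adde_ge0 ?degeneracy_ge0// ler1n.
rewrite exprS EFinM lee_pmul2l ?lte_fin//.
apply: le_trans (psi_term j0 (jmin _ _)) _ => //.
by rewrite leeDr.
Qed.

Variables (M K4 : R).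
Hypotheses (M0 : 0 <= M) (K40 : 0 <= K4).
Hypothesis slabP : forall (v : 'cV[R]_d) (c s : R),
  (exists k, `|v k 0| = 1) -> 0 <= s ->
  (P [set x | (`|dotv v x - c| <= s)%R] <= (2 * M * s)%:E)%E.
Hypothesis mom4 : forall k, (\int[P]_x (x k 0 ^+ 4)%:E <= K4%:E)%E.

Definition degeneracy_cst : R := (3 * d.+1 + 8)%:R * d%:R * K4
  + (5 * d)%:R ^+ d.+1 * (6 * M) ^+ (3 * d.+1 + 8).

Lemma degeneracy_cst_ge0 : 0 <= degeneracy_cst.
Proof. by rewrite addr_ge0 ?mulr_ge0 ?exprn_ge0 ?mulr_ge0. Qed.

(** The tails contribute (4^j)^-4 = 256^-j.  The net has O(8^(j (d+1))) slabs, each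
    of probability O(2^(-j N)), and N = 3 (d+1) + 8 makes this 2^(-8 j) = 256^-j. *)
Lemma bad_scale_prob j : (Pr (bad_scale j) <= (degeneracy_cst / 256 ^+ j)%:E)%E.
Proof.
apply: le_trans (bad_event_prob ind law M0 K40 slabP mom4 _ _ _) _.
- by rewrite exprn_gt0.
- by rewrite invr_ge0 exprn_ge0.
rewrite lee_fin /degeneracy_cst (mulrDl _ _ (256 ^+ j)^-1) cardH; apply: lerD.
  rewrite -[leRHS]mulrA ler_wpM2l// -[(4 ^+ j) ^+ 4]exprM [(j * 4)%N]mulnC exprM.
  by rewrite (_ : 4 ^+ 4 = 256 :> R)// -natrX.
have m1 : (1 <= d * 8 ^ j)%N by rewrite muln_gt0 d0 expn_gt0.
set m := (d * 8 ^ j)%N in m1 *.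
have cm : ((2 * m).+1 ^ d * (2 * m.+1).+1 <= (5 * m) ^ d.+1)%N.
  rewrite expnSr; apply: leq_mul; last by lia.
  by rewrite leq_exp2r//; lia.
have -> : 2 * M * (3 * 2 ^- j) = 6 * M * 2 ^- j by ring.
have e0 : 0 <= (6 * M * 2 ^- j) ^+ (3 * d.+1 + 8).
  by rewrite exprn_ge0// !mulr_ge0// invr_ge0 exprn_ge0.
apply: le_trans (ler_wpM2r e0 (_ : _ <= ((5 * m) ^ d.+1)%:R)) _.
  by rewrite ler_nat.
(* the group size is chosen to leave 2^(-8 j) after the count of the net *)
have pow : (8 ^ j)%:R ^+ d.+1 * (2 ^- j) ^+ (3 * d.+1 + 8) = (256 ^+ j)^-1 :> R.
  pose x : R := 2 ^+ j; have x0 : x != 0 by rewrite expf_neq0.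
  have e8 : 8 = 2 ^+ 3 :> R by rewrite -natrX.
  have e256 : 256 = 2 ^+ 8 :> R by rewrite -natrX.
  have -> : (8 ^ j)%:R = x ^+ 3 :> R by rewrite natrX e8 exprAC.
  have -> : 256 ^+ j = x ^+ 8 :> R by rewrite e256 exprAC.
  rewrite -/x exprD -exprM mulrA -exprMn divff// expr1n mul1r exprVn//.
rewrite /m mulnA natrX natrM !exprMn -pow.
by apply: eq_leR; ring.
Qed.

Lemma degeneracy_integral : (\int[Pr]_w degeneracy w <= (2 * degeneracy_cst)%:E)%E.
Proof.
have mb j : measurable (bad_scale j) by exact: bad_event_measurable.
rewrite integral_nneseries//; last first.
  move=> j; apply: emeasurable_funM => //; apply/measurable_EFinP.
  exact: measurable_indic.
apply: (@le_trans _ _ (\sum_(0 <= j <oo) (degeneracy_cst / 4 ^+ j)%:E)%E).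
  apply: lee_nneseries => [j _ _|j _].
    by apply: integral_ge0 => w _; exact: degeneracy_term_ge0.
  rewrite ge0_integralZl ?lee_fin ?exprn_ge0//; last first.
    by apply/measurable_EFinP; exact: measurable_indic.
  rewrite integral_indic// setIT.
  apply: le_trans (lee_wpmul2l _ (bad_scale_prob j)) _; first by rewrite lee_fin exprn_ge0.
  rewrite -EFinM lee_fin; apply: eq_leR.
  rewrite (_ : 256 = 64 * 4 :> R) ?exprMn; last by ring.
  by field; rewrite !expf_neq0.
apply: lime_le.
  by apply: is_cvg_nneseries => j _ _; rewrite lee_fin divr_ge0 ?degeneracy_cst_ge0 ?exprn_ge0.
near=> n; rewrite sumEFin lee_fin.
apply: (@le_trans _ _ (degeneracy_cst * (2 - 2 / 4 ^+ n))); last first.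
  rewrite mulrC ler_wpM2r ?degeneracy_cst_ge0// gerBl divr_ge0// exprn_ge0//.
elim: (n) => [|k IH].
  by rewrite big_geq// expr0 divr1 subrr mulr0.
rewrite big_nat_recr//=; apply: le_trans (lerD IH (lexx _)) _.
rewrite -mulrDr ler_wpM2l ?degeneracy_cst_ge0// exprS invfM.
have : 0 <= (4 ^+ k)^-1 :> R by rewrite invr_ge0 exprn_ge0.
by lra.
Unshelve. all: by end_near. Qed.

End degeneracy.

(** * Expected fluctuation of the empirical moments *)

Section fluct_expectation.
Context {R : realType} {d : nat}.
Local Open Scope ereal_scope.

(** A sum of squares of averages of centered functions, to which the variance
    bound applies term by term. *)
Lemma fluctE (I : finType) (H : {set I}) (T : 'M[R]_d) (u : I -> 'cV[R]_d) :
  (0 < #|H|)%N -> fluct H T u =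
  (\sum_k (\sum_l avg H (fun i => u i k 0 * u i l 0 - T k l) ^+ 2
           + avg H (fun i => u i k 0) ^+ 2))%R.
Proof.
move=> H0; rewrite /fluct big_split/= sqnormE; congr (_ + _)%R; last first.
  by apply: eq_bigr => k _; rewrite mxE.
apply: eq_bigr => k _; apply: eq_bigr => l _; rewrite !mxE; congr (_ ^+ 2)%R.
have -> : avg H (fun i => u i k 0 * u i l 0 - T k l)%R =
    (avg H (fun i => u i k 0 * u i l 0) + avg H (fun=> - T k l))%R by rewrite -avgD.
by rewrite avg_cst.
Qed.

Lemma group_measurable_avg {dO} {Omega : measurableType dO} (Pr : probability Omega R)
    d' (S : measurableType d') (I : finType) (Z : I -> {RV Pr >-> S}) (H : {set I})
    (f : S -> R) : measurable_fun setT f ->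
  group_measurable Z H (fun w => avg H (fun i => f (Z i w))).
Proof.
move=> mf; apply: measurable_funM => //.
have -> : (fun w => \sum_(i in H) f (Z i w))%R =
    (fun w => \sum_i (if i \in H then f \o Z i else cst 0%R) w)%R.
  by apply/funext => w; rewrite big_mkcond; apply: eq_bigr => i _; case: ifP.
apply: measurable_sum => i; case: ifPn => // iH.
by apply: (group_measurable_comp mf); exact: group_measurable_RV.
Qed.

Lemma group_measurable_fluct {dO} {Omega : measurableType dO} (Pr : probability Omega R)
    (I : finType) (Z : I -> {RV Pr >-> 'cV[R]_d}) (H : {set I}) (T : 'M[R]_d) :
  (0 < #|H|)%N -> group_measurable Z H (fun w => fluct H T (fun i => Z i w)).
Proof.
move=> H0; have mc k : measurable_fun setT (fun x : 'cV[R]_d => x k 0%R) := @measurable_coord R d 1 k 0%R.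
have -> : (fun w => fluct H T (fun i => Z i w)) = (fun w =>
  \sum_k (\sum_l avg H (fun i => Z i w k 0 * Z i w l 0 - T k l) ^+ 2
           + avg H (fun i => Z i w k 0) ^+ 2))%R.
  by apply/funext => w; rewrite fluctE.
apply: measurable_sum => k; apply: measurable_funD.
  apply: measurable_sum => l; apply: measurable_funX.
  have mkl : measurable_fun setT (fun x : 'cV[R]_d => x k 0 * x l 0 - T k l)%R.
    by apply: measurable_funB => //; exact: measurable_funM.
  have h := group_measurable_avg (Z := Z) (H := H) mkl.
  exact: h.
apply: measurable_funX.
have h := group_measurable_avg (Z := Z) (H := H) (mc k).
exact: h.
Qed.

Lemma fluct_integral (Q : probability 'cV[R]_d R) (T : 'M[R]_d) :
  (forall k, centered_L2 Q (fun y => y k 0%R)) ->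
  (forall k l, centered_L2 Q (fun y => y k 0 * y l 0 - T k l)%R) ->
  exists2 C : R, (0 <= C)%R & forall (dO : measure_display) (Omega : measurableType dO)
    (Pr : probability Omega R) (I : finType) (Z : I -> {RV Pr >-> 'cV[R]_d})
    (H : {set I}), mutually_independent Z -> (forall i, has_law (Z i) Q) ->
    (0 < #|H|)%N ->
    \int[Pr]_w (fluct H T (fun i => Z i w))%:E <= (C / #|H|%:R)%:E.
Proof.
move=> c1 c2.
have /choice[C1 hC1] : forall k, exists C : R, (0 <= C)%R /\
    \int[Q]_t (t k 0 ^+ 2)%:E <= C%:E.
  by move=> k; have [C ? ?] := centered_L2_sq_le (c1 k); exists C.
have /choice[C2 hC2] : forall kl : 'I_d * 'I_d, exists C : R, (0 <= C)%R /\
    \int[Q]_t ((t kl.1 0 * t kl.2 0 - T kl.1 kl.2) ^+ 2)%:E <= C%:E.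
  by move=> [k l]; have [C ? ?] := centered_L2_sq_le (c2 k l); exists C.
exists (\sum_k (\sum_l C2 (k, l) + C1 k))%R.
  apply: sumr_ge0 => k _; rewrite addr_ge0 ?(proj1 (hC1 k))//.
  by apply: sumr_ge0 => l _; exact: (proj1 (hC2 _)).
move=> dO Omega Pr I Z H ind law H0.
have mc k : measurable_fun setT (fun x : 'cV[R]_d => x k 0%R) := @measurable_coord R d 1 k 0%R.
have ma (f : 'cV[R]_d -> R) : measurable_fun setT f ->
    measurable_fun setT (fun w => (avg H (fun i => f (Z i w)) ^+ 2)%:E).
  move=> mf; apply/measurable_EFinP; apply: measurable_funX.
  have h := group_measurable_avg (Z := Z) (H := H) mf.
  exact: group_measurable_fun h.
have mkl k l : measurable_fun setT (fun x : 'cV[R]_d => x k 0 * x l 0 - T k l)%R.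
  by apply: measurable_funB => //; exact: measurable_funM.
have b1 k : \int[Pr]_w (avg H (fun i => Z i w k 0) ^+ 2)%:E <= (C1 k / #|H|%:R)%:E.
  by have [_ _ m0] := c1 k; exact: (avg_sq_le ind law (mc k) (proj2 (hC1 k)) m0 H0).
have b2 k l : \int[Pr]_w (avg H (fun i => Z i w k 0 * Z i w l 0 - T k l) ^+ 2)%:E
    <= (C2 (k, l) / #|H|%:R)%:E.
  by have [_ _ m0] := c2 k l; exact: (avg_sq_le ind law (mkl k l) (proj2 (hC2 (k, l))) m0 H0).
have -> : \int[Pr]_w (fluct H T (fun i => Z i w))%:E = \int[Pr]_w (\sum_k
    (\sum_l (avg H (fun i => Z i w k 0 * Z i w l 0 - T k l) ^+ 2)%:E
     + (avg H (fun i => Z i w k 0) ^+ 2)%:E)).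
  apply: eq_integral => w _; rewrite fluctE// -sumEFin; apply: eq_bigr => k _.
  by rewrite EFinD -sumEFin.
have m2 k : measurable_fun setT (fun w =>
    \sum_l (avg H (fun i => Z i w k 0 * Z i w l 0 - T k l) ^+ 2)%:E).
  by apply: emeasurable_sum => l; exact: (ma _ (mkl k l)).
have n2 k w : 0 <= \sum_l (avg H (fun i => Z i w k 0 * Z i w l 0 - T k l) ^+ 2)%:E.
  by apply: sume_ge0 => l _; rewrite lee_fin sqr_ge0.
rewrite ge0_integral_sum//; last 2 first.
- by move=> k; apply: emeasurable_funD => //; exact: (ma _ (mc k)).
- by move=> k w _; rewrite adde_ge0// lee_fin sqr_ge0.
rewrite mulr_suml -sumEFin; apply: lee_sum => k _.
rewrite ge0_integralD//; last 2 first.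
- by move=> w _; rewrite lee_fin sqr_ge0.
- exact: (ma _ (mc k)).
rewrite mulrDl EFinD; apply: leeD => //.
rewrite ge0_integral_sum//; last 2 first.
- by move=> l; exact: (ma _ (mkl k l)).
- by move=> l w _; rewrite lee_fin sqr_ge0.
by rewrite mulr_suml -sumEFin; apply: lee_sum => l _.
Qed.

End fluct_expectation.

Section subfamily.
Context {R : realType} {dO dT : measure_display}
  {Omega : measurableType dO} {T : measurableType dT}.
Variable Pr : probability Omega R.
Context {I J : finType}.
Variables (X : I -> {RV Pr >-> T}) (Y : J -> {RV Pr >-> T}).
Let Z (k : I + J) : {RV Pr >-> T} := match k with inl i => X i | inr j => Y j end.
Hypothesis ind : mutually_independent Z.
Local Open Scope ereal_scope.

Lemma independent_inl : mutually_independent X.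
Proof.
move=> A mA.
have := ind (A := fun k => if k is inl i then A i else setT).
rewrite big_sumType/= => /(_ _)/wrap[[i|j] //|].
rewrite [X in _ = _ * X -> _]big1 ?mule1; last first.
  by move=> j _; rewrite preimage_setT probability_setT.
move=> <-; congr (Pr _); apply/seteqP; split => w.
  by move=> hw [i|j] _ //; exact: hw.
by move=> hw i _; exact: (hw (inl i)).
Qed.

Lemma independent_inr : mutually_independent Y.
Proof.
move=> A mA.
have := ind (A := fun k => if k is inr i then A i else setT).
rewrite big_sumType/= => /(_ _)/wrap[[i|j] //|].
rewrite [X in _ = X * _ -> _]big1 ?mul1e; last first.
  by move=> j _; rewrite preimage_setT probability_setT.
move=> <-; congr (Pr _); apply/seteqP; split => w.
  by move=> hw [i|j] _ //; exact: hw.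
by move=> hw i _; exact: (hw (inr i)).
Qed.

Lemma group_measurable_inl d' (T' : measurableType d') (H : {set I}) (f : Omega -> T') :
  group_measurable X H f -> group_measurable Z [set k : I + J | if k is inl i then i \in H else false]%SET f.
Proof.
move=> mf _ A mA; have := mf measurableT A mA; rewrite !setTI.
apply: sub_sigma_algebra2 => E [C [mC CT ->]].
exists (fun k => if k is inl i then C i else setT); split.
- by move=> [].
- by move=> [i|j] //; rewrite inE; exact: CT.
- apply/seteqP; split => w hw; first by move=> [i|j] _ //; exact: hw.
  by move=> i _; exact: (hw (inl i)).
Qed.

Lemma group_measurable_inr d' (T' : measurableType d') (H : {set J}) (f : Omega -> T') :
  group_measurable Y H f -> group_measurable Z [set k : I + J | if k is inr i then i \in H else false]%SET f.
Proof.
move=> mf _ A mA; have := mf measurableT A mA; rewrite !setTI.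
apply: sub_sigma_algebra2 => E [C [mC CT ->]].
exists (fun k => if k is inr i then C i else setT); split.
- by move=> [].
- by move=> [i|j] //; rewrite inE; exact: CT.
- apply/seteqP; split => w hw; first by move=> [i|j] _ //; exact: hw.
  by move=> i _; exact: (hw (inr i)).
Qed.

End subfamily.

(** * Pathwise bound on the loss *)

Section pathwise_loss.
Context {R : realType} {d : nat}.
Hypothesis d0 : (0 < d)%N.

(** The standardized form of the squared distance between the gradients: the
    error of the linear part and the two contributions to the error of the
    constant part. *)
Definition plug_in_loss (I J : finType) (A B : 'M[R]_d) (z : I -> 'cV[R]_d)
    (u : J -> 'cV[R]_d) : R :=
  frob2 (B - A) + frob2 B * sqnorm (mean [set: I]%SET z) + sqnorm (mean [set: J]%SET u).

(** If one half of the sample has small fluctuation, cov(z) is bounded below and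
    the first bound of [brenier_bounds] is of first order.  Otherwise the second
    bound is used with an eigenvalue bound from the points of H1 alone, which
    make up a fraction of order 1/n of the sample, and the factor U2 U3 is
    inserted at the cost of a constant.  The squared mean of
    the sample is controlled by the three groups
    separately, so that each factor depends on one group only. *)
Lemma pathwise_loss (A : 'M[R]_d) : psdmx A -> exists2 C : R, 0 < C &
  forall (n : nat) (J : finType) (H1 H2 H3 : {set 'I_n})
    (z : 'I_n -> 'cV[R]_d) (u : J -> 'cV[R]_d) (B : 'M[R]_d),
  (0 < #|J|)%N -> (0 < #|H1|)%N ->
  (n <= 4 * #|H2|)%N -> (n <= 4 * #|H3|)%N ->
  (H1 :|: H2 :|: H3)%SET = [set: 'I_n]%SET ->
  [disjoint H1 & H2]%B -> [disjoint (H1 :|: H2)%SET & H3]%B ->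
  psdmx B -> B *m cov [set: _]%SET z *m B = cov [set: _]%SET u ->
  (forall l : R, (forall v, sqnorm v <= l * dotv v (cov [set: _]%SET z *m v)) ->
    exists E, B = E *m A) ->
  let U := fluct [set: _]%SET 1%:M z in let V := fluct [set: _]%SET (A *m A) u in
  let U2 := fluct H2 1%:M z in let U3 := fluct H3 1%:M z in
  (U2 <= 16^-1 \/ U3 <= 16^-1 -> plug_in_loss A B z u <= C * (V + (1 + V) * U)) /\
  (16^-1 < U2 -> 16^-1 < U3 -> forall j : nat,
    (forall i k, i \in H1 -> `|z i k 0| <= 4 ^+ j) ->
    (forall v c, sqnorm v <= 4 ^+ j *
      (d%:R * (#|H1|%:R * avg H1 (fun i => (dotv v (z i) - c) ^+ 2)))) ->
    plug_in_loss A B z u <= C * (n%:R * (1 + V) * (U2 * U3)) * 64 ^+ j).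
Proof.
move=> Apsd; have [C C0 hC] := brenier_bounds Apsd.
pose C2 := C * (d%:R * ((3 * d%:R + 3) * 288)).
have d1 : 1 <= d%:R :> R by rewrite ler1n.
have C20 : 0 < C2 by rewrite /C2 !mulr_gt0//; lra.
exists (64 * C + C2); first by rewrite addr_gt0// mulr_gt0.
move=> n J H1 H2 H3 z u B J0 H10 nH2 nH3 HU D12 D123 Bpsd eqB range U V U2 U3.
have n0 : (0 < n)%N.
  by have := max_card (mem H1); rewrite card_ord; apply: leq_trans.
have I0 : (0 < #|'I_n|)%N by rewrite card_ord.
have nr : 0 < n%:R :> R by rewrite ltr0n.
have H20 : (0 < #|H2|)%N by lia.
have H30 : (0 < #|H3|)%N by lia.
have U0 : 0 <= U by exact: fluct_ge0.
have V0 : 0 <= V by exact: fluct_ge0.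
split.
  move=> small.
  (* at least a quarter of the points has variance at least |v|^2 / 2 along v *)
  have l8 v : sqnorm v <= 8 * dotv v (cov [set: _]%SET z *m v).
    have key (H : {set 'I_n}) : (0 < #|H|)%N -> (n <= 4 * #|H|)%N -> fluct H 1%:M z <= 16^-1 ->
        sqnorm v <= 8 * dotv v (cov [set: _]%SET z *m v).
      move=> H0 nH sm.
      have h := group_form_le H0 (fun c => fluct_small_form v c H0 sm).
      rewrite card_ord in h.
      have h2 : n%:R * (2^-1 * sqnorm v) <= 4 * (#|H|%:R * (2^-1 * sqnorm v)).
        rewrite [leRHS]mulrA ler_wpM2r ?mulr_ge0 ?sqnorm_ge0//.
        by rewrite -natrM ler_nat.
      rewrite -(ler_pM2l nr); lra.
    by case: small; exact: key.
  have [E BE] := range _ l8.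
  have [h _] := hC _ _ z u E B 8 I0 J0 Bpsd BE eqB (ler1n _ 8) l8.
  apply: le_trans h _; rewrite -/U -/V.
  have W0 : 0 <= (1 + V) * U by rewrite mulr_ge0// addr_ge0.
  have : 0 <= C * V by rewrite mulr_ge0// ltW.
  have : 0 <= C * ((1 + V) * U) by rewrite mulr_ge0// ltW.
  have : 0 <= C2 * V by rewrite mulr_ge0// ltW.
  have : 0 <= C2 * ((1 + V) * U) by rewrite mulr_ge0// ltW.
  rewrite (_ : 8 ^+ 2 = 64 :> R); last by rewrite -natrX.
  by lra.
move=> bad2 bad3 j zj spread.
pose l : R := 4 ^+ j * (d%:R * n%:R).
have fj : 1 <= 4 ^+ j :> R by rewrite exprn_ege1// ler1n.
have l1 : 1 <= l.
  by rewrite /l !mulr_ege1// ler1n.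
have hl v : sqnorm v <= l * dotv v (cov [set: _]%SET z *m v).
  have H1r : 0 < #|H1|%:R :> R by rewrite ltr0n.
  have dr : 0 < d%:R :> R by rewrite ltr0n.
  pose q := sqnorm v / (4 ^+ j * (d%:R * #|H1|%:R)).
  have hq c : q <= avg H1 (fun i => (dotv v (z i) - c) ^+ 2).
    rewrite ler_pdivrMr ?mulr_gt0 ?exprn_gt0//.
    by rewrite mulrC -!mulrA; exact: spread.
  have := group_form_le H10 hq; rewrite card_ord.
  have -> : #|H1|%:R * q = sqnorm v / (4 ^+ j * d%:R).
    by rewrite /q; field; rewrite !gt_eqF// exprn_gt0.
  rewrite ler_pdivrMr ?mulr_gt0 ?exprn_gt0// /l => /le_trans; apply.
  by apply: eq_leR; ring.
have [E BE] := range _ hl.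
have [_ h] := hC _ _ z u E B l I0 J0 Bpsd BE eqB l1 hl.
have mz : sqnorm (mean [set: _]%SET z) <= 3 * (d%:R * 16 ^+ j + U2 + U3).
  apply: le_trans (mean_split_le z HU D12 D123 H10 H20 H30) _.
  have m1 : sqnorm (mean H1 z) <= d%:R * 16 ^+ j.
    have k1 k : (mean H1 z k 0) ^+ 2 <= 16 ^+ j.
      rewrite mxE -real_normK ?num_real// (_ : 16 ^+ j = (4 ^+ j) ^+ 2 :> R); last first.
        have e16 : 4 ^+ 2 = 16 :> R by rewrite -natrX.
        by rewrite -exprM mulnC exprM e16.
      rewrite ler_sqr ?nnegrE// ?exprn_ge0//.
      rewrite ler_norml -lerNl -[- avg _ _]mulN1r -avgZ.
      rewrite -{1 2}(avg_cst (4 ^+ j) H10).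
      apply/andP; split; apply: ler_avg => i iH; have := zj i k iH; rewrite ler_norml => /andP[]; lra.
    rewrite sqnormE; apply: le_trans (_ : _ <= \sum_(k < d) 16 ^+ j) _.
      by apply: ler_sum => k _.
    by rewrite sumr_const card_ord mulr_natl.
  have m2 : sqnorm (mean H2 z) <= U2 by rewrite lerDr frob2_ge0.
  have m3 : sqnorm (mean H3 z) <= U3 by rewrite lerDr frob2_ge0.
  by lra.
have sj : 1 <= 16 ^+ j :> R by rewrite exprn_ege1// ler1n.
(* on this event any bounded quantity may be multiplied by U2 U3 *)
have u1 : 1 <= 256 * (U2 * U3) by nra.
have u2 : U2 <= 16 * (U2 * U3) by nra.
have u3 : U3 <= 16 * (U2 * U3) by nra.
have mz2 : 1 + sqnorm (mean [set: _]%SET z) <= (3 * d%:R + 3) * 16 ^+ j * (288 * (U2 * U3)).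
  apply: le_trans (_ : _ <= (3 * d%:R + 3) * 16 ^+ j * (1 + U2 + U3)) _.
    have key (s W m : R) : 1 <= s -> 0 <= W -> m <= 3 * (d%:R * s + W) ->
        1 + m <= (3 * d%:R + 3) * s * (1 + W).
      move=> s1 W0 hm.
      have ds : 0 <= d%:R * (s - 1) :> R by rewrite mulr_ge0// subr_ge0.
      have D3 : 3 <= (3 * d%:R + 3) * s by lra.
      by have := ler_wpM2r W0 D3; lra.
    rewrite -[1 + U2 + U3]addrA; apply: key => //; first lra.
    by rewrite addrA.
  apply: ler_wpM2l; last lra.
  by rewrite mulr_ge0//; lra.
apply: le_trans h _; rewrite -/V.
have U23 : 0 <= U2 * U3 by rewrite mulr_ge0//; lra.
have V1 : 0 <= 1 + V by lra.
have l0 : 0 <= l by lra.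
apply: (@le_trans _ _ (C2 * (n%:R * (1 + V) * (U2 * U3)) * 64 ^+ j)); last first.
  apply: ler_wpM2r; first by rewrite exprn_ge0.
  apply: ler_wpM2r; first by apply: mulr_ge0 => //; exact: mulr_ge0.
  by rewrite lerDr mulr_ge0// ltW.
apply: le_trans (ler_wpM2l (ltW C0) (ler_wpM2l V1 (ler_wpM2l l0 mz2))) _.
apply: eq_leR; rewrite /C2 /l.
have -> : 64 ^+ j = 4 ^+ j * 16 ^+ j :> R by rewrite -exprMn -natrM.
by ring.
Qed.

End pathwise_loss.

(** * Standardized coordinates *)

Section ae_integral.
Context {R : realType} {d : measure_display} {T : measurableType d}.
Variable mu : {measure set T -> \bar R}.
Local Open Scope ereal_scope.

(** The estimator is an arbitrary almost sure minimizer, so that its loss comes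
    with no measurability in the sample.  The integral of a nonnegative function
    is a supremum over simple functions below it, which is monotone without any
    measurability of the smaller function. *)
Lemma ae_le_integral_nonmeasurable (f g : T -> \bar R) :
  (forall t, 0 <= f t) -> (forall t, 0 <= g t) -> measurable_fun setT g ->
  {ae mu, forall t, f t <= g t} -> \int[mu]_t f t <= \int[mu]_t g t.
Proof.
move=> f0 g0 mg [N [mN N0 hN]].
(* raising g to +oo on the negligible set makes the inequality pointwise *)
pose g' t := if t \in N then +oo else g t.
have g'0 t : 0 <= g' t by rewrite /g'; case: ifP.
have mg' : measurable_fun setT g'.
  apply: measurable_fun_if => //.
  - apply: (measurable_fun_bool true); rewrite setTI.
    rewrite (_ : _ @^-1` _ = N)//.
    by apply/seteqP; split => t /=; [move=> /set_mem | move/mem_set].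
  - exact: measurable_funTS.
have fg' t : f t <= g' t.
  rewrite /g'; case: ifPn => tN; first exact: leey.
  rewrite leNgt; apply/negP => h; move/negP: tN; apply; apply/mem_set/hN.
  by move=> /=; rewrite leNgt h.
have -> : \int[mu]_t g t = \int[mu]_t g' t.
  apply: ge0_ae_eq_integral => //.
  exists N; split => // t /= h; apply: contrapT => tN; apply: h => _.
  by rewrite /g' memNset.
rewrite !ge0_integralTE//; apply: ge_ereal_sup => _ [h hf <-].
apply: ereal_sup_ubound; exists h => // t.
exact: le_trans (hf t) (fg' t).
Qed.

End ae_integral.

Section law_transfer.
Context {R : realType} {d : nat}.
Variables (P0 P : probability 'cV[R]_d R) (m : 'cV[R]_d) (S : 'M[R]_d).
Hypothesis law : location_scale P m S P0.
Local Open Scope ereal_scope.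

Let g (x : 'cV[R]_d) : 'cV[R]_d := (m + sqrtmx S *m x)%R.
Let mg : measurable_fun setT g := measurable_affine m (sqrtmx S).

Lemma location_scale_integral (f : 'cV[R]_d -> \bar R) :
  measurable_fun setT f -> (forall x, 0 <= f x) ->
  \int[P]_x f x = \int[P0]_x f (g x).
Proof.
move=> mf f0; rewrite (eq_measure_integral (pushforward P0 g)); last first.
  by move=> A mA _; exact: law.
by rewrite ge0_integral_pushforward// => y _.
Qed.

End law_transfer.

Section standardization.
Context {R : realType} {d : nat}.
Variables (P0 P : probability 'cV[R]_d R) (mP mQ : 'cV[R]_d) (SP SQ : 'M[R]_d).
Hypotheses (P0_centered : centered P0) (P0_isotropic : isotropic P0).
Hypotheses (SP_psd : psdmx SP) (SP_unit : SP \in unitmx) (SQ_psd : psdmx SQ).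
Hypothesis P_law : location_scale P mP SP P0.

Local Notation S := (sqrtmx SP).
Local Notation L := (sqrtmx SQ).
Local Notation Si := (invmx S).
Local Notation A := (sqrtmx (S *m SQ *m S)).

Lemma sqrt_sym : S^T = S. Proof. by have [[]] := sqrtmxP SP_psd. Qed.

Lemma sqrt_unit : S \in unitmx.
Proof.
have [_ SS] := sqrtmxP SP_psd.
by move: SP_unit; rewrite -{1}SS unitmx_mul => /andP[].
Qed.

Lemma invsqrt_sym : Si^T = Si.
Proof. by rewrite trmx_inv sqrt_sym. Qed.

Lemma conj_psd (B : 'M[R]_d) : psdmx B -> psdmx (S *m B *m S).
Proof.
move=> [Bt B0]; split; first by rewrite !trmx_mul sqrt_sym Bt mulmxA.
by move=> x; rewrite -!mulmxA dotv_sym ?sqrt_sym//.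
Qed.

Lemma brenierA_psd : psdmx A /\ A *m A = S *m SQ *m S.
Proof. exact/sqrtmxP/conj_psd. Qed.

Section data.
Variables (n : nat) (X Y : 'I_n -> 'cV[R]_d).

Definition std_x i : 'cV[R]_d := Si *m X i + - (Si *m mP).
Definition std_y j : 'cV[R]_d := S *m Y j + - (S *m mQ).

Hypothesis n0 : (0 < n)%N.
Let cardT : (0 < #|[set: 'I_n]%SET|)%N.
Proof. by rewrite cardsT card_ord. Qed.

Local Notation mX := (mean [set: 'I_n]%SET X).
Local Notation mY := (mean [set: 'I_n]%SET Y).

Lemma mean_std_x : mean [set: 'I_n]%SET std_x = Si *m (mX - mP).
Proof. by rewrite mean_affine// mulmxBr. Qed.

Lemma mean_std_y : mean [set: 'I_n]%SET std_y = S *m (mY - mQ).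
Proof. by rewrite mean_affine// mulmxBr. Qed.

(** The factors S and its inverse cancel in the middle, so that the standardized
    matrix S B S matches the standardized covariances. *)
Lemma std_cov_eq (B : 'M[R]_d) :
  B *m cov [set: 'I_n]%SET X *m B = cov [set: 'I_n]%SET Y ->
  (S *m B *m S) *m cov [set: 'I_n]%SET std_x *m (S *m B *m S)
  = cov [set: 'I_n]%SET std_y.
Proof.
move=> BXB; rewrite !cov_affine// invsqrt_sym sqrt_sym -BXB.
have SSi : S *m Si = 1%:M by rewrite mulmxV// sqrt_unit.
have SiS : Si *m S = 1%:M by rewrite mulVmx// sqrt_unit.
have h (M C : 'M[R]_d) : (S *m M *m S) *m (Si *m C *m Si) *m (S *m M *m S)
    = S *m (M *m C *m M) *m S.
  transitivity (S *m M *m (S *m Si) *m C *m (Si *m S) *m M *m S); first by rewrite !mulmxA.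
  by rewrite SSi SiS !mulmx1 !mulmxA.
exact: h.
Qed.

(** The second sample lies in the range of the scale matrix around its mean,
    so the estimator, too, vanishes on the kernel of A. *)
Lemma std_range (B : 'M[R]_d) (l : R) :
  psdmx B -> B *m cov [set: 'I_n]%SET X *m B = cov [set: 'I_n]%SET Y ->
  (forall j, exists w, Y j = mQ + L *m w) ->
  (forall v, sqnorm v <= l * dotv v (cov [set: 'I_n]%SET std_x *m v)) ->
  exists E, S *m B *m S = E *m A.
Proof.
move=> Bpsd BXB Yrange hl.
have [[Lt L0] LL] := sqrtmxP SQ_psd.
have [[At A0] AA] := brenierA_psd.
have [Bt _] := conj_psd Bpsd.
suff ker (v : 'cV[R]_d) : A *m v = 0 -> (S *m B *m S) *m v = 0.
  have : ((S *m B *m S) <= A)%MS.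
    rewrite submxE; apply/eqP/matrixP => i j.
    have := ker (col j (cokermx A)); rewrite -!col_mulmx mulmx_coker col0.
    by move=> /(_ erefl)/colP/(_ i); rewrite !mxE.
  by move=> /submxP[E ->]; exists E.
move=> Av.
have LSv : L *m (S *m v) = 0.
  apply: sqnorm_eq0; rewrite /sqnorm -dotv_sym// -dotv_sym ?sqrt_sym//.
  have -> : S *m (L *m (L *m (S *m v))) = S *m (L *m L) *m S *m v by rewrite !mulmxA.
  by rewrite LL -AA -mulmxA Av mulmx0 dotv0r.
have uv j : dotv v (std_y j) = 0.
  have [w Yw] := Yrange j.
  rewrite /std_y Yw -mulmxN -mulmxDr [mQ + _]addrC addrK.
  by rewrite dotv_sym ?sqrt_sym// dotv_sym// LSv dotv0l.
have cv : dotv v (cov [set: 'I_n]%SET std_y *m v) = 0.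
  have m0 : dotv v (mean [set: 'I_n]%SET std_y) = 0.
    rewrite dotv_mean; under eq_avg do rewrite uv.
    by rewrite avg_cst.
  rewrite dotv_cov m0 expr0n subr0; under eq_avg do rewrite uv expr0n.
  by rewrite avg_cst.
apply: sqnorm_eq0; apply/eqP; rewrite eq_le sqnorm_ge0 andbT.
apply: le_trans (hl _) _.
have := cv; rewrite -(std_cov_eq BXB).
move: (S *m B *m S) Bt (cov _ std_x) => B' B't C.
by rewrite -!mulmxA dotv_sym// => ->; rewrite mulr0.
Qed.

(** The difference of the gradients is affine, M w + dl in terms of w with law P0,
    and the isotropy of P0 bounds its squared norm. *)
Lemma L2sq_grad_le (B : 'M[R]_d) (b : 'cV[R]_d) : psdmx B -> b + B *m mX = mY ->
  (L2sq P (fun x => (grad (quad B b) x - grad (brenier_potential mP mQ SP SQ) x)%R)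
   <= ((2 * d%:R + 4) * frob2 Si * plug_in_loss A (S *m B *m S) std_x std_y)%:E)%E.
Proof.
move=> Bpsd bE; have [[At _] AA] := brenierA_psd.
have Su := sqrt_unit.
pose M := Si *m (S *m B *m S - A).
pose dl := Si *m mean [set: 'I_n]%SET std_y
           - Si *m (S *m B *m S *m mean [set: 'I_n]%SET std_x).
have B0t : (brenier_mx SP SQ)^T = brenier_mx SP SQ.
  by rewrite /brenier_mx !trmx_mul invsqrt_sym At mulmxA.
have gradE x : (grad (quad B b) x - grad (brenier_potential mP mQ SP SQ) x)%R
    = B *m x + b - (brenier_mx SP SQ *m (x - mP) + mQ).
  congr (_ - _); last exact: grad_quadratic.
  have := @grad_quadratic R d B 0 b x (proj1 Bpsd); rewrite subr0 => <-.
  suff -> : quad B b = (fun y => 2^-1 * dotv (y - 0) (B *m (y - 0)) + dotv b y) by [].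
  by apply/funext => y; rewrite subr0.
rewrite /L2sq; under eq_integral do rewrite gradE.
have gz (w : 'cV[R]_d) : B *m (mP + S *m w) + b
    - (brenier_mx SP SQ *m (mP + S *m w - mP) + mQ) = M *m w + dl.
  have SiS C : Si *m (S *m C) = C :> 'cV[R]_d by rewrite mulmxA mulVmx// mul1mx.
  have SSi C : S *m (Si *m C) = C :> 'cV[R]_d by rewrite mulmxA mulmxV// mul1mx.
  have e1 : M *m w = B *m (S *m w) - Si *m (A *m w).
    rewrite /M -mulmxA mulmxBl mulmxBr -!mulmxA SiS//.
  have e2 : dl = (mY - mQ) - B *m (mX - mP).
    by rewrite /dl mean_std_x mean_std_y SiS -!mulmxA SSi SiS.
  have e3 : brenier_mx SP SQ *m (mP + S *m w - mP) = Si *m (A *m w).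
    by rewrite [mP + _]addrC addrK /brenier_mx -!mulmxA SiS.
  rewrite e1 e2 e3 -bE mulmxDr mulmxBr.
  move: (B *m mP) (B *m (S *m w)) (Si *m (A *m w)) (B *m mX) => p q r s.
  by apply/colP => i; rewrite !mxE; ring.
pose K := B - brenier_mx SP SQ; pose k := b + brenier_mx SP SQ *m mP - mQ.
have hK x : B *m x + b - (brenier_mx SP SQ *m (x - mP) + mQ) = k + K *m x.
  rewrite /k /K mulmxBr mulmxBl.
  move: (B *m x) (brenier_mx SP SQ *m x) (brenier_mx SP SQ *m mP) => p q r.
  by apply/colP => i; rewrite !mxE; ring.
rewrite (location_scale_integral P_law); last 2 first.
- under eq_fun do rewrite hK.
  apply/measurable_EFinP.
  exact: (measurableT_comp (@measurable_sqnorm R d) (measurable_affine k K)).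
- by move=> x; rewrite lee_fin sqnorm_ge0.
under eq_integral do rewrite gz.
have intw : (\int[P0]_x (sqnorm x)%:E = d%:R%:E)%E.
  under eq_integral do rewrite sqnormE -sumEFin.
  rewrite ge0_integral_sum//; last 2 first.
  - by move=> i; apply/measurable_EFinP; apply: measurable_funX; exact: measurable_coord.
  - by move=> i x _; rewrite lee_fin sqr_ge0.
  under eq_bigr do under eq_integral do rewrite expr2.
  under eq_bigr do rewrite (cov_coord P0_centered P0_isotropic) eqxx.
  by rewrite sumEFin sumr_const card_ord.
have f0 := frob2_ge0 M; have fi := frob2_ge0 Si.
have msq := @measurable_sqnorm R d.
apply: (@le_trans _ _ (\int[P0]_w ((2 * frob2 M)%:E * (sqnorm w)%:E + (2 * sqnorm dl)%:E))%E).
  apply: ge0_le_integral => //.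
  - by move=> w _; rewrite lee_fin sqnorm_ge0.
  - apply/measurable_EFinP.
    under eq_fun do rewrite addrC.
    exact: (measurableT_comp msq (measurable_affine dl M)).
  - apply: emeasurable_funD => //; apply: emeasurable_funM => //; exact/measurable_EFinP.
  - move=> w _; rewrite -EFinM -EFinD lee_fin.
    apply: le_trans (sqnormD_le _ _) _; rewrite lerD2r -mulrA ler_wpM2l//.
    exact: sqnorm_mulmx_le.
rewrite ge0_integralD//; last 3 first.
- by move=> w _; rewrite -EFinM lee_fin !mulr_ge0// sqnorm_ge0.
- by apply: emeasurable_funM => //; exact/measurable_EFinP.
- by move=> w _; rewrite lee_fin mulr_ge0// sqnorm_ge0.
rewrite ge0_integralZl//; last 3 first.
- exact/measurable_EFinP.
- by move=> w _; rewrite lee_fin sqnorm_ge0.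
- by rewrite lee_fin mulr_ge0.
rewrite intw integral_prob_cst -EFinM -EFinD lee_fin.
rewrite /plug_in_loss.
set mz := mean _ std_x; set mu := mean _ std_y; set Bt := S *m B *m S.
have hM : frob2 M <= frob2 Si * frob2 (Bt - A) by exact: frob2M_le.
have hdl : sqnorm dl <= 2 * (frob2 Si * sqnorm mu) + 2 * (frob2 Si * (frob2 Bt * sqnorm mz)).
  apply: le_trans (sqnormD_le _ _) _; rewrite sqnormN; apply: lerD.
    by rewrite ler_wpM2l//; exact: sqnorm_mulmx_le.
  rewrite ler_wpM2l//; apply: le_trans (sqnorm_mulmx_le _ _) _.
  by rewrite ler_wpM2l//; exact: sqnorm_mulmx_le.
have p1 : 0 <= frob2 Si * frob2 (Bt - A) by rewrite mulr_ge0// frob2_ge0.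
have p2 : 0 <= frob2 Si * sqnorm mu by rewrite mulr_ge0// sqnorm_ge0.
have p3 : 0 <= frob2 Si * (frob2 Bt * sqnorm mz).
  by rewrite !mulr_ge0// ?sqnorm_ge0 ?frob2_ge0.
have dr : 0 <= d%:R :> R by [].
have q2 := mulr_ge0 dr p2; have q3 := mulr_ge0 dr p3.
have q1 : frob2 M * d%:R <= frob2 Si * frob2 (Bt - A) * d%:R by rewrite ler_wpM2r.
by lra.
Qed.

End data.

End standardization.

(** * Expectation of the majorant *)

Section majorant.
Context {R : realType} {d : nat} {dO : measure_display}
  {Omega : measurableType dO}.
Variables (Pr : probability Omega R) (n : nat).
Variables (Z W : 'I_n -> {RV Pr >-> 'cV[R]_d}) (T : 'M[R]_d) (H1 H2 H3 : {set 'I_n}).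
Local Open Scope ereal_scope.

Local Notation V w := (fluct [set: 'I_n]%SET T (fun j => W j w)).
Local Notation U w := (fluct [set: 'I_n]%SET 1%:M (fun j => Z j w)).
Local Notation U2 w := (fluct H2 1%:M (fun j => Z j w)).
Local Notation U3 w := (fluct H3 1%:M (fun j => Z j w)).

(** In each product the factors depend on disjoint, hence independent, parts of
    the data. *)
Definition majorant (w : Omega) : \bar R :=
  (V w)%:E + (1 + V w)%:E * (U w)%:E
  + n%:R%:E * ((1 + V w)%:E * ((1 + degeneracy Z H1 w) * ((U2 w)%:E * (U3 w)%:E))).

Hypothesis ind : mutually_independent (fun k : 'I_n + 'I_n =>
  match k with inl i => Z i | inr j => W j end).
Hypotheses (H20 : (0 < #|H2|)%N) (H30 : (0 < #|H3|)%N).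
Hypotheses (dH1 : [disjoint (H2 :|: H3)%SET & H1]%B) (dH2 : [disjoint H2 & H3]%B).
Hypothesis n0 : (0 < n)%N.

Let cardT : (0 < #|[set: 'I_n]%SET|)%N.
Proof. by rewrite cardsT card_ord. Qed.

Let indZ : mutually_independent Z := independent_inl ind.

Let psi1_ge0 w : 0 <= 1 + degeneracy Z H1 w.
Proof. by rewrite adde_ge0// ?lee_fin// degeneracy_ge0. Qed.

Let gE (H : {set 'I_n}) (f : Omega -> R) (Y : 'I_n -> {RV Pr >-> 'cV[R]_d}) :
  group_measurable Y H f -> group_measurable Y H (EFin \o f).
Proof. exact: group_measurable_comp. Qed.

Let gU2 : group_measurable Z H2 (fun w => (U2 w)%:E).
Proof. exact: (gE (group_measurable_fluct _ H20)). Qed.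
Let gU3 : group_measurable Z H3 (fun w => (U3 w)%:E).
Proof. exact: (gE (group_measurable_fluct _ H30)). Qed.
Let gU : group_measurable Z [set: 'I_n]%SET (fun w => (U w)%:E).
Proof. exact: (gE (group_measurable_fluct _ cardT)). Qed.
Let gV : group_measurable W [set: 'I_n]%SET (fun w => (1 + V w)%:E).
Proof.
apply: gE; have m1 : measurable_fun setT (fun x : R => 1 + x)%R by exact: measurable_funD.
exact: (group_measurable_comp m1 (group_measurable_fluct _ cardT)).
Qed.
Let gU23 : group_measurable Z (H2 :|: H3)%SET (fun w => (U2 w)%:E * (U3 w)%:E).
Proof.
apply: emeasurable_funM.
- exact: group_measurableS (finset.subsetUl _ _) gU2.
- exact: group_measurableS (finset.subsetUr _ _) gU3.
Qed.
Let gpsi : group_measurable Z H1 (fun w => 1 + degeneracy Z H1 w).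
Proof. apply: emeasurable_funD => //; exact: degeneracy_group_measurable. Qed.
Let gpU : group_measurable Z [set: 'I_n]%SET
  (fun w => (1 + degeneracy Z H1 w) * ((U2 w)%:E * (U3 w)%:E)).
Proof.
apply: emeasurable_funM.
- exact: group_measurableS (finset.subsetT _) gpsi.
- exact: group_measurableS (finset.subsetT _) gU23.
Qed.

Let fl0 H S (f : 'I_n -> 'cV[R]_d) : 0 <= (fluct H S f)%:E.
Proof. by rewrite lee_fin fluct_ge0. Qed.

Let V1_ge0 w : 0 <= (1 + V w)%:E.
Proof. by rewrite lee_fin addr_ge0// fluct_ge0. Qed.

Lemma majorant_ge0 w : 0 <= majorant w.
Proof.
by rewrite /majorant adde_ge0 ?adde_ge0 ?mule_ge0// ?mule_ge0// ?mule_ge0// lee_fin.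
Qed.

Let mV : measurable_fun setT (fun w => (V w)%:E).
Proof. exact: group_measurable_fun (gE (group_measurable_fluct _ cardT)). Qed.

Lemma measurable_majorant : measurable_fun setT majorant.
Proof.
have mV1 := group_measurable_fun gV.
apply: emeasurable_funD.
  apply: emeasurable_funD => //; apply: emeasurable_funM => //.
  exact: group_measurable_fun gU.
apply: emeasurable_funM => //; apply: emeasurable_funM => //.
exact: group_measurable_fun gpU.
Qed.

(** The two samples, and the three groups within the first sample, are
    independent, so the expectation of each product factorizes. *)
Lemma majorant_integral :
  \int[Pr]_w majorant w <=
  \int[Pr]_w (V w)%:E + (1 + \int[Pr]_w (V w)%:E) * \int[Pr]_w (U w)%:E
  + n%:R%:E * ((1 + \int[Pr]_w (V w)%:E) * ((1 + \int[Pr]_w degeneracy Z H1 w) *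
     (\int[Pr]_w (U2 w)%:E * \int[Pr]_w (U3 w)%:E))).
Proof.
have mV1 := group_measurable_fun gV.
have mU := group_measurable_fun gU.
have mpU := group_measurable_fun gpU.
have mpsi : measurable_fun setT (degeneracy Z H1).
  by apply: (@group_measurable_fun _ _ _ _ _ _ _ Z _ _ H1); exact: degeneracy_group_measurable.
have i1V : \int[Pr]_w (1 + V w)%:E = 1 + \int[Pr]_w (V w)%:E.
  under eq_integral do rewrite EFinD.
  by rewrite ge0_integralD// integral_prob_cst.
have i1p : \int[Pr]_w (1 + degeneracy Z H1 w) = 1 + \int[Pr]_w degeneracy Z H1 w.
  by rewrite ge0_integralD ?integral_prob_cst// => w _; exact: degeneracy_ge0.
have dis : [disjoint
   [set k : 'I_n + 'I_n | if k is inr j then j \in [set: 'I_n]%SET else false]%SET &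
   [set k : 'I_n + 'I_n | if k is inl i then i \in [set: 'I_n]%SET else false]%SET]%B.
  by rewrite finset.disjoints_subset; apply/fintype.subsetP => -[i|j]; rewrite !inE.
have gVs := @group_measurable_inr _ _ _ _ _ _ _ _ Z W _ _ _ _ gV.
have prodE (F : Omega -> \bar R) : (forall w, 0 <= F w) ->
    group_measurable Z [set: 'I_n]%SET F ->
    \int[Pr]_w ((1 + V w)%:E * F w) = (1 + \int[Pr]_w (V w)%:E) * \int[Pr]_w F w.
  move=> F0 gF.
  by rewrite (group_integralM ind dis gVs (@group_measurable_inl _ _ _ _ _ _ _ _ Z W _ _ _ _ gF))// i1V.
have pU0 w : 0 <= (1 + degeneracy Z H1 w) * ((U2 w)%:E * (U3 w)%:E).
  by rewrite mule_ge0// mule_ge0.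
rewrite /majorant ge0_integralD//; last 4 first.
- by move=> w _; rewrite adde_ge0// mule_ge0.
- by apply: emeasurable_funD => //; apply: emeasurable_funM.
- by move=> w _; rewrite mule_ge0 ?lee_fin// mule_ge0.
- by apply: emeasurable_funM => //; apply: emeasurable_funM.
rewrite ge0_integralD//; last 2 first.
- by move=> w _; rewrite mule_ge0.
- exact: emeasurable_funM.
rewrite ge0_integralZl ?lee_fin//; last 2 first.
- exact: emeasurable_funM.
- by move=> w _; rewrite mule_ge0.
rewrite (prodE _ _ gU)// (prodE _ pU0 gpU).
rewrite (group_integralM indZ _ gpsi gU23)//; last 2 first.
- by rewrite disjoint_sym.
- by move=> w; rewrite mule_ge0.
by rewrite (group_integralM indZ dH2 gU2 gU3)// i1p.
Qed.

End majorant.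

(** * Standardized samples and their groups *)

Section affine_transforms.
Context {R : realType} {d : nat}.
Implicit Types (k : 'cV[R]_d) (K : 'M[R]_d).

Definition affine k K (x : 'cV[R]_d) : 'cV[R]_d := K *m x + k.

Lemma measurable_affine_fun k K : measurable_fun setT (affine k K).
Proof. rewrite /affine; under eq_fun do rewrite addrC; exact: measurable_affine. Qed.

HB.instance Definition _ k K :=
  isMeasurableFun.Build _ _ _ _ (affine k K) (measurable_affine_fun k K).

Lemma affine_law (P0 P : probability 'cV[R]_d R) (m : 'cV[R]_d) (S K : 'M[R]_d)
    (k : 'cV[R]_d) (dO : measure_display) (Omega : measurableType dO)
    (Pr : probability Omega R) (Z : {RV Pr >-> 'cV[R]_d}) (B : set 'cV[R]_d) :
  location_scale P m S P0 -> has_law Z P -> measurable B ->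
  distribution Pr (affine k K \o Z) B = P0 [set x | B (affine k K (m + sqrtmx S *m x))].
Proof.
move=> law lawZ mB.
have mg : measurable (affine k K @^-1` B).
  by rewrite -[X in measurable X]setTI; exact: measurable_affine_fun.
by have := lawZ _ mg; rewrite law.
Qed.

(** The product rule for the images is the product rule for the preimages of
    the sets under the affine maps. *)
Lemma affine_independent (k1 k2 : 'cV[R]_d) (K1 K2 : 'M[R]_d)
    (dO : measure_display) (Omega : measurableType dO)
    (Pr : probability Omega R) (I J : finType) (X : I -> {RV Pr >-> 'cV[R]_d})
    (Y : J -> {RV Pr >-> 'cV[R]_d}) :
  mutually_independent (fun k : I + J => match k with inl i => X i | inr j => Y j end) ->
  mutually_independent (fun k : I + J => match k with
    | inl i => (affine k1 K1 \o X i)%FUN : {RV Pr >-> 'cV[R]_d}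
    | inr j => (affine k2 K2 \o Y j)%FUN : {RV Pr >-> 'cV[R]_d} end).
Proof.
move=> ind A mA.
pose A' (k : I + J) := match k with inl _ => affine k1 K1 | inr _ => affine k2 K2 end @^-1` A k.
have mA' p : measurable (A' p).
  by case: p => i; rewrite /A' -[X in measurable X]setTI; exact: measurable_affine_fun.
apply: etrans (etrans _ (ind A' mA')) _; last by apply: eq_bigr => -[i|j] _.
by congr (Pr _); apply: eq_bigcapr => -[i|j] _.
Qed.

End affine_transforms.

Section scaled_moments.
Context {R : realType}.

(** Moments under an image measure are moments of the composition. *)
Lemma centered_L2_distribution {d1 d2 : measure_display} {T1 : measurableType d1}
    {T2 : measurableType d2} (P : probability T1 R) (g : {RV P >-> T2})
    (f : T2 -> R) :
  measurable_fun setT f -> centered_L2 P (f \o g) -> centered_L2 (distribution P g) f.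
Proof.
move=> mf [_ /integrableP[_ fi] f0].
have lawg : has_law g (distribution P g) by [].
have mf2 : measurable_fun setT (fun t => (f t ^+ 2)%:E).
  by apply/measurable_EFinP; exact: measurable_funX.
split => //.
- apply/integrableP; split => //.
  rewrite -(ge0_integral_law lawg)//; exact: measurableT_comp.
- by rewrite -(integral_law lawg)//; exact/measurable_EFinP.
Qed.

Context {d : nat}.
Variable P : probability 'cV[R]_d R.
Hypotheses (Pc : centered P) (Pi : isotropic P) (Pp : poincare P).
Variable M : 'M[R]_d.

Lemma scaled_centered_L2 k :
  centered_L2 (distribution P (affine 0 M)) (fun y => y k 0).
Proof.
apply: centered_L2_distribution; first exact: measurable_coord.
have -> : (fun y : 'cV[R]_d => y k 0) \o affine 0 M = (fun x => \sum_j M k j * x j 0).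
  by apply/funext => x /=; rewrite /affine addr0 mxE.
apply: centered_L2_sum => j; apply: centered_L2Z; exact: centered_L2_coord.
Qed.

Lemma scaled_centered_L2_2 k l :
  centered_L2 (distribution P (affine 0 M)) (fun y => y k 0 * y l 0 - (M *m M^T) k l).
Proof.
apply: centered_L2_distribution.
  by apply: measurable_funB => //; apply: measurable_funM; exact: measurable_coord.
have -> : (fun y : 'cV[R]_d => y k 0 * y l 0 - (M *m M^T) k l) \o affine 0 M =
    (fun x => \sum_i \sum_j (M k i * M l j) * (x i 0 * x j 0 - (i == j)%:R)).
  apply/funext => x /=; rewrite /affine addr0 !mxE mulr_suml -sumrB.
  apply: eq_bigr => i _; rewrite mulr_sumr mxE.
  rewrite (bigD1 i)//= [in RHS](bigD1 i)//= eqxx.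
  under [in RHS]eq_bigr => j /negPf ji do rewrite eq_sym ji subr0.
  under eq_bigr do rewrite mulrACA.
  by rewrite mulrBr mulr1 mulrACA addrAC.
apply: centered_L2_sum => i; apply: centered_L2_sum => j; apply: centered_L2Z.
exact: centered_L2_coord2.
Qed.

End scaled_moments.

Lemma draw_subset (T : finType) (A : {set T}) k : (k <= #|A|)%N ->
  exists2 H : {set T}, H \subset A & #|H| = k.
Proof.
move=> /card_geqP[s [us <- sA]]; exists [set x in s]%SET.
  by apply/fintype.subsetP => x; rewrite inE; exact: sA.
by rewrite cardsE; exact/card_uniqP.
Qed.

Lemma sample_groups N n : (0 < N)%N -> (4 * N <= n)%N ->
  exists H1 H2 H3 : {set 'I_n},
    [/\ #|H1| = N, (n <= 4 * #|H2|)%N, (n <= 4 * #|H3|)%N &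
     [/\ (H1 :|: H2 :|: H3)%SET = [set: 'I_n]%SET, [disjoint H1 & H2]%B,
      [disjoint H2 & H3]%B & [disjoint (H1 :|: H2)%SET & H3]%B]].
Proof.
move=> N0 nN.
have [|H1 _ c1] := @draw_subset _ [set: 'I_n]%SET N.
  by rewrite cardsT card_ord; lia.
have cC : #|(~: H1)%SET| = (n - N)%N.
  by have := cardsC H1; rewrite card_ord c1; lia.
have [|H2 s2 c2] := @draw_subset _ (~: H1)%SET (n - N)./2.
  by rewrite cC; lia.
have d12 : [disjoint H1 & H2]%B by rewrite disjoint_sym finset.disjoints_subset.
have c12 : #|(H1 :|: H2)%SET| = (N + (n - N)./2)%N.
  by rewrite cardsU (finset.disjoint_setI0 d12) cards0 c1 c2 subn0.
have c3 : #|(~: (H1 :|: H2))%SET| = (n - (N + (n - N)./2))%N.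
  by have := cardsC (H1 :|: H2)%SET; rewrite card_ord c12; lia.
exists H1, H2, (~: (H1 :|: H2))%SET; rewrite c1 c2 c3; split => //; try lia.
split => //.
- by rewrite finset.setUCr.
- rewrite finset.disjoints_subset finset.setCK; exact: finset.subsetUr.
- by rewrite finset.disjoints_subset finset.setCK.
Qed.

(** * Rate of the majorant *)

(** In expectation 1 + V and 1 + degeneracy are bounded, while U2 and U3 are each of
    order 1/n, which leaves n / n^2. *)
Lemma majorant_rate {R : realType} {d : nat} (P0 Q0 : probability 'cV[R]_d R)
    (T : 'M[R]_d) : (0 < d)%N ->
  centered P0 -> isotropic P0 -> poincare P0 -> bounded_directional_density P0 ->
  (forall k, centered_L2 Q0 (fun y => y k 0)) ->
  (forall k l, centered_L2 Q0 (fun y => y k 0 * y l 0 - T k l)) ->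
  exists2 C : R, 0 <= C & forall (n : nat) (H1 H2 H3 : {set 'I_n})
    (dO : measure_display) (Omega : measurableType dO)
    (Pr : probability Omega R) (Z W : 'I_n -> {RV Pr >-> 'cV[R]_d}),
  (0 < n)%N -> #|H1| = (3 * d.+1 + 8)%N -> (n <= 4 * #|H2|)%N -> (n <= 4 * #|H3|)%N ->
  [disjoint (H2 :|: H3)%SET & H1]%B -> [disjoint H2 & H3]%B ->
  two_samples P0 Q0 Z W ->
  (\int[Pr]_w majorant Z W T H1 H2 H3 w <= (C * n%:R^-1)%:E)%E.
Proof.
move=> d0 Pc Pi Pp Pd Q1 Q2.
have P2 k l : centered_L2 P0 (fun y => y k 0 * y l 0 - (1%:M : 'M[R]_d) k l).
  by have := centered_L2_coord2 Pc Pi Pp k l; rewrite mxE.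
have [a a0 ha] := fluct_integral (centered_L2_coord Pc Pi) P2.
have [b b0 hb] := fluct_integral Q1 Q2.
have [M M0 hM] := slab_prob Pd.
have [K4 K40 hK] := fourth_moment Pc Pi Pp.
pose p := 2 * degeneracy_cst (d := d) M K4.
have p0 : 0 <= p by rewrite mulr_ge0// degeneracy_cst_ge0.
exists (b + (1 + b) * a + (1 + b) * ((1 + p) * (16 * a ^+ 2))).
  by rewrite !addr_ge0// !mulr_ge0// ?addr_ge0// exprn_ge0.
move=> n H1 H2 H3 dO Omega Pr Z W n0 c1 n2 n3 dis1 dis2 [lZ lW ind].
have H20 : (0 < #|H2|)%N by lia.
have H30 : (0 < #|H3|)%N by lia.
have cT : #|[set: 'I_n]%SET| = n by rewrite cardsT card_ord.
have indZ := independent_inl ind; have indW := independent_inr ind.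
have nr : 0 < n%:R :> R by rewrite ltr0n.
pose t : R := n%:R^-1.
have t0 : 0 <= t by rewrite invr_ge0.
have nt : n%:R * t = 1 by rewrite mulfV// gt_eqF.
have t1 : t <= 1 by rewrite invf_le1// ler1n.
have inv4 (H : {set 'I_n}) : (0 < #|H|)%N -> (n <= 4 * #|H|)%N -> a / #|H|%:R <= 4 * a * t.
  move=> H0 nH; rewrite [4 * a]mulrC -mulrA ler_wpM2l//.
  rewrite /t ler_pdivlMr// mulrC ler_pdivrMr ?ltr0n//.
  by rewrite -natrM ler_nat.
have hU : (\int[Pr]_w (fluct [set: 'I_n]%SET 1%:M (fun j => Z j w))%:E <= (a * t)%:E)%E.
  by have := ha _ _ _ _ Z [set: 'I_n]%SET indZ lZ; rewrite cT; apply.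
have hV : (\int[Pr]_w (fluct [set: 'I_n]%SET T (fun j => W j w))%:E <= (b * t)%:E)%E.
  by have := hb _ _ _ _ W [set: 'I_n]%SET indW lW; rewrite cT; apply.
have hU2 : (\int[Pr]_w (fluct H2 1%:M (fun j => Z j w))%:E <= (4 * a * t)%:E)%E.
  by apply: le_trans (ha _ _ _ _ _ _ indZ lZ H20) _; rewrite lee_fin inv4.
have hU3 : (\int[Pr]_w (fluct H3 1%:M (fun j => Z j w))%:E <= (4 * a * t)%:E)%E.
  by apply: le_trans (ha _ _ _ _ _ _ indZ lZ H30) _; rewrite lee_fin inv4.
have hpsi : (\int[Pr]_w degeneracy Z H1 w <= p%:E)%E.
  exact: (degeneracy_integral indZ (fun i _ => lZ i) d0 c1 M0 K40 hM hK).
apply: le_trans (majorant_integral _ ind H20 H30 dis1 dis2 n0) _.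
have flI (H : {set 'I_n}) S Y : (0 <= \int[Pr]_w (fluct H S (fun j : 'I_n => Y j w))%:E)%E.
  by apply: integral_ge0 => w _; rewrite lee_fin fluct_ge0.
have psiI : (0 <= \int[Pr]_w degeneracy Z H1 w)%E by apply: integral_ge0 => w _; exact: degeneracy_ge0.
apply: (@le_trans _ _ ((b * t)%:E + (1 + (b * t)%:E) * (a * t)%:E + n%:R%:E *
   ((1 + (b * t)%:E) * ((1 + p%:E) * ((4 * a * t)%:E * (4 * a * t)%:E))))%E).
  apply: leeD.
    by apply: leeD => //; apply: lee_pmul => //; [exact: adde_ge0 | exact: leeD].
  apply: lee_wpmul2l; first by rewrite lee_fin.
  apply: lee_pmul; [exact: adde_ge0| |exact: leeD|].
    apply: mule_ge0; [exact: adde_ge0|exact: mule_ge0].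
  apply: lee_pmul; [exact: adde_ge0|exact: mule_ge0|exact: leeD|exact: lee_pmul].
rewrite -!(EFinD, EFinM) lee_fin.
have -> : n%:R * ((1 + b * t) * ((1 + p) * (4 * a * t * (4 * a * t))))
   = (1 + b * t) * ((1 + p) * (16 * a ^+ 2)) * t * (n%:R * t) by ring.
rewrite nt mulr1 -/t !mulrDl.
have bt : b * t <= b by rewrite ler_piMr.
have q1 : 0 <= a * t by rewrite mulr_ge0.
have q2 : 0 <= (1 + p) * (16 * a ^+ 2) * t.
  by rewrite !mulr_ge0// ?addr_ge0// exprn_ge0.
have h1 := ler_wpM2r q1 bt; have h2 := ler_wpM2r q2 bt.
rewrite -mulrA in h2; lra.
Qed.

(** Q is carried by the affine subspace of the points mQ + L v, which is the zero
    set of a measurable function. *)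
Lemma sample_range {R : realType} {d : nat} (P0 Q : probability 'cV[R]_d R)
    (mQ : 'cV[R]_d) (SQ : 'M[R]_d) (dO : measure_display)
    (Omega : measurableType dO) (Pr : probability Omega R) (Y : {RV Pr >-> 'cV[R]_d}) :
  psdmx SQ -> location_scale Q mQ SQ P0 -> has_law Y Q ->
  {ae Pr, forall w, exists v, Y w = mQ + sqrtmx SQ *m v}.
Proof.
move=> SQ_psd law lawY; have [[Lt _] _] := sqrtmxP SQ_psd.
set L := sqrtmx SQ in Lt *.
(* L is symmetric, so that K x = 0 exactly when x is in the range of L *)
pose K : 'M[R]_d := (cokermx L)^T.
have KL v : K *m (L *m v) = 0.
  by apply: trmx_inj; rewrite !trmx_mul trmxK Lt -mulmxA mulmx_coker mulmx0 trmx0.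
pose f y : R := sqnorm (affine (- (K *m mQ)) K y).
have mf : measurable_fun setT f.
  exact: measurableT_comp (@measurable_sqnorm R d) (measurable_affine_fun _ _).
have mE : measurable [set y | f y != 0].
  rewrite (_ : [set _ | _] = ~` (f @^-1` [set 0])); last first.
    by apply/seteqP; split => y /=; [move/eqP | move=> h; apply/eqP].
  by apply: measurableC; rewrite -[X in measurable X]setTI; exact: mf.
exists (Y @^-1` [set y | f y != 0]); split.
- by rewrite -[X in measurable X]setTI; exact: measurable_funP.
- transitivity (distribution Pr Y [set y | f y != 0]); first by [].
  have E0 : (fun x => mQ + L *m x) @^-1` [set y | f y != 0] = set0.
    apply/seteqP; split => // x /=.
    by rewrite /f /affine mulmxDr KL addr0 subrr /sqnorm dotv0l eqxx.
  by rewrite lawY// law// /pushforward E0 measure0.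
- move=> w /= h; apply/negP => /eqP/sqnorm_eq0 fw; apply: h.
  have : K *m (Y w - mQ) = 0 by rewrite mulmxBr.
  move/(congr1 trmx); rewrite trmx_mul trmxK trmx0 => /eqP.
  rewrite -submxE => /submxP[v hv]; exists v^T.
  by rewrite -Lt -trmx_mul -hv trmxK addrC subrK.
Qed.

(** * The loss is below the majorant *)

(** Stated at one point w of the probability space, because the minimizing matrix
    B need not depend measurably on w. *)
Lemma L2sq_le_majorant {R : realType} {d : nat} (P0 P : probability 'cV[R]_d R)
    (mP mQ : 'cV[R]_d) (SP SQ : 'M[R]_d) : (0 < d)%N ->
  centered P0 -> isotropic P0 -> psdmx SP -> SP \in unitmx -> psdmx SQ ->
  location_scale P mP SP P0 ->
  exists2 C : R, 0 <= C & forall (n : nat) (H1 H2 H3 : {set 'I_n})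
    (dO : measure_display) (Omega : measurableType dO)
    (Pr : probability Omega R) (X Y : 'I_n -> {RV Pr >-> 'cV[R]_d})
    (Z W : 'I_n -> {RV Pr >-> 'cV[R]_d}) w phi,
  (0 < n)%N -> #|H1| = (3 * d.+1 + 8)%N -> (n <= 4 * #|H2|)%N -> (n <= 4 * #|H3|)%N ->
  (H1 :|: H2 :|: H3)%SET = [set: 'I_n]%SET ->
  [disjoint H1 & H2]%B -> [disjoint (H1 :|: H2)%SET & H3]%B ->
  (forall i, Z i w = std_x mP SP (fun i => X i w) i) ->
  (forall i, W i w = std_y mQ SP (fun i => Y i w) i) ->
  is_argmin F_quad (semidual (empirical (fun i => X i w)) (empirical (fun i => Y i w))) phi ->
  (forall j, exists v, Y j w = mQ + sqrtmx SQ *m v) ->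
  (L2sq P (fun x => (grad phi x - grad (brenier_potential mP mQ SP SQ) x)%R)
   <= C%:E * majorant Z W (sqrtmx SP *m SQ *m sqrtmx SP) H1 H2 H3 w)%E.
Proof.
move=> d0 Pc Pi SP_psd SP_unit SQ_psd law.
have [Apsd AA] := brenierA_psd SP_psd SQ_psd.
have [C C0 hC] := pathwise_loss d0 Apsd.
set A := sqrtmx (sqrtmx SP *m SQ *m sqrtmx SP) in Apsd AA hC *.
pose K := (2 * d%:R + 4) * frob2 (invmx (sqrtmx SP)).
have K0 : 0 <= K by rewrite mulr_ge0 ?frob2_ge0// addr_ge0// mulr_ge0.
exists (K * (64 * C)); first by rewrite mulr_ge0// mulr_ge0// ltW.
move=> n H1 H2 H3 dO Omega Pr X Y Z W w phi n0 c1 n2 n3 HU D12 D123 ZE WE amin Yr.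
have [B [b [z [Bpsd phiE Yb opt]]]] := argmin_quad n0 amin.
have BXB := optimal_cov n0 Bpsd Yb opt.
have bE := optimal_mean n0 Bpsd Yb opt.
rewrite phiE; apply: le_trans (L2sq_grad_le mQ Pc Pi SP_psd SP_unit SQ_psd law n0 Bpsd bE) _.
rewrite EFinM [X in (_ <= X * _)%E]EFinM -muleA; apply: lee_wpmul2l; first by rewrite lee_fin.
have H10 : (0 < #|H1|)%N by rewrite c1 addn_gt0 orbT.
have J0 : (0 < #|'I_n|)%N by rewrite card_ord.
have Ze : (fun i => Z i w) = std_x mP SP (fun i => X i w) by exact/funext.
have We : (fun i => W i w) = std_y mQ SP (fun i => Y i w) by exact/funext.
have Bt := conj_psd SP_psd Bpsd.
have range l := std_range (mP := mP) SP_psd SP_unit SQ_psd n0 (l := l) Bpsd BXB Yr.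
have := hC n 'I_n H1 H2 H3 _ _ _ J0 H10 n2 n3 HU D12 D123 Bt
  (std_cov_eq mP mQ SP_psd SP_unit n0 BXB) range.
rewrite -/A -Ze -We AA.
move: (plug_in_loss _ _ _ _) => loss.
rewrite /majorant.
have V0 := fluct_ge0 [set: 'I_n]%SET (sqrtmx SP *m SQ *m sqrtmx SP) (fun i => W i w).
have U0 := fluct_ge0 [set: 'I_n]%SET 1%:M (fun i => Z i w).
have U20 := fluct_ge0 H2 1%:M (fun i => Z i w).
have U30 := fluct_ge0 H3 1%:M (fun i => Z i w).
move: (fluct _ _ _) V0 (fluct _ _ _) U0 (fluct _ _ _) U20 (fluct _ _ _) U30 => V V0 U U0 U2 U20 U3 U30.
move=> /= [good badb].
have V1 : 0 <= 1 + V by rewrite addr_ge0.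
have C64 : 0 <= 64 * C by rewrite mulr_ge0// ltW.
have psi1 : (0 <= 1 + degeneracy Z H1 w)%E by rewrite adde_ge0// degeneracy_ge0.
have t3 : (0 <= n%:R%:E * ((1 + V)%:E * ((1 + degeneracy Z H1 w) * (U2%:E * U3%:E))))%E.
  by rewrite !mule_ge0// lee_fin.
have t12 : 0 <= V + (1 + V) * U by rewrite addr_ge0// mulr_ge0.
have [U2s|U2l] := leP U2 16^-1; [|have [U3s|U3l] := leP U3 16^-1].
1,2: apply: (@le_trans _ _ ((64 * C)%:E * (V + (1 + V) * U)%:E)%E).
1,3: rewrite -EFinM lee_fin.
1: apply: le_trans (good (or_introl U2s)) _.
2: apply: le_trans (good (or_intror U3s)) _.
1,2: by rewrite ler_wpM2r// ler_peMl// ?(ltW C0)// ler1n.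
1,2: by apply: lee_wpmul2l; rewrite ?lee_fin// EFinD EFinM; exact: leeDl.
(* positive because U2 and U3 exceed 1/16 here *)
pose c := C * (n%:R * (1 + V) * (U2 * U3)).
have c0 : 0 < c.
  have q : 0 < 16^-1 :> R by [].
  by rewrite /c !mulr_gt0// ?ltr0n//; [lra|exact: lt_trans U2l|exact: lt_trans U3l].
have := @degeneracy_bound _ _ _ _ _ _ Z H1 w loss c c0.
move=> /(_ _)/le_trans; apply.
  move=> j nb; have [nb1 nb2] := not_bad_scale d0 c1 nb.
  exact: badb U2l U3l j nb1 nb2.
have -> : ((64 * c)%:E * (1 + degeneracy Z H1 w) = (64 * C)%:E *
   (n%:R%:E * ((1 + V)%:E * ((1 + degeneracy Z H1 w) * (U2%:E * U3%:E)))))%E.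
  rewrite /c !EFinM; move: (1 + degeneracy Z H1 w)%E => y.
  by rewrite [(y * _)%E]muleC !muleA.
apply: lee_wpmul2l; first by rewrite lee_fin.
by rewrite leeDr// -EFinM -EFinD lee_fin.
Qed.

(** * The parametric rate *)

Theorem proposition2 (R : realType) (d : nat) (d_ge2 : (2 <= d)%N)
    (P0 P Q : probability 'cV[R]_d R)
    (mP mQ : 'cV[R]_d) (SP SQ : 'M[R]_d)
    (P0_centered : centered P0) (P0_isotropic : isotropic P0)
    (SP_psd : psdmx SP) (SP_unit : SP \in unitmx) (SQ_psd : psdmx SQ)
    (P_law : location_scale P mP SP P0)
    (Q_law : location_scale Q mQ SQ P0)
    (P0_poincare : poincare P0)
    (P0_density : bounded_directional_density P0) :
  exists (C : R) (k n0 : nat), 0 < C /\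
    forall (n : nat), (n0 <= n)%N ->
    forall (dO : measure_display) (Omega : measurableType dO)
      (Pr : probability Omega R)
      (X Y : 'I_n -> {RV Pr >-> 'cV[R]_d})
      (phihat : Omega -> 'cV[R]_d -> R),
      two_samples P Q X Y ->
      empirical_minimizer F_quad X Y phihat ->
      (\int[Pr]_w
          L2sq P (fun x => (grad (phihat w) x
                            - grad (brenier_potential mP mQ SP SQ) x)%R)
        <= (C * ln n%:R ^+ k * n%:R^-1)%R%:E)%E.
Proof.
have d0 : (0 < d)%N := ltnW d_ge2.
pose S := sqrtmx SP; pose L := sqrtmx SQ; pose Si := invmx S.
have St : S^T = S := sqrt_sym SP_psd.
have Su : S \in unitmx := sqrt_unit SP_psd SP_unit.
have [[Lt _] LL] := sqrtmxP SQ_psd.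
pose Q0 := distribution P0 (affine 0 (S *m L)) : probability 'cV[R]_d R.
have TE : S *m L *m (S *m L)^T = S *m SQ *m S.
  by rewrite trmx_mul St (Lt : L^T = L) !mulmxA -[S *m L *m L]mulmxA (LL : L *m L = SQ).
have Q2 k l : centered_L2 Q0 (fun y => y k 0 * y l 0 - (S *m SQ *m S) k l).
  by rewrite -TE; exact: scaled_centered_L2_2.
have [C1 C10 loss] :=
  L2sq_le_majorant mQ d0 P0_centered P0_isotropic SP_psd SP_unit SQ_psd P_law.
have [C2 C20 rate] := majorant_rate d0 P0_centered P0_isotropic P0_poincare
  P0_density (scaled_centered_L2 P0_centered P0_isotropic (S *m L)) Q2.
exists (C1 * C2 + 1), 0%N, (4 * (3 * d.+1 + 8))%N; split.
  by rewrite ltr_wpDl// mulr_ge0.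
move=> n nN dO Omega Pr X Y phihat [lX lY ind] [_ _ amin].
have n0 : (0 < n)%N by apply: leq_trans nN; rewrite muln_gt0 addn_gt0 orbT.
have [|H1 [H2 [H3 [c1 n2 n3 [HU D12 D23 D123]]]]] := sample_groups _ nN.
  by rewrite addn_gt0 orbT.
pose Z i : {RV Pr >-> 'cV[R]_d} := (affine (- (Si *m mP)) Si \o X i)%FUN.
pose W j : {RV Pr >-> 'cV[R]_d} := (affine (- (S *m mQ)) S \o Y j)%FUN.
have samples : two_samples P0 Q0 Z W.
  split; last exact: affine_independent.
  - move=> i B mB; rewrite (affine_law _ _ P_law (lX i) mB).
    have -> // : [set x | B (affine (- (Si *m mP)) Si (mP + sqrtmx SP *m x))] = B.
    apply/funext => x /=; congr B.
    by rewrite /affine mulmxDr mulmxA mulVmx// mul1mx addrC addKr.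
  - move=> j B mB; rewrite (affine_law _ _ Q_law (lY j) mB).
    have -> // : [set x | B (affine (- (S *m mQ)) S (mQ + sqrtmx SQ *m x))]
        = affine 0 (S *m L) @^-1` B.
    apply/funext => x /=; congr B.
    by rewrite /affine mulmxDr mulmxA addr0 addrC addKr.
have D1 : [disjoint (H2 :|: H3)%SET & H1]%B.
  rewrite disjoint_sym finset.disjoints_subset; apply/fintype.subsetP => i i1.
  rewrite !inE negb_or (disjointFr D12 i1)/= (disjointFr D123)//.
  by rewrite inE i1.
have H20 : (0 < #|H2|)%N by lia.
have H30 : (0 < #|H3|)%N by lia.
pose T := S *m SQ *m S.
have mG : measurable_fun setT (majorant Z W T H1 H2 H3) by exact: measurable_majorant.
have G0 w : (0 <= majorant Z W T H1 H2 H3 w)%E by exact: majorant_ge0.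
apply: (@le_trans _ _ (\int[Pr]_w (C1%:E * majorant Z W T H1 H2 H3 w))%E).
  apply: ae_le_integral_nonmeasurable.
  - by move=> w; apply: integral_ge0 => x _; rewrite lee_fin sqnorm_ge0.
  - by move=> w; apply: mule_ge0.
  - exact: emeasurable_funM.
  - have range : {ae Pr, forall w j, exists v, Y j w = mQ + L *m v}.
      by apply: filter_forall => j; exact: sample_range SQ_psd Q_law (lY j).
    apply: filterS2 amin range => w aw rw.
    exact: (loss n H1 H2 H3 dO Omega Pr X Y Z W w (phihat w) n0 c1 n2 n3 HU D12 D123
      (fun=> erefl) (fun=> erefl) aw rw).
rewrite ge0_integralZl// expr0 mulr1.
apply: le_trans (lee_wpmul2l _ (rate _ _ _ _ _ _ _ _ _ n0 c1 n2 n3 D1 D23 samples)) _ => //.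
by rewrite -EFinM lee_fin mulrA; apply: ler_wpM2r; rewrite ?invr_ge0// lerDl ler01.
Qed.
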